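(* Let $d>1$ be an integer, $\delta\in(0,2)$, and $\lambda>0$ with $\delta\lambda\in(0,2]$. Then for $\boldsymbol z\in\mathbb{R}^d\setminus\{0\}$ with $z=\|\boldsymbol z\|$, the Dagum isotropic spectral density in $\mathbb{R}^d$ is given by $$\widehat{\mathcal D}_{\delta,\lambda}(\boldsymbol z)=-\frac{z^{1-\frac d2}}{2^{\frac d2-1}\pi^{\frac d2+1}}\,\mathrm{Im}\int_0^\infty K_{\frac d2-1}(zt)\left(1-\frac{t^{\delta\lambda}e^{i\pi\delta\lambda/2}}{(1+e^{i\pi\delta/2}t^\delta)^\lambda}\right)t^{d/2}\,\mathrm{d}t .$$
   Context: The Dagum function with parameters $\lambda,\delta>0$ is $\mathcal D_{\lambda,\delta}(r)=1-\left(\frac{r^\delta}{1+r^\delta}\right)^{\lambda}$, $r\ge 0$. Its isotropic spectral density in $\mathbb{R}^d$ is the Fourier transform $$\widehat{\mathcal D}_{\delta,\lambda}(\boldsymbol z)=\frac{1}{(2\pi)^d}\int_{\mathbb{R}^d}e^{-i\boldsymbol z\cdot\boldsymbol r}\,\mathcal D_{\lambda,\delta}(\|\boldsymbol r\|)\,\mathrm{d}\boldsymbol r=\frac{z^{1-d/2}}{(2\pi)^{d/2}}\int_0^\infty u^{d/2}J_{d/2-1}(uz)\,\mathcal D_{\lambda,\delta}(u)\,\mathrm{d}u,\qquad z=\|\boldsymbol z\|.$$ When these integrals do not converge absolutely, the Fourier transform is understood in the sense of tempered distributions (the bounded function $\mathcal D_{\lambda,\delta}(\|\cdot\|)$ being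 a tempered distribution), and $\widehat{\mathcal D}_{\delta,\lambda}(\boldsymbol z)$ for $\boldsymbol z\ne0$ denotes the value of the continuous function representing it on $\mathbb{R}^d\setminus\{0\}$. $J_\nu$ is the Bessel function of the first kind and $K_\nu$ the modified Bessel function of the second kind, of order $\nu$. Complex powers are taken with the principal branch. *)

(* Defs.v *)
From HB Require Import structures.
From mathcomp Require Import all_boot all_order all_algebra.
From mathcomp Require Import all_classical all_reals all_analysis.
From mathcomp Require Export complex.

Set Implicit Arguments.
Unset Strict Implicit.
Unset Printing Implicit Defensive.

Import Order.TTheory GRing.Theory Num.Theory.
Import numFieldNormedType.Exports.

Local Open Scope classical_set_scope.
Local Open Scope ring_scope.
Local Open Scope complex_scope.

(* 'rV[R]_n carries the product (= Borel) sigma-algebra, generated by the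
   coordinates, as the library does for n.-tuple T. *)

Definition measure_rV_display : measure_display -> measure_display.
Proof. exact. Qed.

Section measurable_rV.
Context {R : realType}.
Variable n : nat.

Let coors : 'I_n -> 'rV[R]_n -> measurableTypeR R := fun i x => x ord0 i.

Let rV_set0 : g_sigma_preimage coors set0.
Proof. exact: sigma_algebra0. Qed.

Let rV_setC A : g_sigma_preimage coors A -> g_sigma_preimage coors (~` A).
Proof. exact: sigma_algebraC. Qed.

Let rV_bigcup (F : (set _)^nat) : (forall i, g_sigma_preimage coors (F i)) ->
  g_sigma_preimage coors (\bigcup_i (F i)).
Proof. exact: sigma_algebra_bigcup. Qed.

HB.instance Definition _ := @isMeasurable.Build
  (measure_rV_display default_measure_display)
  'rV[R]_n (g_sigma_preimage coors) rV_set0 rV_setC rV_bigcup.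

Lemma measurable_coord (i : 'I_n) :
  measurable_fun [set: 'rV[R]_n]
    (fun x : 'rV[R]_n => x ord0 i : measurableTypeR R).
Proof.
move=> _ Y mY; rewrite setTI; apply: sub_sigma_algebra => /=.
rewrite -bigcup_seq/=; exists i => /=; first by rewrite mem_index_enum.
by exists Y => //; rewrite setTI.
Qed.

Lemma measurable_fun_rV d (T : measurableType d) (f : T -> 'rV[R]_n) :
  (forall i, measurable_fun setT (fun x => f x ord0 i : measurableTypeR R)) ->
  measurable_fun setT f.
Proof.
move=> mf; suff H : g_sigma_preimage (fun i => coors i \o f) `<=` measurable.
  move=> _ A mA; apply: H; rewrite g_sigma_preimage_comp; exists A => //.
apply: smallest_sub; first exact: sigma_algebra_measurable.
rewrite -bigcup_seq; apply: bigcup_sub => i _.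
by move=> A [B mB <-]; exact: mf.
Qed.

End measurable_rV.

(* The library's sigma-finite instance for product measures is shadowed by the
   one it declares for subprobabilities. *)
Lemma sigma_finite_product d1 d2 (T1 : measurableType d1)
    (T2 : measurableType d2) (R : realType)
    (m1 : {sigma_finite_measure set T1 -> \bar R})
    (m2 : {sigma_finite_measure set T2 -> \bar R}) :
  sigma_finite setT (m1 \x m2)%E.
Proof.
have /sigma_finiteP[F [TF ndF Foo]] := sigma_finiteT m1.
have /sigma_finiteP[G [TG ndG Goo]] := sigma_finiteT m2.
exists (fun n => F n `*` G n).
  rewrite -setXTT TF TG predeqE => -[x y]; split.
    move=> [/= [n _ Fnx] [k _ Gky]]; exists (maxn n k) => //; split.
    - by move: x Fnx; exact/subsetPset/ndF/leq_maxl.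
    - by move: y Gky; exact/subsetPset/ndG/leq_maxr.
  by move=> [n _ []/= ? ?]; split; exists n.
move=> k; have [? ?] := Foo k; have [? ?] := Goo k.
split; first exact: measurableX.
by rewrite product_measure1E// lte_mul_pinfty// ge0_fin_numE.
Qed.

Section lebesgue_rV.
Context {R : realType}.

Definition rV_cons n (p : measurableTypeR R * 'rV[R]_n) : 'rV[R]_n.+1 :=
  row_mx (const_mx p.1 : 'rV_1) p.2.

Definition rV_uncons n (v : 'rV[R]_n.+1) : measurableTypeR R * 'rV[R]_n :=
  (v ord0 ord0, \row_i v ord0 (lift ord0 i)).

Lemma rV_cons0 n p : @rV_cons n p ord0 ord0 = p.1.
Proof.
have -> : ord0 = lshift n ord0 :> 'I_(1 + n) by apply/val_inj.
by rewrite /rV_cons (row_mxEl (const_mx p.1 : 'rV_1)) mxE.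
Qed.

Lemma rV_consS n p i : @rV_cons n p ord0 (lift ord0 i) = p.2 ord0 i.
Proof.
have -> : lift ord0 i = rshift 1 i :> 'I_(1 + n) by apply/val_inj.
by rewrite /rV_cons (row_mxEr (const_mx p.1 : 'rV_1)).
Qed.

Lemma rV_consK n : cancel (@rV_cons n) (@rV_uncons n).
Proof.
move=> p; rewrite /rV_uncons rV_cons0 [RHS]surjective_pairing; congr pair.
by apply/rowP => i; rewrite mxE rV_consS.
Qed.

Lemma measurable_rV_cons n : measurable_fun setT (@rV_cons n).
Proof.
apply: measurable_fun_rV => i.
have [->|[j ->]] : i = ord0 \/ exists j, i = lift ord0 j.
  by case: (unliftP ord0 i) => [j ->|->]; [right; exists j|left].
- by under eq_fun do rewrite rV_cons0; exact: measurable_fst.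
- under eq_fun do rewrite rV_consS.
  exact: (measurableT_comp (measurable_coord j) measurable_snd).
Qed.

Lemma measurable_rV_uncons n : measurable_fun setT (@rV_uncons n).
Proof.
apply: measurable_fun_pair; first exact: measurable_coord.
apply: measurable_fun_rV => i; under eq_fun do rewrite mxE.
exact: measurable_coord.
Qed.

HB.instance Definition _ n :=
  isMeasurableFun.Build _ _ _ _ (@rV_cons n)
    (@measurable_rV_cons n).

Section lebesgue_rVS.
Variables (n : nat) (m : {sigma_finite_measure set 'rV[R]_n -> \bar R}).

Definition lebesgue_rVS : set 'rV[R]_n.+1 -> \bar R :=
  pushforward (lebesgue_measure \x m)%E (@rV_cons n).

Let lebesgue_rVS0 : lebesgue_rVS set0 = 0%E.
Proof. exact: measure0. Qed.

Let lebesgue_rVS_ge0 A : (0 <= lebesgue_rVS A)%E.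
Proof. exact: measure_ge0. Qed.

Let lebesgue_rVS_sigma_additive : semi_sigma_additive lebesgue_rVS.
Proof.
exact: (@measure_semi_sigma_additive _ _ _
  (pushforward (lebesgue_measure \x m)%E (@rV_cons n))).
Qed.

HB.instance Definition _ := isMeasure.Build _ _ _ lebesgue_rVS
  lebesgue_rVS0 lebesgue_rVS_ge0 lebesgue_rVS_sigma_additive.

Let lebesgue_rVS_sigma_finite : sigma_finite setT lebesgue_rVS.
Proof.
have [F TF Foo] := sigma_finite_product (@lebesgue_measure R) m.
exists (fun k => @rV_uncons n @^-1` F k).
  by rewrite -preimage_bigcup -TF preimage_setT.
move=> k; have [mF Fk] := Foo k; split.
  by rewrite -[X in measurable X]setTI; exact: measurable_rV_uncons.
rewrite /lebesgue_rVS /pushforward -comp_preimage.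
rewrite (_ : _ @^-1` _ = F k)//.
by apply/seteqP; split => p; rewrite /preimage/= rV_consK.
Qed.

HB.instance Definition _ := Measure_isSigmaFinite.Build _ _ _ lebesgue_rVS
  lebesgue_rVS_sigma_finite.

End lebesgue_rVS.

Fixpoint lebesgue_rV (n : nat) :
    {sigma_finite_measure set 'rV[R]_n -> \bar R} :=
  match n with
  | 0 => \d_(0 : 'rV[R]_0)
  | n'.+1 => lebesgue_rVS (lebesgue_rV n')
  end.

End lebesgue_rV.
Arguments lebesgue_rV {R} n.

Section complex_functions.
Context {R : realType}.
Implicit Types z w : R[i].

Definition cexp z : R[i] :=
  (expR (complex.Re z) * cos (complex.Im z)) +i*
  (expR (complex.Re z) * sin (complex.Im z)).

Definition cmod z : R := Num.sqrt (complex.Re z ^+ 2 + complex.Im z ^+ 2).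

(* The principal argument, in ]-pi, pi] for z != 0. *)
Definition carg z : R :=
  if complex.Im z < 0 then - acos (complex.Re z / cmod z)
  else acos (complex.Re z / cmod z).

Definition clog z : R[i] := ln (cmod z) +i* carg z.

(* Same convention at z = 0 as powR. *)
Definition cpow z w : R[i] :=
  if z == 0 then (w == 0)%:R else cexp (w * clog z).

End complex_functions.

Section complex_integral.
Context d (T : measurableType d) (R : realType).
Variable mu : {measure set T -> \bar R}.
Implicit Types (D : set T) (f : T -> R[i]).

Definition cintegrable D f : Prop :=
  mu.-integrable D (fun x => (complex.Re (f x))%:E) /\
  mu.-integrable D (fun x => (complex.Im (f x))%:E).

Definition cintegral D f : R[i] :=
  (\int[mu]_(x in D) complex.Re (f x)) +i*
  (\int[mu]_(x in D) complex.Im (f x)).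

End complex_integral.

Section bessel.
Context {R : realType}.
Implicit Types (nu x : R) (K : R -> R).

(* The standard definition of K_nu on the positive half-line (DLMF 10.25):
   the solution of the modified Bessel equation such that
   K_nu(x) ~ sqrt (pi / (2 x)) * exp (- x) at +oo. The second solution of the
   equation grows exponentially, so these properties determine K_nu on
   ]0, +oo[. *)
Definition is_besselK nu K : Prop :=
  [/\ forall x, 0 < x -> derivable K x 1,
      forall x, 0 < x -> derivable (derive1 K) x 1,
      forall x, 0 < x ->
        x ^+ 2 * derive1n 2 K x + x * derive1 K x - (x ^+ 2 + nu ^+ 2) * K x = 0 &
      K x / (Num.sqrt (pi / (2 * x)) * expR (- x)) @[x --> +oo] --> (1 : R)].

(* Meaningful at positive arguments only. *)
Definition besselK nu : R -> R := xget (fun=> 0) (is_besselK nu).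

End bessel.

Section fourier.
Context {R : realType}.
Variable d : nat.
Implicit Types (x y z r : 'rV[R]_d) (f : 'rV[R]_d -> R).

Definition dotp x y : R := \sum_i x ord0 i * y ord0 i.

(* The library's norm on 'rV[R]_d is the sup norm. *)
Definition enorm x : R := Num.sqrt (dotp x x).

Fixpoint Cn (k : nat) f : Prop :=
  continuous f /\
  match k with
  | 0 => True
  | k'.+1 => forall i : 'I_d,
      (forall x, derivable f x (delta_mx ord0 i)) /\
      Cn k' ('D_(delta_mx ord0 i) f)
  end.

Definition smooth f : Prop := forall k, Cn k f.

Definition test_function (U : set 'rV[R]_d) (phi : 'rV[R]_d -> R[i]) : Prop :=
  [/\ smooth (fun x => complex.Re (phi x)),
      smooth (fun x => complex.Im (phi x)) &
      exists2 S : set 'rV[R]_d, compact S /\ S `<=` U &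
        forall x, ~ S x -> phi x = 0].

Definition fourier (phi : 'rV[R]_d -> R[i]) r : R[i] :=
  ((2 * pi) ^- d)%:C *
  cintegral (lebesgue_rV d) setT (fun z => cexp (0 +i* (- dotp z r)) * phi z).

(* F is continuous on R^d \ {0} and represents there the Fourier transform, in
   the sense of tempered distributions, of the bounded function g: the Fourier
   transform of the distribution g is phi |-> \int g (fourier phi), and it is
   compared with F on the test functions supported in R^d \ {0}. *)
Definition fourier_density (g : 'rV[R]_d -> R) (F : 'rV[R]_d -> R[i]) : Prop :=
  (forall z, z != 0 -> {for z, continuous (fun z => complex.Re (F z))} /\
                       {for z, continuous (fun z => complex.Im (F z))}) /\
  (forall phi, test_function [set z | z != 0] phi ->
     cintegral (lebesgue_rV d) setT (fun r => (g r)%:C * fourier phi r) =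
     cintegral (lebesgue_rV d) setT (fun z => F z * phi z)).

End fourier.

Definition dagum {R : realType} (lambda delta r : R) : R :=
  1 - (r `^ delta / (1 + r `^ delta)) `^ lambda.

Definition dagum_spectral_density {R : realType} (d : nat) (delta lambda : R)
    (F : 'rV[R]_d -> R[i]) : Prop :=
  fourier_density (fun r => dagum lambda delta (enorm r)) F.

Definition dagum_integrand {R : realType} (d : nat) (delta lambda z t : R)
    : R[i] :=
  (besselK (d%:R / 2 - 1) (z * t))%:C *
  (1 - (t `^ (delta * lambda))%:C * cexp (0 +i* (pi * (delta * lambda) / 2)) /
       cpow (1 + cexp (0 +i* (pi * delta / 2)) * (t `^ delta)%:C) lambda%:C) *
  (t `^ (d%:R / 2))%:C.

(* Main.v *)
Require Import Defs.
From mathcomp Require Import all_boot all_order all_algebra.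
From mathcomp Require Import all_classical all_reals all_analysis.
From mathcomp Require Import complex.
From mathcomp Require Import measurable_realfun gauss_integral.
From mathcomp Require Import ring lra.

Import Order.TTheory GRing.Theory Num.Theory.
Import numFieldNormedType.Exports.

Local Open Scope classical_set_scope.
Local Open Scope ring_scope.
Local Open Scope complex_scope.

Set Implicit Arguments.
Unset Strict Implicit.
Unset Printing Implicit Defensive.

(** * Calculus on the line *)

Section derivative_rules.
Context {R : realType}.
Implicit Types (f g : R -> R) (x a b : R).

Lemma is_derive1D f g x a b : is_derive x 1 f a -> is_derive x 1 g b ->
  is_derive x 1 (fun y => f y + g y) (a + b).
Proof. exact: is_deriveD. Qed.

Lemma is_derive1B f g x a b : is_derive x 1 f a -> is_derive x 1 g b ->
  is_derive x 1 (fun y => f y - g y) (a - b).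
Proof. exact: is_deriveB. Qed.

Lemma is_derive1N f x a : is_derive x 1 f a ->
  is_derive x 1 (fun y => - f y) (- a).
Proof. exact: is_deriveN. Qed.

Lemma is_derive1M f g x a b : is_derive x 1 f a -> is_derive x 1 g b ->
  is_derive x 1 (fun y => f y * g y) (a * g x + f x * b).
Proof.
move=> df dg; apply: (is_derive_eq (is_deriveM df dg)).
by rewrite /GRing.scale/= addrC (mulrC (g x)).
Qed.

Lemma is_derive1Zl (k : R) f x a : is_derive x 1 f a ->
  is_derive x 1 (fun y => k * f y) (k * a).
Proof. exact: is_deriveZ. Qed.

Lemma is_derive1_comp f g x a b :
  is_derive x 1 f a -> is_derive (f x) 1 g b ->
  is_derive x 1 (fun y => g (f y)) (b * a).
Proof. by move=> df dg; have := is_derive1_comp dg df. Qed.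

Lemma is_derive1V f x a : f x != 0 -> is_derive x 1 f a ->
  is_derive x 1 (fun y => (f y)^-1) (- a / f x ^+ 2).
Proof.
move=> fx0 df; apply: (is_derive_eq (is_deriveV fx0 df)).
by rewrite /GRing.scale/= !mulNr mulrC.
Qed.

Lemma is_derive1_id x : is_derive x 1 (fun y : R => y) 1.
Proof. exact: is_derive_id. Qed.

Lemma is_derive1_cst (c : R) x : is_derive x 1 (fun=> c) 0.
Proof. exact: is_derive_cst. Qed.

Lemma is_derive1_expR f x a : is_derive x 1 f a ->
  is_derive x 1 (fun y => expR (f y)) (expR (f x) * a).
Proof. by move=> df; apply: is_derive1_comp. Qed.

Lemma is_derive1_cos f x a : is_derive x 1 f a ->
  is_derive x 1 (fun y => cos (f y)) (- sin (f x) * a).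
Proof. by move=> df; apply: is_derive1_comp. Qed.

Lemma is_derive1_sin f x a : is_derive x 1 f a ->
  is_derive x 1 (fun y => sin (f y)) (cos (f x) * a).
Proof. by move=> df; apply: is_derive1_comp. Qed.

Lemma is_derive1_continuous f x a : is_derive x 1 f a -> {for x, continuous f}.
Proof. by move=> df; apply/differentiable_continuous/derivable1_diffP. Qed.

Lemma is_derive1_continuousT f f' : (forall x, is_derive x 1 f (f' x)) ->
  continuous f.
Proof. by move=> df x; exact: is_derive1_continuous (df x). Qed.

(** The mean value inequality. *)
Lemma le_dist_derive f f' a b (M : R) : a <= b ->
  (forall x, a <= x <= b -> is_derive x 1 f (f' x)) ->
  (forall x, a <= x <= b -> `|f' x| <= M) -> `|f b - f a| <= M * (b - a).
Proof.
move=> ab df bf.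
have [x|x xab|c cab ->] := @MVT_segment R f f' a b ab.
- by move=> /itvP xab; apply: df; rewrite !xab.
- apply: derivable_within_continuous => y /itvP yab.
  by have := df y; rewrite !yab => /(_ isT) [].
rewrite normrM (ger0_norm (_ : 0 <= b - a)) ?subr_ge0//.
by rewrite ler_wpM2r ?subr_ge0// bf// !(itvP cab).
Qed.

Lemma le_dist_deriveT f f' (M : R) : (forall x, is_derive x 1 f (f' x)) ->
  (forall x, `|f' x| <= M) -> forall a b, `|f b - f a| <= M * `|b - a|.
Proof.
move=> df bf a b; have [ab|ba] := leP a b.
  by rewrite [X in _ <= _ * X]ger0_norm ?subr_ge0//; apply: (@le_dist_derive f f').
rewrite distrC (distrC b) [X in _ <= _ * X]gtr0_norm ?subr_gt0//.
by apply: (@le_dist_derive f f') => //; exact: ltW.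
Qed.

End derivative_rules.

Section integrals.
Context d (T : measurableType d) (R : realType).
Variable mu : {measure set T -> \bar R}.
Implicit Types (f g : T -> R).

Lemma integrable_le f g D : measurable D -> measurable_fun D f ->
  (forall x, D x -> `|f x| <= g x) ->
  mu.-integrable D (EFin \o g) -> mu.-integrable D (EFin \o f).
Proof.
move=> mD mf fg ig; apply: (le_integrable _ _ _ ig) => //.
- exact/measurable_EFinP.
- by move=> x Dx /=; rewrite lee_fin (le_trans (fg x Dx))// ler_norm.
Qed.

Lemma integrableD_R f g D : measurable D -> mu.-integrable D (EFin \o f) ->
  mu.-integrable D (EFin \o g) -> mu.-integrable D (EFin \o (fun x => f x + g x)).
Proof.
move=> mD fi gi; rewrite (_ : _ \o _ = (fun x => (EFin \o f) x + (EFin \o g) x)%E).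
  exact: integrableD.
exact/funext.
Qed.

Lemma integrableB_R f g D : measurable D -> mu.-integrable D (EFin \o f) ->
  mu.-integrable D (EFin \o g) -> mu.-integrable D (EFin \o (fun x => f x - g x)).
Proof.
move=> mD fi gi; rewrite (_ : _ \o _ = (fun x => (EFin \o f) x - (EFin \o g) x)%E).
  exact: integrableB.
exact/funext.
Qed.

Lemma integrableZl_R (k : R) f D : measurable D -> mu.-integrable D (EFin \o f) ->
  mu.-integrable D (EFin \o (fun x => k * f x)).
Proof.
move=> mD fi; rewrite (_ : _ \o _ = (fun x => k%:E * (EFin \o f) x)%E).
  exact: integrableZl.
exact/funext.
Qed.

Lemma integrable_norm_R f D : measurable D -> mu.-integrable D (EFin \o f) ->
  mu.-integrable D (EFin \o (fun x => `|f x|)).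
Proof.
move=> mD fi; rewrite (_ : _ \o _ = (fun x => `|(EFin \o f) x|)%E).
  exact: integrable_abse.
exact/funext.
Qed.

Lemma measurable_integrable f D : mu.-integrable D (EFin \o f) ->
  measurable_fun D f.
Proof. by move=> /measurable_int /measurable_EFinP. Qed.

Lemma EFin_Rintegral f D : measurable D -> mu.-integrable D (EFin \o f) ->
  (\int[mu]_(x in D) f x)%R%:E = (\int[mu]_(x in D) (f x)%:E)%E.
Proof. by move=> mD fi; rewrite /Rintegral fineK//; exact: integrable_fin_num. Qed.

Lemma cvg_Rintegral (f_ : nat -> T -> R) f g :
  (forall n, measurable_fun setT (f_ n)) ->
  {ae mu, forall x, f_ n x @[n --> \oo] --> f x} ->
  mu.-integrable setT (EFin \o g) ->
  (forall n x, `|f_ n x| <= g x) -> measurable_fun setT f ->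
  \int[mu]_x f_ n x @[n --> \oo] --> \int[mu]_x f x.
Proof.
move=> mf_ cf ig f_g mf.
have [] := @dominated_convergence _ _ _ mu setT measurableT
  (fun n => EFin \o f_ n) (EFin \o f) (EFin \o g) => //.
- by move=> n; exact/measurable_EFinP.
- exact/measurable_EFinP.
- by apply: filterS cf => x cfx _; apply: cvg_EFin => //; exact: nearW.
- by apply: aeW => x n _; exact: f_g.
move=> intf _ h.
by apply: fine_cvg; rewrite fineK//; exact: integrable_fin_num.
Qed.

End integrals.

Section integration_on_R.
Context {R : realType}.
Notation mu := (@lebesgue_measure R).
Implicit Types (f F : R -> R) (x a b : R).

Lemma continuous_measurable_setT f : continuous f -> measurable_fun setT f.
Proof. exact: continuous_measurable_fun. Qed.

Let itvn (n : nat) : set R := `[- n.+1%:R, n.+1%:R]%classic.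

Let itvn_nd : nondecreasing_seq itvn.
Proof.
move=> m n mn; apply/subsetPset => x; rewrite /itvn/= !in_itv/= => /andP[a b].
have : m.+1%:R <= n.+1%:R :> R by rewrite ler_nat.
by move=> h; apply/andP; split; lra.
Qed.

Let itvn_bigcup : \bigcup_n itvn n = [set: R].
Proof.
apply/seteqP; split => // x _; exists (Num.truncn `|x|) => //.
rewrite /itvn/= in_itv/= -ler_norml ltW//.
exact: truncnS_gt.
Qed.

Lemma cvg_integral_itvn f : mu.-integrable setT (EFin \o f) ->
  \int[mu]_(x in `[- n.+1%:R, n.+1%:R]) f x @[n --> \oo] --> \int[mu]_x f x.
Proof.
move=> fi; under eq_fun do rewrite Rintegral_mkcond.
apply: (@cvg_Rintegral _ _ _ mu (fun n => f \_ (itvn n)) f (fun x => `|f x|)).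
- move=> n; apply/(measurable_restrictT f); first exact: measurable_itv.
  by apply: measurable_funTS; exact: measurable_integrable fi.
- apply/aeW => x; apply: cvg_near_cst.
  have : (\bigcup_n itvn n) x by rewrite itvn_bigcup.
  case=> N _ xN; exists N => // n /= Nn; rewrite patchE mem_set//.
  by move: x xN; apply/subsetPset/itvn_nd.
- exact: integrable_norm_R.
- by move=> n x; rewrite patchE; case: ifPn => // _; rewrite normr0.
- exact: measurable_integrable fi.
Qed.

Lemma integral_itv_primitive f F a b : a < b -> continuous f ->
  (forall x, is_derive x 1 F (f x)) ->
  (\int[mu]_(x in `[a, b]) (f x)%:E = (F b - F a)%:E)%E.
Proof.
move=> ab cf dF; have cF := is_derive1_continuousT dF.
rewrite (@continuous_FTC2 _ f F a b)//.
- exact/continuous_subspaceT.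
- split => [x _||]; first by case: (dF x).
  + exact/cvg_at_right_filter/cF.
  + exact/cvg_at_left_filter/cF.
- by move=> x _; rewrite derive1E; exact: derive_val.
Qed.

(** A nonnegative function with a bounded primitive is integrable: this is the
    source of all the dominating functions below. *)
Lemma integrable_bounded_primitive f F (M : R) :
  (forall x, 0 <= f x) -> continuous f ->
  (forall x, is_derive x 1 F (f x)) -> (forall x, `|F x| <= M) ->
  mu.-integrable setT (EFin \o f).
Proof.
move=> f0 cf dF FM; have mf := continuous_measurable_setT cf.
apply/integrableP; split; first exact/measurable_EFinP.
under eq_integral do rewrite /= ger0_norm//.
have := @ge0_nondecreasing_set_cvg_integral _ (measurableTypeR R) R itvn (EFin \o f) mu itvn_nd.
rewrite itvn_bigcup => /(_ (fun=> measurable_itv _)) h.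
have {}h := h (fun i => measurable_funTS (proj2 (measurable_EFinP _ _) mf))
   (fun i x _ => f0 x).
rewrite (le_lt_trans (_ : _ <= (M + M)%:E)%E) ?ltry//.
rewrite -(cvg_lim _ h)//; apply: lime_le; first by apply/cvg_ex; eexists; exact: h.
apply: nearW => n /=.
have nn : - n.+1%:R < n.+1%:R :> R.
  by have : 0 < n.+1%:R :> R by []; lra.
rewrite /itvn (integral_itv_primitive nn cf dF) lee_fin.
by rewrite (le_trans (ler_norm _))// (le_trans (ler_normB _ _))// lerD.
Qed.

(** The fundamental theorem of calculus on the whole line. *)
Lemma Rintegral_primitive f F (l r : R) : continuous f ->
  mu.-integrable setT (EFin \o f) ->
  (forall x, is_derive x 1 F (f x)) ->
  F x @[x --> -oo] --> l -> F x @[x --> +oo] --> r ->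
  \int[mu]_x f x = r - l.
Proof.
move=> cf fi dF Fl Fr; have := cvg_integral_itvn fi.
have -> : (fun n => \int[mu]_(x in `[- n.+1%:R, n.+1%:R]) f x) =
          (fun n => F n.+1%:R - F (- n.+1%:R)).
  apply/funext => n; rewrite /Rintegral (integral_itv_primitive _ cf dF)//.
  by have : 0 < n.+1%:R :> R by []; lra.
have ny : n.+1%:R @[n --> \oo] --> (+oo : set_system R).
  by rewrite (cvg_shiftS (fun n => n%:R : R)); exact: cvgr_idn.
move=> h; apply: (cvg_unique _ h) => //; apply: cvgB.
  by move/cvg_pinftyP : Fr; apply.
by move/cvg_ninftyP : Fl; apply; exact/cvgNrNy.
Qed.

End integration_on_R.

Section dominating_functions.
Context {R : realType}.
Notation mu := (@lebesgue_measure R).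
Implicit Types c a x : R.

(** Half of the hyperbolic secant: comparable to [expR (- `|x|)], but smooth
    and with the bounded primitive [atan \o expR]. *)
Definition hsech x : R := (expR x + expR (- x))^-1.

Lemma hsech_gt0 x : 0 < hsech x.
Proof. by rewrite invr_gt0 addr_gt0 ?expR_gt0. Qed.

Lemma continuous_hsech : continuous hsech.
Proof.
apply: (@is_derive1_continuousT _ _ (fun x =>
  - (expR x * 1 + expR (- x) * (- 1)) / (expR x + expR (- x)) ^+ 2)) => x.
apply: is_derive1V; first by rewrite gt_eqF// addr_gt0 ?expR_gt0.
by apply: is_derive1D; apply: is_derive1_expR.
Qed.

Lemma expRN_norm_le_hsech x : expR (- `|x|) <= 2 * hsech x.
Proof.
rewrite /hsech ler_pdivlMr ?addr_gt0 ?expR_gt0//.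
have [x0|x0] := leP 0 x.
  rewrite ger0_norm// mulrDr -!expRD addNr expR0.
  suff : expR (- x - x) <= 1 by lra.
  by rewrite -expR0 ler_expR; lra.
rewrite ltr0_norm// opprK mulrDr -!expRD addrN expR0.
suff : expR (x + x) <= 1 by lra.
by rewrite -expR0 ler_expR; lra.
Qed.

Lemma integrable_hsech c a : 0 < c ->
  mu.-integrable setT (EFin \o (fun x => hsech (c * (x - a)))).
Proof.
move=> c0.
have dl x : is_derive x 1 (fun x => c * (x - a)) c.
  apply: (is_derive_eq (is_derive1Zl c
    (is_derive1B (is_derive1_id x) (is_derive1_cst a x)))).
  by rewrite subr0 mulr1.
apply: (@integrable_bounded_primitive _ _
  (fun x => c^-1 * atan (expR (c * (x - a)))) (c^-1 * (pi / 2))).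
- by move=> x; exact/ltW/hsech_gt0.
- move=> x; apply: (@continuous_comp _ _ _ (fun x => c * (x - a)) hsech);
    last exact: continuous_hsech.
  exact: is_derive1_continuous (dl x).
- move=> x; apply: (is_derive_eq (is_derive1Zl c^-1
    (is_derive1_comp (is_derive1_expR (dl x)) (is_derive1_atan _)))).
  rewrite /hsech expRN; have := expR_gt0 (c * (x - a)).
  set e := expR _ => e0; field.
  by rewrite !gt_eqF//; nra.
- move=> x; rewrite normrM (gtr0_norm (_ : 0 < c^-1)) ?invr_gt0//.
  rewrite ler_wpM2l ?invr_ge0 ?ltW// ltr_norml atan_ltpi2 andbT.
  exact: atan_gtNpi2.
Qed.

Lemma integrable_expRN_norm c a : 0 < c ->
  mu.-integrable setT (EFin \o (fun x => expR (- (c * `|x - a|)))).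
Proof.
move=> c0; apply: (@integrable_le _ _ _ mu _ (fun x => 2 * hsech (c * (x - a)))) => //.
- apply: continuous_measurable_setT => x.
  apply: (@continuous_comp _ _ _ (fun x => - (c * `|x - a|)) expR);
    last exact: continuous_expR.
  apply: cvgN; apply: cvgM; first exact: cvg_cst.
  by apply: cvg_norm; apply: cvgB; [exact: cvg_id|exact: cvg_cst].
- move=> x _; rewrite ger0_norm ?expR_ge0//.
  rewrite (_ : c * `|x - a| = `|c * (x - a)|); first exact: expRN_norm_le_hsech.
  by rewrite normrM (gtr0_norm c0).
- by apply: integrableZl_R => //; exact: integrable_hsech.
Qed.

Lemma integrable_inv1Dsqr :
  mu.-integrable setT (EFin \o (fun x : R => (1 + x ^+ 2)^-1)).
Proof.
apply: (@integrable_bounded_primitive _ _ atan (pi / 2)).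
- by move=> x; rewrite invr_ge0 addr_ge0 ?sqr_ge0.
- move=> x; apply: cvgV; first by rewrite gt_eqF// ltr_wpDr ?sqr_ge0.
  by apply: cvgD; [exact: cvg_cst|apply: cvgM; exact: cvg_id].
- by move=> x; rewrite ltW// ltr_norml atan_ltpi2 andbT; exact: atan_gtNpi2.
Qed.

End dominating_functions.

Section real_fubini.
Context d1 d2 (T1 : measurableType d1) (T2 : measurableType d2) (R : realType).
Variable m1 : {sigma_finite_measure set T1 -> \bar R}.
Variable m2 : {sigma_finite_measure set T2 -> \bar R}.
Implicit Type f : T1 * T2 -> R.

Lemma integrable_prod12 f : measurable_fun setT f ->
  (forall x, m2.-integrable setT (fun y => (f (x, y))%:E)) ->
  m1.-integrable setT (EFin \o (fun x => \int[m2]_y `|f (x, y)|)) ->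
  (m1 \x m2)%E.-integrable setT (EFin \o f).
Proof.
move=> mf f2 f1; apply/integrable12ltyP; first exact/measurable_EFinP.
move/integrableP : f1 => [_]; apply: le_lt_trans.
rewrite le_eqVlt; apply/orP; left; apply/eqP; apply: eq_integral => x _.
rewrite /= ger0_norm ?Rintegral_ge0// EFin_Rintegral//.
exact: (integrable_norm_R (measurableT) (f2 x)).
Qed.

Lemma integrable_prod21 f : measurable_fun setT f ->
  (forall y, m1.-integrable setT (fun x => (f (x, y))%:E)) ->
  m2.-integrable setT (EFin \o (fun y => \int[m1]_x `|f (x, y)|)) ->
  (m1 \x m2)%E.-integrable setT (EFin \o f).
Proof.
move=> mf f2 f1; apply/integrable21ltyP; first exact/measurable_EFinP.
move/integrableP : f1 => [_]; apply: le_lt_trans.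
rewrite le_eqVlt; apply/orP; left; apply/eqP; apply: eq_integral => x _.
rewrite /= ger0_norm ?Rintegral_ge0// EFin_Rintegral//.
exact: (integrable_norm_R (measurableT) (f2 x)).
Qed.

Lemma integrable_prodM f p q : measurable_fun setT f ->
  m1.-integrable setT (EFin \o p) -> m2.-integrable setT (EFin \o q) ->
  (forall x y, `|f (x, y)| <= p x * q y) ->
  (m1 \x m2)%E.-integrable setT (EFin \o f).
Proof.
move=> mf ip iq fpq.
apply: (@integrable_le _ _ _ _ _ (fun z => p z.1 * q z.2)) => //.
  by move=> [x y] _; exact: fpq.
apply: integrable_prod12 => /=.
- apply: measurable_funM.
    exact: (measurableT_comp (measurable_integrable ip) measurable_fst).
  exact: (measurableT_comp (measurable_integrable iq) measurable_snd).
- by move=> x; exact: integrableZl_R.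
- rewrite (_ : (fun _ => _) = (fun x => (\int[m2]_y `|q y|) * `|p x|)).
    by apply: integrableZl_R => //; exact: integrable_norm_R.
  apply/funext => x; under eq_Rintegral do rewrite normrM.
  rewrite [LHS](_ : _ = `|p x| * \int[m2]_y `|q y|); first by rewrite mulrC.
  by apply: RintegralZl => //; exact: (integrable_norm_R measurableT iq).
Qed.

Let fine_integral_F f : (m1 \x m2)%E.-integrable setT (EFin \o f) ->
  m1.-integrable setT (EFin \o (fun x => \int[m2]_y f (x, y))) /\
  \int[m1]_x \int[m2]_y f (x, y) = fine (\int[(m1 \x m2)%E]_z (f z)%:E)%E.
Proof.
move=> fi; have iF := integrable_fubini_F fi.
have mF := measurable_int _ iF.
have mfF : measurable_fun setT (fun x => \int[m2]_y f (x, y)).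
  exact: (measurableT_comp (fine_measurable measurableT) mF).
split.
  apply: (le_integrable _ _ _ iF) => //; first exact/measurable_EFinP.
  move=> x _; rewrite /= /Rintegral /fubini_F/=.
  by case: (integral _ _ _) => [r||]//=; rewrite normr0 leey.
rewrite /Rintegral -integral12_prod_meas1//; congr fine.
apply: ae_eq_integral => //; first exact/measurable_EFinP.
apply: filterS (ae_integrable1 fi) => x fx _.
by rewrite fineK//; exact: integrable_fin_num.
Qed.

Let fine_integral_G f : (m1 \x m2)%E.-integrable setT (EFin \o f) ->
  m2.-integrable setT (EFin \o (fun y => \int[m1]_x f (x, y))) /\
  \int[m2]_y \int[m1]_x f (x, y) = fine (\int[(m1 \x m2)%E]_z (f z)%:E)%E.
Proof.
move=> fi.
have mF := measurable_fubini_G fi.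
have mfF : measurable_fun setT (fun y => \int[m1]_x f (x, y)).
  exact: (measurableT_comp (fine_measurable measurableT) mF).
have iF : m2.-integrable setT (fubini_G m1 (EFin \o f)).
  apply/integrableP; split => //.
  have /(integrable21ltyP) : measurable_fun setT (EFin \o f).
    exact: measurable_int fi.
  move=> /(_ m1 m2) [/(_ fi) + _]; apply: le_lt_trans.
  apply: ge0_le_integral => //.
  - exact: measurableT_comp.
  - apply: (measurable_fun_fubini_tonelli_G (abse \o (EFin \o f))) => //=.
    by apply: measurableT_comp => //; exact: measurable_int fi.
  - move=> y _; apply: le_abse_integral => //.
    by apply: measurableT_comp; first exact: measurable_int fi.
split.
  apply: (le_integrable _ _ _ iF) => //; first exact/measurable_EFinP.
  move=> x _; rewrite /= /Rintegral /fubini_G/=.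
  by case: (integral _ _ _) => [r||]//=; rewrite normr0 leey.
rewrite /Rintegral -integral21_prod_meas1//; congr fine.
apply: ae_eq_integral => //; first exact/measurable_EFinP.
apply: filterS (ae_integrable2 fi) => x fx _.
by rewrite fineK//; exact: integrable_fin_num.
Qed.

Lemma Rfubini f : (m1 \x m2)%E.-integrable setT (EFin \o f) ->
  \int[m1]_x \int[m2]_y f (x, y) = \int[m2]_y \int[m1]_x f (x, y).
Proof.
by move=> fi; rewrite (fine_integral_F fi).2 (fine_integral_G fi).2.
Qed.

Lemma integrable_Rfubini1 f : (m1 \x m2)%E.-integrable setT (EFin \o f) ->
  m1.-integrable setT (EFin \o (fun x => \int[m2]_y f (x, y))).
Proof. by move=> /fine_integral_F[]. Qed.

Lemma integrable_Rfubini2 f : (m1 \x m2)%E.-integrable setT (EFin \o f) ->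
  m2.-integrable setT (EFin \o (fun y => \int[m1]_x f (x, y))).
Proof. by move=> /fine_integral_G[]. Qed.

Lemma Rintegral_prod f : (m1 \x m2)%E.-integrable setT (EFin \o f) ->
  \int[(m1 \x m2)%E]_z f z = \int[m1]_x \int[m2]_y f (x, y).
Proof. by move=> /fine_integral_F[_ ->]. Qed.

End real_fubini.

Section substitutions.
Context {R : realType}.
Notation mu := (@lebesgue_measure R).
Implicit Types (f g : R -> R) (x a b c : R).

Lemma is_derive1_affine c b x : is_derive x 1 (fun y => c * y + b) c.
Proof.
apply: (is_derive_eq (is_derive1D (is_derive1Zl c (is_derive1_id x))
  (is_derive1_cst b x))).
by rewrite addr0 mulr1.
Qed.

Lemma cvg_affine_y c b : 0 < c -> c * x + b @[x --> +oo] --> (+oo : set_system R).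
Proof.
move=> c0; apply: (cvg_comp (fun x => c * x) (fun y => y + b) _ (cvg_addrr b)).
by apply: gt0_cvgMry => //; exact: cvg_id.
Qed.

Lemma cvg_affine_Ny c b : 0 < c -> c * x + b @[x --> -oo] --> (-oo : set_system R).
Proof.
move=> c0; apply: (cvg_comp (fun x => c * x) (fun y => y + b) _ (cvg_addrr_Ny b)).
by apply: gt0_cvgMrNy => //; exact: cvg_id.
Qed.

Lemma integral_affine f c b : 0 < c -> continuous f -> (forall x, 0 <= f x) ->
  (\int[mu]_x (f (c * x + b) * c)%:E = \int[mu]_x (f x)%:E)%E.
Proof.
move=> c0 cf f0.
have dF x : derivable (fun y => c * y + b) x 1.
  by case: (is_derive1_affine c b x).
have F' : derive1 (fun y => c * y + b) = cst c.
  apply/funext => x; rewrite derive1E.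
  by have [_ ->] := is_derive1_affine c b x.
have := @increasing_ge0_integration_by_substitutionT R (fun y => c * y + b) f.
rewrite F' => h; apply/esym; apply: h => //.
- by move=> x y xy; rewrite ltrD2r ltr_pM2l.
- by move=> x; exact: cvg_cst.
- exact: is_cvg_cst.
- exact: is_cvg_cst.
- exact: cvg_affine_Ny.
- exact: cvg_affine_y.
Qed.

Let expitv (n : nat) : set R := `[expR (- n.+1%:R), expR n.+1%:R]%classic.
Let itvn (n : nat) : set R := `[- n.+1%:R, n.+1%:R]%classic.

Let itvn_nd : nondecreasing_seq itvn.
Proof.
move=> m n mn; apply/subsetPset => x; rewrite /itvn/= !in_itv/= => /andP[a b].
have : m.+1%:R <= n.+1%:R :> R by rewrite ler_nat.
by move=> h; apply/andP; split; lra.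
Qed.

Let itvn_bigcup : \bigcup_n itvn n = [set: R].
Proof.
apply/seteqP; split => // x _; exists (Num.truncn `|x|) => //.
rewrite /itvn/= in_itv/= -ler_norml ltW//.
exact: truncnS_gt.
Qed.

Let expitv_nd : nondecreasing_seq expitv.
Proof.
move=> m n mn; apply/subsetPset => x; rewrite /expitv/= !in_itv/= => /andP[a b].
have h : m.+1%:R <= n.+1%:R :> R by rewrite ler_nat.
by rewrite (le_trans _ a) ?(le_trans b)// ler_expR ?lerN2.
Qed.

Let expitv_bigcup : \bigcup_n expitv n = `]0, +oo[%classic.
Proof.
apply/seteqP; split => x.
  move=> [n _]; rewrite /expitv/= !in_itv/= andbT => /andP[+ _].
  by apply: lt_le_trans; exact: expR_gt0.
rewrite /= in_itv/= andbT => x0.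
have : (\bigcup_n itvn n) (ln x) by rewrite itvn_bigcup.
case=> n _; rewrite /itvn/= in_itv/= => /andP[a b]; exists n => //.
by rewrite /expitv/= in_itv/= -(lnK x0) !ler_expR a b.
Qed.

Let integral_expitv f n : {in `]0, +oo[, continuous f} ->
  (\int[mu]_(x in expitv n) (f x)%:E =
   \int[mu]_(x in itvn n) (f (expR x) * expR x)%:E)%E.
Proof.
move=> cf; have h : 0 < n.+1%:R :> R by [].
have E : derive1 (@expR R) = expR.
  by apply/funext => x; rewrite derive1E; exact: derive_val.
rewrite /expitv (@integration_by_substitution_increasing _ expR f)//.
- by apply: eq_integral => x _; rewrite E.
- by lra.
- by move=> x y _ _; rewrite ltr_expR.
- by rewrite E => x _; exact: continuous_expR.
- rewrite E; apply/cvg_ex; eexists; apply: cvg_at_right_filter.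
  exact: continuous_expR.
- rewrite E; apply/cvg_ex; eexists; apply: cvg_at_left_filter.
  exact: continuous_expR.
- split => //.
  + exact/cvg_at_right_filter/continuous_expR.
  + exact/cvg_at_left_filter/continuous_expR.
- apply: continuous_in_subspaceT => x /set_mem/=; rewrite in_itv/= => /andP[a _].
  by apply: cf; rewrite in_itv/= andbT (lt_le_trans _ a)// expR_gt0.
Qed.

Let measurable_pos f : {in `]0, +oo[, continuous f} ->
  measurable_fun (`]0, +oo[%classic : set R) f.
Proof.
move=> cf; apply: open_continuous_measurable_fun => // x /set_mem; exact: cf.
Qed.

Lemma integrable_expR_subst f : {in `]0, +oo[, continuous f} ->
  mu.-integrable setT (EFin \o (fun x => f (expR x) * expR x)) ->
  mu.-integrable `]0, +oo[ (EFin \o f).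
Proof.
move=> cf fi; have mf := measurable_pos cf.
apply/integrableP; split; first exact/measurable_EFinP.
have caf : {in `]0, +oo[, continuous (fun x => `|f x|)}.
  by move=> x x0; apply: cvg_norm; exact: cf.
have := @ge0_nondecreasing_set_cvg_integral _ (measurableTypeR R) R expitv
  (fun x => `|(f x)%:E|)%E mu expitv_nd (fun=> measurable_itv _).
rewrite expitv_bigcup => h.
have := @ge0_nondecreasing_set_cvg_integral _ (measurableTypeR R) R itvn
  (fun x => `|(f (expR x) * expR x)%:E|)%E mu itvn_nd (fun=> measurable_itv _).
rewrite itvn_bigcup => g.
move/integrableP : fi => [mg]; apply: le_lt_trans.
have mg' : measurable_fun setT (fun x => `|(f (expR x) * expR x)%:E|%E).
  exact: (measurableT_comp (@abse_measurable R setT) mg).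
have sub n : expitv n `<=` (`]0, +oo[%classic : set R).
  by rewrite -expitv_bigcup; exact: bigcup_sup.
have mf' i : measurable_fun (expitv i) (fun x => `|(f x)%:E|%E).
  apply: (measurable_funS (measurable_itv _) (sub i)).
  exact: (measurableT_comp (@abse_measurable R setT) (proj2 (measurable_EFinP _ _) mf)).
have {}g := g (fun i => measurable_funTS mg') (fun i x _ => abse_ge0 _).
have {}h := h mf' (fun i x _ => abse_ge0 _).
rewrite le_eqVlt; apply/orP; left; apply/eqP.
apply: (cvg_unique _ h) => //; move: g; apply: cvg_trans; apply: near_eq_cvg.
apply: nearW => n; rewrite integral_expitv//.
by apply: eq_integral => x _; rewrite /= normrM (ger0_norm (expR_ge0 _)).
Qed.

Lemma Rintegral_expR_subst f : {in `]0, +oo[, continuous f} ->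
  mu.-integrable setT (EFin \o (fun x => f (expR x) * expR x)) ->
  \int[mu]_(x in `]0, +oo[) f x = \int[mu]_x (f (expR x) * expR x).
Proof.
move=> cf fi; have fpos := integrable_expR_subst cf fi.
have := cvg_integral_itvn fi.
have -> : (fun n => \int[mu]_(x in `[- n.+1%:R, n.+1%:R]) (f (expR x) * expR x)) =
    (fun n => \int[mu]_x ((f \_ (expitv n)) x)).
  apply/funext => n; rewrite -Rintegral_mkcond /Rintegral; congr fine.
  by rewrite integral_expitv.
move=> h; apply: cvg_unique h => //; rewrite Rintegral_mkcond.
pose D : set R := `]0, +oo[%classic; have mD : measurable D by exact: measurable_itv.
have sub n : expitv n `<=` D by rewrite /D -expitv_bigcup; exact: bigcup_sup.
have fD : mu.-integrable setT (EFin \o (f \_ D)).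
  by rewrite -restrict_EFin; exact: (@integrable_mkcond _ _ _ mu D (EFin \o f) mD).1 fpos.
apply: (@cvg_Rintegral _ _ _ mu (fun n => f \_ (expitv n)) (f \_ D)
  (fun x => `|(f \_ D) x|)).
- move=> n; apply/(measurable_restrictT f); first exact: measurable_itv.
  exact: (measurable_funS mD (sub n) (measurable_integrable fpos)).
- apply/aeW => x; apply: cvg_near_cst.
  have [Dx|nDx] := pselect (D x); last first.
    apply: nearW => n; rewrite !patchE !memNset//; by move=> /sub.
  have : (\bigcup_n expitv n) x by rewrite expitv_bigcup.
  case=> N _ xN; exists N => // n /= Nn; rewrite !patchE !mem_set//.
  by move: x xN {Dx}; apply/subsetPset/expitv_nd.
- exact: integrable_norm_R.
- move=> n x; rewrite !patchE; case: ifPn => [/set_mem/sub xn|_].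
    by rewrite mem_set.
  by rewrite normr0.
- exact: measurable_integrable fD.
Qed.

End substitutions.

(** * Complex differentiation *)

Local Notation Re := complex.Re.
Local Notation Im := complex.Im.

Section complex_lemmas.
Context {R : realType}.
Implicit Types (z w : R[i]) (x y a : R).

Lemma ReD z w : Re (z + w) = Re z + Re w. Proof. by case: z; case: w. Qed.
Lemma ImD z w : Im (z + w) = Im z + Im w. Proof. by case: z; case: w. Qed.
Lemma ReN z : Re (- z) = - Re z. Proof. by case: z. Qed.
Lemma ImN z : Im (- z) = - Im z. Proof. by case: z. Qed.
Lemma ReB z w : Re (z - w) = Re z - Re w. Proof. by rewrite ReD ReN. Qed.
Lemma ImB z w : Im (z - w) = Im z - Im w. Proof. by rewrite ImD ImN. Qed.
Lemma ReM z w : Re (z * w) = Re z * Re w - Im z * Im w.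
Proof. by case: z; case: w. Qed.
Lemma ImM z w : Im (z * w) = Re z * Im w + Im z * Re w.
Proof. by case: z => a b; case: w => c d. Qed.
Lemma ReV z : Re z^-1 = Re z / (Re z ^+ 2 + Im z ^+ 2).
Proof. by case: z. Qed.
Lemma ImV z : Im z^-1 = - (Im z / (Re z ^+ 2 + Im z ^+ 2)).
Proof. by case: z. Qed.

Definition ReImE := (ReD, ImD, ReN, ImN, ReM, ImM).

Lemma complex_eqP z w : Re z = Re w -> Im z = Im w -> z = w.
Proof. by case: z => a b; case: w => c d /= -> ->. Qed.

Lemma cmodE z : cmod z = Normc.normc z. Proof. by case: z. Qed.

Lemma cmod_ge0 z : 0 <= cmod z. Proof. exact: sqrtr_ge0. Qed.

Lemma sqr_cmod z : cmod z ^+ 2 = Re z ^+ 2 + Im z ^+ 2.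
Proof. by rewrite sqr_sqrtr// addr_ge0 ?sqr_ge0. Qed.

Lemma cmodM z w : cmod (z * w) = cmod z * cmod w.
Proof. by rewrite !cmodE Normc.normcM. Qed.

Lemma cmodV z : cmod z^-1 = (cmod z)^-1.
Proof. by rewrite !cmodE Normc.normcV. Qed.

Lemma cmodN z : cmod (- z) = cmod z.
Proof. by rewrite /cmod !ReImE !sqrrN. Qed.

Lemma ler_cmodD z w : cmod (z + w) <= cmod z + cmod w.
Proof. by rewrite !cmodE; exact: le_normcD. Qed.

Lemma ler_cmodB z w : cmod (z - w) <= cmod z + cmod w.
Proof. by rewrite -(cmodN w); exact: ler_cmodD. Qed.

Lemma ler_Re_cmod z : `|Re z| <= cmod z.
Proof. by rewrite -sqrtr_sqr ler_wsqrtr// lerDl sqr_ge0. Qed.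

Lemma ler_Im_cmod z : `|Im z| <= cmod z.
Proof. by rewrite -sqrtr_sqr ler_wsqrtr// lerDr sqr_ge0. Qed.

Lemma ler_cmod z : cmod z <= `|Re z| + `|Im z|.
Proof.
rewrite -(@ler_pXn2r _ 2) ?nnegrE ?cmod_ge0 ?addr_ge0// sqr_cmod.
rewrite -(real_normK (num_real (Re z))) -(real_normK (num_real (Im z))).
by rewrite sqrrD lerD2r lerDl mulrn_wge0// mulr_ge0.
Qed.

Lemma cmod_gt0 z : z != 0 -> 0 < cmod z.
Proof.
move=> z0; rewrite lt_neqAle cmod_ge0 andbT eq_sym; apply: contra z0 => /eqP.
by rewrite cmodE => /Normc.eq0_normc ->.
Qed.

Lemma cmodR x : cmod x%:C = `|x|.
Proof. by rewrite /cmod/= expr0n addr0 sqrtr_sqr. Qed.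

Lemma cmod1 : cmod (1 : R[i]) = 1.
Proof. by rewrite (cmodR 1) normr1. Qed.

Lemma cmodi : cmod ('i : R[i]) = 1.
Proof. by rewrite /cmod/= expr0n expr1n add0r sqrtr1. Qed.

Lemma cexpD z w : cexp (z + w) = cexp z * cexp w.
Proof.
by apply: complex_eqP; rewrite /= ?ReImE/= expRD ?cosD ?sinD; ring.
Qed.

Lemma cexp0 : cexp (0 : R[i]) = 1.
Proof. by rewrite /cexp/= expR0 cos0 sin0 mulr1 mulr0. Qed.

Lemma cexp_neq0 z : cexp z != 0.
Proof.
apply/negP => /eqP h; have : cexp z * cexp (- z) = 0 by rewrite h mul0r.
by rewrite -cexpD subrr cexp0 => /eqP; rewrite oner_eq0.
Qed.

Lemma cexpN z : cexp (- z) = (cexp z)^-1.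
Proof.
by apply: (mulfI (cexp_neq0 z)); rewrite -cexpD subrr cexp0 mulfV ?cexp_neq0.
Qed.

Lemma cmod_cexp z : cmod (cexp z) = expR (Re z).
Proof.
by rewrite /cmod/= !exprMn -mulrDr cos2Dsin2 mulr1 sqrtr_sqr ger0_norm// expR_ge0.
Qed.

Lemma cexpR x : cexp x%:C = (expR x)%:C.
Proof. by rewrite /cexp/= cos0 sin0 mulr1 mulr0. Qed.

End complex_lemmas.

Section holomorphy.
Context {R : realType}.
Implicit Types (z w d e : R[i]) (f g : R[i] -> R[i]) (c : R -> R[i]) (y : R).

Definition is_cderive c y d := is_derive y 1 (fun s => Re (c s)) (Re d) /\
  is_derive y 1 (fun s => Im (c s)) (Im d).

(** Complex differentiability is only ever used along the two real curves
    [x + i theta] with [x] or [theta] varying, so it is encoded by the chain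
    rule for real curves: this makes composition immediate, and the two
    partial derivatives then satisfy the Cauchy-Riemann equations by
    construction. *)
Definition holo f z d := forall c y e, c y = z -> is_cderive c y e ->
  is_cderive (fun s => f (c s)) y (e * d).

Lemma holo_eq f z d e : holo f z d -> d = e -> holo f z e.
Proof. by move=> + <-. Qed.

Lemma holo_id z : holo id z 1.
Proof. by move=> c y e _; rewrite mulr1. Qed.

Lemma holo_cst w z : holo (fun=> w) z 0.
Proof. by move=> c y e _ _; rewrite mulr0; split; exact: is_derive1_cst. Qed.

Lemma holoD f g z d e : holo f z d -> holo g z e ->
  holo (fun s => f s + g s) z (d + e).
Proof.
move=> hf hg c y k cz hc; have [a1 a2] := hf c y k cz hc.
have [b1 b2] := hg c y k cz hc; rewrite mulrDr; split.
- under eq_fun do rewrite ReD.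
  by rewrite ReD; exact: is_derive1D.
- under eq_fun do rewrite ImD.
  by rewrite ImD; exact: is_derive1D.
Qed.

Lemma holoN f z d : holo f z d -> holo (fun s => - f s) z (- d).
Proof.
move=> hf c y k cz hc; have [a1 a2] := hf c y k cz hc; rewrite mulrN; split.
- under eq_fun do rewrite ReN.
  by rewrite ReN; exact: is_derive1N.
- under eq_fun do rewrite ImN.
  by rewrite ImN; exact: is_derive1N.
Qed.

Lemma holoB f g z d e : holo f z d -> holo g z e ->
  holo (fun s => f s - g s) z (d - e).
Proof. by move=> hf hg; apply: holoD => //; exact: holoN. Qed.

Lemma holoM f g z d e : holo f z d -> holo g z e ->
  holo (fun s => f s * g s) z (d * g z + f z * e).
Proof.
move=> hf hg c y k cz hc; have [a1 a2] := hf c y k cz hc.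
have [b1 b2] := hg c y k cz hc; split.
- under eq_fun do rewrite ReM.
  apply: (is_derive_eq (is_derive1B (is_derive1M a1 b1) (is_derive1M a2 b2))).
  by rewrite cz !ReImE; ring.
- under eq_fun do rewrite ImM.
  apply: (is_derive_eq (is_derive1D (is_derive1M a1 b2) (is_derive1M a2 b1))).
  by rewrite cz !ReImE; ring.
Qed.

Lemma holo_comp f g z d e : holo f z d -> holo g (f z) e ->
  holo (fun s => g (f s)) z (d * e).
Proof.
move=> hf hg c y k cz hc; rewrite mulrA.
by apply: (hg (fun s => f (c s))); [rewrite cz|exact: hf].
Qed.

Lemma sqr_ReIm_gt0 z : z != 0 -> 0 < Re z ^+ 2 + Im z ^+ 2.
Proof. by move=> z0; rewrite -sqr_cmod exprn_gt0// cmod_gt0. Qed.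

Lemma holoV z : z != 0 -> holo (fun s => s^-1) z (- z^-1 ^+ 2).
Proof.
move=> z0 c y k cz [a1 a2]; have n0 := sqr_ReIm_gt0 z0.
have n1 := is_derive1D (is_derive1M a1 a1) (is_derive1M a2 a2).
have n2 : is_derive y 1 (fun s => (Re (c s) ^+ 2 + Im (c s) ^+ 2)^-1)
   (- (Re k * Re z + Re z * Re k + (Im k * Im z + Im z * Im k)) /
    (Re z ^+ 2 + Im z ^+ 2) ^+ 2).
  have := @is_derive1V _ (fun s => Re (c s) ^+ 2 + Im (c s) ^+ 2) y.
  by rewrite cz; apply; [rewrite gt_eqF|rewrite -cz].
split.
- under eq_fun do rewrite ReV.
  apply: (is_derive_eq (is_derive1M a1 n2)).
  rewrite !(expr2 z^-1) !ReImE !ReV !ImV cz.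
  move: (Re z) (Im z) (Re k) (Im k) n0 => a b p q n0.
  by field; rewrite gt_eqF// -!expr2.
- under eq_fun do rewrite ImV.
  apply: (is_derive_eq (is_derive1N (is_derive1M a2 n2))).
  rewrite !(expr2 z^-1) !ReImE !ReV !ImV cz.
  move: (Re z) (Im z) (Re k) (Im k) n0 => a b p q n0.
  by field; rewrite gt_eqF// -!expr2.
Qed.

Lemma holo_cexp z : holo cexp z (cexp z).
Proof.
move=> c y k cz [a1 a2]; have e1 := is_derive1_expR a1.
split.
- apply: (is_derive_eq (is_derive1M e1 (is_derive1_cos a2))).
  by rewrite cz !ReImE /=; ring.
- apply: (is_derive_eq (is_derive1M e1 (is_derive1_sin a2))).
  by rewrite cz !ReImE /=; ring.
Qed.

(** The principal logarithm off the negative real axis; the half-angle form of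
    the argument is differentiable across the positive real axis, where [acos]
    is not. *)
Definition clog2 z : R[i] :=
  ln (cmod z) +i* (2 * atan (Im z / (Re z + cmod z))).

Lemma holo_clog2 z : 0 < Re z + cmod z -> holo clog2 z z^-1.
Proof.
move=> zpos c y k cz [a1 a2].
have z0 : z != 0.
  by apply/negP => /eqP z0; move: zpos; rewrite z0 /cmod/= expr0n addr0 sqrtr0 addr0 ltxx.
have n0 := sqr_ReIm_gt0 z0; have r0 := cmod_gt0 z0.
have n1 := is_derive1D (is_derive1M a1 a1) (is_derive1M a2 a2).
have r1 : is_derive y 1 (fun s => cmod (c s))
    ((2 * cmod z)^-1 * (Re k * Re z + Re z * Re k + (Im k * Im z + Im z * Im k))).
  have := @is_derive1_comp _ (fun s => Re (c s) ^+ 2 + Im (c s) ^+ 2) Num.sqrt y.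
  move=> /(_ _ (2 * cmod z)^-1); apply; first by rewrite -cz.
  by rewrite cz; exact: is_derive1_sqrt.
have l1 : is_derive y 1 (fun s => ln (cmod (c s))) ((cmod z)^-1 * ((2 * cmod z)^-1 *
    (Re k * Re z + Re z * Re k + (Im k * Im z + Im z * Im k)))).
  apply: (is_derive1_comp r1); rewrite cz; exact: is_derive1_ln.
have v1 : is_derive y 1 (fun s => (Re (c s) + cmod (c s))^-1) (- (Re k + (2 * cmod z)^-1 *
    (Re k * Re z + Re z * Re k + (Im k * Im z + Im z * Im k))) /
    (Re z + cmod z) ^+ 2).
  have fx0 : Re (c y) + cmod (c y) != 0 by rewrite cz gt_eqF.
  have := @is_derive1V _ (fun s => Re (c s) + cmod (c s)) _ _ fx0 (is_derive1D a1 r1).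
  by rewrite cz.
have nE := sqr_cmod z.
split.
- apply: (is_derive_eq l1); rewrite ReM ReV ImV -nE.
  move: (cmod z) r0 => r r0; move: (Re z) (Im z) (Re k) (Im k) => a b p q.
  by field; rewrite gt_eqF.
- have tb := is_derive1Zl 2 (is_derive1_comp (is_derive1M a2 v1) (is_derive1_atan _)).
  apply: (is_derive_eq tb); rewrite cz ImM ReV ImV.
  move: (cmod z) (Re z) (Im z) (Re k) (Im k) nE r0 zpos n0 => r a b p q nE r0 zpos n0.
  have h1 : a + r != 0 by rewrite gt_eqF.
  have h2 : r != 0 by rewrite gt_eqF.
  have h3 : 1 + (b / (a + r)) ^+ 2 != 0 by rewrite gt_eqF// ltr_wpDr ?sqr_ge0.
  have b2 : b ^+ 2 = r ^+ 2 - a ^+ 2 by rewrite nE; ring.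
  have -> : 1 + (b / (a + r)) ^+ 2 = 2 * r / (a + r).
    by rewrite expr_div_n b2; field.
  rewrite -nE; transitivity (p * - (b / r ^+ 2) + q * (a / r ^+ 2) +
      q * (r ^+ 2 - a ^+ 2 - b ^+ 2) / (r ^+ 2 * (a + r))).
    by field; rewrite h1 h2.
  by rewrite -b2 subrr mulr0 mul0r addr0; ring.
Qed.

Lemma holo_continuous f z d c y e : holo f z d -> c y = z ->
  is_cderive c y e ->
  {for y, continuous (fun s => Re (f (c s)))} /\
  {for y, continuous (fun s => Im (f (c s)))}.
Proof.
move=> hf cz hc; have [a b] := hf c y e cz hc.
by split; [exact: is_derive1_continuous a|exact: is_derive1_continuous b].
Qed.

Lemma is_cderive_x (x t : R) : is_cderive (fun s => s +i* t) x 1.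
Proof. by split; [exact: is_derive1_id|exact: is_derive1_cst]. Qed.

Lemma is_cderive_t (x t : R) : is_cderive (fun s => x +i* s) t 'i.
Proof. by split; [exact: is_derive1_cst|exact: is_derive1_id]. Qed.

End holomorphy.
Arguments holo_cst {R} w z.
Arguments holo_id {R} z.
Arguments holo_cexp {R} z.

(** * The Dagum function in the right half-plane *)


Section dagum_extension.
Context {R : realType}.
Variables (delta lambda : R).
Hypothesis (hdelta : 0 < delta < 2) (hlambda : 0 < lambda).
Implicit Types (x t : R) (z : R[i]).

Let delta0 : 0 < delta. Proof. by case/andP: hdelta. Qed.
Let delta2 : delta < 2. Proof. by case/andP: hdelta. Qed.

Let pd0 : 0 < pi * delta. Proof. by rewrite mulr_gt0// pi_gt0. Qed.
Let pd2 : pi * delta < 2 * pi. Proof. by rewrite mulrC ltr_pM2r// pi_gt0. Qed.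

(** With [w = cexp z], [wpow z] is [w ^ delta] and [gext z] is the analytic
    extension of the Dagum function at [w]. *)
Definition wpow z : R[i] := cexp (delta%:C * z).
Definition gpow z : R[i] :=
  cexp (lambda%:C * (delta%:C * z - clog2 (1 + wpow z))).
Definition gext z : R[i] := 1 - gpow z.
Definition gext' z : R[i] := - ((lambda * delta)%:C * gpow z * (1 + wpow z)^-1).

Definition c0 : R := cos (pi * delta / 4).
Definition kappa : R := Num.min (lambda * delta) delta.

Lemma c0_gt0 : 0 < c0.
Proof.
have := pd0; have := pd2 => h1 h2.
by apply: cos_gt0_pihalf; apply/andP; split; lra.
Qed.

Lemma kappa_gt0 : 0 < kappa.
Proof. by rewrite lt_min mulr_gt0. Qed.

Lemma cos_half_ge x t : 0 <= t <= pi / 2 -> c0 <= cos (delta * t / 2).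
Proof.
move=> /andP[t0 t1]; have := pd0; have := pd2 => h1 h2.
have h3 : 0 <= delta * t by rewrite mulr_ge0// ltW.
have h4 : delta * t <= delta * (pi / 2) by rewrite ler_wpM2l// ltW.
have h : pi * delta / 4 \in `[0, pi] by rewrite in_itv/=; apply/andP; split; lra.
have k : delta * t / 2 \in `[0, pi] by rewrite in_itv/=; apply/andP; split; lra.
by rewrite leNgt ltr_cos// -leNgt; lra.
Qed.

Lemma wpowE x t : let a := expR (delta * x) in let p := delta * t / 2 in
  wpow (x +i* t) = (a * (1 - 2 * sin p ^+ 2)) +i* (a * (2 * sin p * cos p)).
Proof.
move=> a p; rewrite /wpow; apply: complex_eqP; rewrite /= !mul0r ?subr0 ?addr0 -/a.
  rewrite (_ : delta * t = p + p); last by rewrite /p; field.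
  by rewrite cosD -!expr2 cos2sin2; ring.
rewrite (_ : delta * t = p + p); last by rewrite /p; field.
by rewrite sinD; ring.
Qed.

Lemma Re_1Dwpow x t : Re (1 + wpow (x +i* t)) =
  1 + expR (delta * x) * (1 - 2 * sin (delta * t / 2) ^+ 2).
Proof. by rewrite ReD wpowE. Qed.

Lemma Im_1Dwpow x t : Im (1 + wpow (x +i* t)) =
  expR (delta * x) * (2 * sin (delta * t / 2) * cos (delta * t / 2)).
Proof. by rewrite ImD wpowE/= add0r. Qed.

Lemma cmod_1Dwpow_ge x t : 0 <= t <= pi / 2 ->
  c0 * (1 + expR (delta * x)) <= cmod (1 + wpow (x +i* t)).
Proof.
move=> ht; have c00 := c0_gt0; have a0 := expR_gt0 (delta * x).
rewrite -(@ler_pXn2r _ 2) ?nnegrE ?cmod_ge0//; last first.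
  by rewrite mulr_ge0// ?addr_ge0// ltW.
rewrite sqr_cmod Re_1Dwpow Im_1Dwpow.
have c1 := cos_half_ge x ht; have := cos2Dsin2 (delta * t / 2).
move: (cos _) (sin _) (expR _) a0 c0 c00 c1 => c s a a0 k k0 kc h.
have -> : (1 + a * (1 - 2 * s ^+ 2)) ^+ 2 + (a * (2 * s * c)) ^+ 2 =
  c ^+ 2 * (1 + a) ^+ 2 + (1 - a) ^+ 2 * s ^+ 2.
  have -> : s ^+ 2 = 1 - c ^+ 2 by rewrite -h; ring.
  rewrite !exprMn; have -> : s ^+ 2 = 1 - c ^+ 2 by rewrite -h; ring.
  ring.
apply: ler_wpDr; first by rewrite mulr_ge0 ?sqr_ge0.
rewrite exprMn; apply: ler_wpM2r; first exact: sqr_ge0.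
by rewrite ler_pXn2r// nnegrE ltW// (lt_le_trans k0).
Qed.

Lemma cmod_1Dwpow_gt0 x t : 0 <= t <= pi / 2 -> 0 < cmod (1 + wpow (x +i* t)).
Proof.
move=> ht; apply: lt_le_trans (cmod_1Dwpow_ge x ht).
by rewrite mulr_gt0 ?c0_gt0// addr_gt0// expR_gt0.
Qed.

Lemma onewpow_neq0 x t : 0 <= t <= pi / 2 -> 1 + wpow (x +i* t) != 0.
Proof.
move=> ht; apply/eqP => h; have := cmod_1Dwpow_gt0 x ht.
by rewrite h (cmodR 0) normr0 ltxx.
Qed.

(** The logarithm of [1 + w ^ delta] stays off its cut because
    [`|arg (w ^ delta)| <= pi * delta / 2 < pi]. *)
Lemma onewpow_slit x t : 0 <= t <= pi / 2 ->
  0 < Re (1 + wpow (x +i* t)) + cmod (1 + wpow (x +i* t)).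
Proof.
move=> ht; have r0 := cmod_1Dwpow_gt0 x ht; have a0 := expR_gt0 (delta * x).
have c1 : 0 < cos (delta * t / 2) := lt_le_trans c0_gt0 (cos_half_ge x ht).
have [s0|s0] := eqVneq (sin (delta * t / 2)) 0.
  by rewrite addr_gt0// Re_1Dwpow s0 expr0n/= mulr0 subr0 mulr1 addr_gt0.
have I0 : Im (1 + wpow (x +i* t)) != 0.
  rewrite Im_1Dwpow; apply: mulf_neq0; first by rewrite gt_eqF.
  apply: mulf_neq0; last by rewrite gt_eqF.
  by apply: mulf_neq0.
have : Re (1 + wpow (x +i* t)) ^+ 2 < cmod (1 + wpow (x +i* t)) ^+ 2.
  by rewrite sqr_cmod ltrDl lt_neqAle sqr_ge0 andbT eq_sym sqrf_eq0.
by move: (Re _) (cmod _) r0 => a r r0 h; nra.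
Qed.

Lemma holo_wpow z : holo wpow z (delta%:C * wpow z).
Proof.
have h := holo_comp (holoM (holo_cst delta%:C z) (holo_id z)) (holo_cexp _).
by move: h; rewrite mul0r add0r mulr1.
Qed.

Arguments holo_wpow : clear implicits.

Lemma holo_gpow x t : 0 <= t <= pi / 2 -> let z := x +i* t in
  holo gpow z ((lambda * delta)%:C * gpow z * (1 + wpow z)^-1).
Proof.
move=> ht z; have n0 := onewpow_neq0 x ht.
have h1 := holoD (holo_cst 1 z) (holo_wpow z).
have h2 := holo_comp h1 (holo_clog2 (onewpow_slit x ht)).
have h3 := holoB (holoM (holo_cst delta%:C z) (holo_id z)) h2.
have h4 := holo_comp (holoM (holo_cst lambda%:C z) h3) (holo_cexp _).
move: h4; rewrite -/(gpow z) !mul0r !add0r mulr1.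
have -> : (delta%:C - delta%:C * wpow z / (1 + wpow z)) = delta%:C / (1 + wpow z).
  by move: n0; rewrite -/z; move: (wpow z) => w n0; field.
by rewrite rmorphM/= !mulrA (mulrAC _ _ (gpow z)).
Qed.

Arguments holo_gpow x {t} _.

Lemma holo_gext x t : 0 <= t <= pi / 2 -> let z := x +i* t in
  holo gext z (gext' z).
Proof.
move=> ht z; have := holoB (holo_cst 1 z) (holo_gpow x ht).
by rewrite sub0r.
Qed.

Arguments holo_gext x {t} _.

Lemma holo_gext' x t : 0 <= t <= pi / 2 -> exists d, holo gext' (x +i* t) d.
Proof.
move=> ht; have n0 := onewpow_neq0 x ht.
have h1 := holoD (holo_cst 1 _) (holo_wpow (x +i* t)).
have h2 := holo_comp h1 (holoV n0).
by eexists; exact: (holoN (holoM (holoM (holo_cst _ _) (holo_gpow x ht)) h2)).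
Qed.

Let m z := ln (cmod (1 + wpow z)).

Let m_ge x t : 0 <= t <= pi / 2 ->
  ln c0 <= m (x +i* t) /\ ln c0 + delta * x <= m (x +i* t).
Proof.
move=> ht; have a0 := expR_gt0 (delta * x); have c00 := c0_gt0.
have h := cmod_1Dwpow_ge x ht.
have h1 : c0 <= cmod (1 + wpow (x +i* t)) by apply: le_trans h; nra.
have h2 : c0 * expR (delta * x) <= cmod (1 + wpow (x +i* t)).
  by apply: le_trans h; nra.
split; first by rewrite ler_ln// posrE (lt_le_trans c00).
rewrite -(expRK (delta * x)) -lnM ?posrE// ler_ln ?posrE ?mulr_gt0//.
by rewrite (lt_le_trans _ h2)// mulr_gt0.
Qed.

Let cmod_gpow x t : cmod (gpow (x +i* t)) =
  expR (lambda * (delta * x - m (x +i* t))).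
Proof. by rewrite cmod_cexp !ReImE/= !mul0r !subr0. Qed.

Definition Cgpow : R := expR (- (lambda * ln c0)).
Definition Cgext' : R := lambda * delta * expR (- ((lambda + 1) * ln c0)).

Lemma Cgext'_gt0 : 0 < Cgext'.
Proof. by rewrite !mulr_gt0 ?expR_gt0. Qed.

Lemma cmod_gpow_le x t : 0 <= t <= pi / 2 -> cmod (gpow (x +i* t)) <= Cgpow.
Proof.
move=> ht; rewrite cmod_gpow ler_expR -mulrN; apply: ler_wpM2l; first exact: ltW.
by have [h1 h2] := m_ge x ht; lra.
Qed.

Lemma cmod_gext_le x t : 0 <= t <= pi / 2 -> cmod (gext (x +i* t)) <= 1 + Cgpow.
Proof.
move=> ht; rewrite (le_trans (ler_cmodB _ _))// cmod1 lerD2l.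
exact: cmod_gpow_le.
Qed.

Lemma cmod_gext'_le x t : 0 <= t <= pi / 2 ->
  cmod (gext' (x +i* t)) <= Cgext' * expR (- (kappa * `|x|)).
Proof.
move=> ht; rewrite /gext' cmodN !cmodM cmodV cmod_gpow cmodR.
have ld0 : 0 <= lambda * delta by rewrite ltW// mulr_gt0.
rewrite ger0_norm// /Cgext' -!mulrA !(mulrA lambda); apply: ler_wpM2l => //.
rewrite -(lnK (cmod_1Dwpow_gt0 x ht)) -/(m _) -expRN -!expRD ler_expR.
have [h1 h2] := m_ge x ht; have k0 := kappa_gt0.
have k1 : kappa <= lambda * delta by rewrite /kappa ge_min lexx.
have k2 : kappa <= delta by rewrite /kappa ge_min lexx orbT.
move: (m _) (ln c0) h1 h2 => M q h1 h2; have [x0|x0] := leP 0 x.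
  rewrite (ger0_norm x0).
  have : kappa * x <= delta * x by rewrite ler_wpM2r.
  have : 0 <= lambda * (M - (q + delta * x)) by apply: mulr_ge0; [exact: ltW|lra].
  lra.
rewrite (ltr0_norm x0).
have : kappa * - x <= lambda * delta * - x by apply: ler_wpM2r => //; lra.
have : 0 <= lambda * (M - q) by apply: mulr_ge0; [exact: ltW|lra].
lra.
Qed.

Lemma wpow_real x : wpow (x +i* 0) = (expR (delta * x))%:C.
Proof. by rewrite -cexpR /wpow; congr cexp; apply: complex_eqP; rewrite /=; ring. Qed.

Lemma gext_real x : gext (x +i* 0) = (dagum lambda delta (expR x))%:C.
Proof.
have a0 := expR_gt0 (delta * x); have a1 : 0 < 1 + expR (delta * x) by rewrite addr_gt0.
have p1 : expR x `^ delta = expR (delta * x) by rewrite -expRM mulrC.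
rewrite /gext /gpow wpow_real /dagum p1.
have -> : clog2 (1 + (expR (delta * x))%:C) = (ln (1 + expR (delta * x)))%:C.
  rewrite -(rmorphD _ 1) /clog2 cmodR gtr0_norm//=.
  by rewrite mul0r atan0 mulr0.
have -> : lambda%:C * (delta%:C * (x +i* 0) - (ln (1 + expR (delta * x)))%:C) =
  (lambda * (delta * x - ln (1 + expR (delta * x))))%:C.
  by apply: complex_eqP; rewrite /=; ring.
rewrite cexpR -(rmorphB _ 1); congr (_%:C); congr (_ - _).
rewrite -[X in X `^ _](@lnK _ (expR (delta * x) / _)) ?posrE ?divr_gt0//.
by rewrite -expRM mulrC ln_div ?posrE// expRK.
Qed.

Lemma gext_dist_t x t : 0 <= t <= pi / 2 ->
  `|Im (gext (x +i* t))| <= Cgext' * expR (- (kappa * `|x|)) * t /\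
  `|Re (gext (x +i* t)) - Re (gext (x +i* 0))| <=
     Cgext' * expR (- (kappa * `|x|)) * t.
Proof.
move=> /andP[t0 t1].
have ht s : 0 <= s <= t -> 0 <= s <= pi / 2.
  by move=> /andP[a b]; rewrite a (le_trans b).
have dG s (hs : 0 <= s <= t) := holo_gext x (ht s hs) _ _ _ (erefl _) (is_cderive_t x s).
have bG s (hs : 0 <= s <= t) := cmod_gext'_le x (ht s hs).
split.
- have := @le_dist_derive _ (fun s => Im (gext (x +i* s)))
    (fun s => Im ('i * gext' (x +i* s))) 0 t (Cgext' * expR (- (kappa * `|x|))) t0.
  rewrite (_ : Im (gext (x +i* 0)) = 0) ?gext_real// !subr0; apply => s hs; first by case: (dG s hs).
  by apply: (le_trans (ler_Im_cmod _)); rewrite cmodM cmodi mul1r; exact: bG.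
- have := @le_dist_derive _ (fun s => Re (gext (x +i* s)))
    (fun s => Re ('i * gext' (x +i* s))) 0 t (Cgext' * expR (- (kappa * `|x|))) t0.
  rewrite subr0; apply => s hs; first by case: (dG s hs).
  by apply: (le_trans (ler_Re_cmod _)); rewrite cmodM cmodi mul1r; exact: bG.
Qed.

Let h0 : 0 <= (0 : R) <= pi / 2.
Proof. by rewrite lexx divr_ge0// pi_ge0. Qed.

Lemma gext_dist_x x y :
  `|Re (gext (x +i* 0)) - Re (gext (y +i* 0))| <= Cgext' * `|x - y|.
Proof.
apply: (@le_dist_deriveT _ (fun s => Re (gext (s +i* 0)))
  (fun s => Re (1 * gext' (s +i* 0)))) => s.
  by have [] := holo_gext s h0 _ _ _ (erefl _) (is_cderive_x s 0).
rewrite mul1r; apply: (le_trans (ler_Re_cmod _)); apply: (le_trans (cmod_gext'_le s h0)).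
rewrite ler_piMr ?(ltW Cgext'_gt0)// -expR0 ler_expR oppr_le0.
by apply: mulr_ge0 => //; exact: ltW kappa_gt0.
Qed.

Lemma dagum_expR_bounds x :
  0 <= dagum lambda delta (expR x) <= lambda * expR (- (delta * x)).
Proof.
have a0 := expR_gt0 (delta * x); have b0 := expR_gt0 (- (delta * x)).
have e1 : expR (delta * x) * expR (- (delta * x)) = 1 by rewrite -expRD subrr expR0.
have p1 : expR x `^ delta = expR (delta * x) by rewrite -expRM mulrC.
rewrite /dagum p1.
have -> : expR (delta * x) / (1 + expR (delta * x)) = (1 + expR (- (delta * x)))^-1.
  rewrite expRN; move: (expR _) a0 => a a0.
  by field; rewrite !gt_eqF//; lra.
have c1 : 0 < 1 + expR (- (delta * x)) by rewrite addr_gt0.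
rewrite -[X in X `^ _](@lnK _ _^-1) ?posrE ?invr_gt0// -expRM lnV ?posrE//.
have l0 : 0 <= ln (1 + expR (- (delta * x))) by rewrite ln_ge0// lerDl ltW.
have l1 := @le_ln1Dx _ (expR (- (delta * x))) (lt_trans (ltrN10 _) b0).
have l2 := @expR_ge1Dx _ (- ln (1 + expR (- (delta * x))) * lambda).
apply/andP; split; first by rewrite subr_ge0 -[leRHS]expR0 ler_expR mulNr oppr_le0 mulr_ge0// ltW.
apply: (@le_trans _ _ (lambda * ln (1 + expR (- (delta * x))))); first by lra.
by rewrite ler_wpM2l// ltW.
Qed.

End dagum_extension.
Arguments holo_gext {R delta} lambda hdelta x {t} _.
Arguments holo_gext' {R delta} lambda hdelta x {t} _.

(** * The half-plane Poisson representation *)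


Section cauchy_kernel.
Context {R : realType}.
Implicit Types (x y t : R) (z : R[i]).

(** In the variable [w = cexp z] this is [w ^ 2 / (w ^ 2 - 1)]: multiplied by
    [dw / w] it is the Cauchy kernel at [1] symmetrised with the one at [-1]. *)
Definition kern z : R[i] := cexp (z + z) * (cexp (z + z) - 1)^-1.
Definition kern' z : R[i] := - (2%:R * cexp (z + z) * (cexp (z + z) - 1)^-1 ^+ 2).

Lemma holo_kern z : cexp (z + z) - 1 != 0 -> holo kern z (kern' z).
Proof.
move=> n0.
have h1 := holo_comp (holoD (holo_id z) (holo_id z)) (holo_cexp _).
have h2 := holoM h1 (holo_comp (holoB h1 (holo_cst 1 z)) (holoV n0)).
apply: (holo_eq h2); rewrite /kern'; move: n0; move: (cexp _) => e n0.
by field.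
Qed.

Lemma holo_kern' z : cexp (z + z) - 1 != 0 -> exists d, holo kern' z d.
Proof.
move=> n0.
have h1 := holo_comp (holoD (holo_id z) (holo_id z)) (holo_cexp _).
have h2 := holo_comp (holoB h1 (holo_cst 1 z)) (holoV n0).
eexists; apply: holoN; apply: holoM.
  by apply: (holoM (holo_cst 2%:R z)); exact: h1.
by exact: (holoM h2 h2).
Qed.

Definition S4 y t : R := (expR y - expR (- y)) ^+ 2 + 4 * sin t ^+ 2.

Let ef y : expR y * expR (- y) = 1.
Proof. by rewrite -expRD subrr expR0. Qed.

Lemma S4_ge0 y t : 0 <= S4 y t.
Proof. by apply: addr_ge0; [exact: sqr_ge0|apply: mulr_ge0 => //; exact: sqr_ge0]. Qed.

Let kernRe y t : Re (cexp ((y +i* t) + (y +i* t)) - 1) =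
  expR y ^+ 2 * (1 - 2 * sin t ^+ 2) - 1.
Proof. by rewrite ReB /= expRD -expr2 cosD -!expr2 cos2sin2; congr (_ * _ - _); ring. Qed.

Let kernIm y t : Im (cexp ((y +i* t) + (y +i* t)) - 1) =
  expR y ^+ 2 * (2 * sin t * cos t).
Proof. by rewrite ImB /= expRD -expr2 sinD subr0; congr (_ * _); ring. Qed.

Lemma sqr_cmod_kern_denom y t :
  cmod (cexp ((y +i* t) + (y +i* t)) - 1) ^+ 2 = expR y ^+ 2 * S4 y t.
Proof.
rewrite sqr_cmod kernRe kernIm /S4; have := ef y; have := cos2Dsin2 t.
move: (expR y) (expR (- y)) (cos t) (sin t) => e f c s cs ee.
have -> : e ^+ 2 * ((e - f) ^+ 2 + 4 * s ^+ 2) =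
  (e ^+ 2) ^+ 2 - 2 * e ^+ 2 * (e * f) + (e * f) ^+ 2 + 4 * e ^+ 2 * s ^+ 2 by ring.
have -> : (e ^+ 2 * (2 * s * c)) ^+ 2 = 4 * (e ^+ 2) ^+ 2 * s ^+ 2 * c ^+ 2 by ring.
have -> : c ^+ 2 = 1 - s ^+ 2 by rewrite -cs; ring.
by rewrite ee; ring.
Qed.

Lemma cmod_kern_denom y t :
  cmod (cexp ((y +i* t) + (y +i* t)) - 1) = expR y * Num.sqrt (S4 y t).
Proof.
have a : 0 <= expR y * Num.sqrt (S4 y t) by rewrite mulr_ge0// ?expR_ge0// sqrtr_ge0.
apply/eqP; rewrite -(@eqrXn2 _ 2)// ?cmod_ge0//.
by rewrite sqr_cmod_kern_denom exprMn sqr_sqrtr// S4_ge0.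
Qed.

Lemma cmod_kern y t : cmod (kern (y +i* t)) = expR y / Num.sqrt (S4 y t).
Proof.
rewrite cmodM cmodV cmod_cexp cmod_kern_denom /= expRD invfM mulrA.
by rewrite mulfK// gt_eqF// expR_gt0.
Qed.

Lemma cmod_kern' y t : cmod (kern' (y +i* t)) = 2 / S4 y t.
Proof.
rewrite cmodN !cmodM !cmodV cmod_cexp cmod_kern_denom -(rmorph_nat (real_complex R) 2) cmodR ger0_norm//.
rewrite /= expRD -[in RHS](sqr_sqrtr (S4_ge0 y t)).
have := expR_gt0 y; move: (expR y) (Num.sqrt _) => e r e0.
have [->|r0] := eqVneq r 0; first by rewrite expr0n/= !(mulr0, invr0, expr0n).
by field; rewrite r0 gt_eqF.
Qed.

Lemma Im_kern y t : Im (kern (y +i* t)) = - (2 * sin t * cos t) / S4 y t.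
Proof.
have e0 := expR_gt0 y.
have [s0|s0] := eqVneq (S4 y t) 0.
  have : kern (y +i* t) = 0.
    rewrite /kern (_ : cexp _ - 1 = 0) ?invr0 ?mulr0//.
    by apply/Normc.eq0_normc; rewrite -cmodE cmod_kern_denom s0 sqrtr0 mulr0.
  by move=> ->; rewrite s0 invr0 mulr0.
have n0 : expR y ^+ 2 * S4 y t != 0 by rewrite mulf_neq0// expf_neq0// gt_eqF.
rewrite /kern -{1}(subrK 1 (cexp _)) mulrDl mul1r mulfV; last first.
  apply/eqP => h; move: n0; rewrite -sqr_cmod_kern_denom h (cmodR 0) normr0.
  by rewrite expr0n eqxx.
rewrite ImD add0r ImV -sqr_cmod sqr_cmod_kern_denom kernIm.
move: (expR y) (S4 y t) e0 s0 => e S e0 s0.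
by field; rewrite s0 gt_eqF.
Qed.

Lemma sin_ge_half t : 0 <= t <= pi / 2 -> t / 2 <= sin t.
Proof.
move=> /andP[t0 t1].
have h s : 0 <= s <= t / 2 -> cos (t / 2) <= cos s.
  move=> /andP[s0 s1]; have p0 := @pi_gt0 R.
  have a : s \in `[0, pi] by rewrite in_itv/=; apply/andP; split; lra.
  have b : t / 2 \in `[0, pi] by rewrite in_itv/=; apply/andP; split; lra.
  by rewrite leNgt ltr_cos// -leNgt.
have p0 := @pi_gt0 R.
have c0 : 0 <= cos (t / 2) by apply: cos_ge0_pihalf; apply/andP; split; lra.
have s1 : t / 2 * cos (t / 2) <= sin (t / 2).
  have [c /itvP cb] := @MVT_segment R sin cos 0 (t / 2) (divr_ge0 t0 (ler0n _ 2))
    (fun x _ => is_derive_sin x) (continuous_subspaceT (@continuous_sin R)).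
  rewrite sin0 !subr0 => ->; rewrite mulrC ler_wpM2r ?divr_ge0// h//.
  by rewrite !cb.
have c2 : 1 / 2 <= cos (t / 2) ^+ 2.
  have : 0 <= cos t by apply: cos_ge0_pihalf; apply/andP; split; lra.
  rewrite {1}(_ : t = t / 2 + t / 2); last by field.
  by rewrite cosD -!expr2 (sin2cos2 (t / 2)); lra.
rewrite (_ : sin t = 2 * sin (t / 2) * cos (t / 2)); last first.
  by rewrite {1}(_ : t = t / 2 + t / 2) ?sinD; [ring|field].
have h3 : t / 2 * cos (t / 2) * cos (t / 2) <= sin (t / 2) * cos (t / 2).
  by rewrite ler_wpM2r.
have h4 : t / 2 * (1 / 2) <= t / 2 * cos (t / 2) ^+ 2.
  by rewrite ler_wpM2l// divr_ge0.
by move: h4; rewrite expr2 mulrA; lra.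
Qed.

Lemma expR_gap y : `|y| <= `|expR y - expR (- y)|.
Proof.
have [y0|y0] := leP 0 y.
  rewrite !ger0_norm//; last by rewrite subr_ge0 ler_expR; lra.
  have := @expR_ge1Dx _ y; have : expR (- y) <= 1 by rewrite -[leRHS]expR0 ler_expR; lra.
  by lra.
rewrite !ltr0_norm//; last by rewrite subr_lt0 ltr_expR; lra.
have := @expR_ge1Dx _ (- y); have : expR y <= 1 by rewrite -[leRHS]expR0 ler_expR; lra.
by lra.
Qed.

Lemma sqrt_S4_ge y t : 0 <= t <= pi / 2 -> (`|y| + t) / 2 <= Num.sqrt (S4 y t).
Proof.
move=> ht; have /andP[t0 _] := ht; have s0 := sin_ge_half ht.
rewrite -(@ler_pXn2r _ 2) ?nnegrE ?sqrtr_ge0//; last by rewrite divr_ge0// addr_ge0.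
rewrite sqr_sqrtr ?S4_ge0// /S4 -(real_normK (num_real (_ - _))).
have h1 : `|y| ^+ 2 <= `|expR y - expR (- y)| ^+ 2.
  by rewrite ler_pXn2r ?nnegrE// expR_gap.
have h2 : (t / 2) ^+ 2 <= sin t ^+ 2.
  by rewrite ler_pXn2r ?nnegrE ?divr_ge0// (le_trans _ s0)// divr_ge0.
have h3 := sqr_ge0 (`|y| - t).
move: (`|y|) (`|expR y - _|) (sin t) h1 h2 h3 => a b c h1 h2 h3; nra.
Qed.

Lemma dist_cmod_kern y t : 0 <= t <= pi / 2 ->
  (`|y| + t) * cmod (kern (y +i* t)) <= 2 * expR y.
Proof.
move=> ht; rewrite cmod_kern; have := sqrt_S4_ge y ht.
have := sqrtr_ge0 (S4 y t); rewrite le_eqVlt => /predU1P[<-|r0 h].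
  by rewrite invr0 !mulr0 mulr_ge0 ?expR_ge0.
rewrite mulrA ler_pdivrMr// -mulrA (mulrC (expR y)) mulrA ler_wpM2r ?expR_ge0//.
by lra.
Qed.

Let expR_large y : 1 <= `|y| -> expR `|y| <= 2 * `|expR y - expR (- y)|.
Proof.
have k (u : R) : 1 <= u -> expR u <= 2 * (expR u - expR (- u)).
  move=> u1; have e0 := expR_gt0 u; have := ef u; have := @expR_ge1Dx _ u.
  move: (expR u) (expR (- u)) e0 => e f e0 h1 h2.
  have : 2 * f <= e * f by rewrite ler_wpM2r; nra.
  by nra.
have [y0|y0] := leP 0 y.
  rewrite (ger0_norm y0) => y1; rewrite ger0_norm ?k// subr_ge0 ler_expR; lra.
rewrite (ltr0_norm y0) => y1; have := k _ y1; rewrite opprK distrC ger0_norm//.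
by rewrite subr_ge0 ler_expR; lra.
Qed.

Let sqrt_S4_gap y t : `|expR y - expR (- y)| <= Num.sqrt (S4 y t).
Proof.
rewrite -sqrtr_sqr; apply: ler_wsqrtr; rewrite /S4 lerDl.
by apply: mulr_ge0 => //; exact: sqr_ge0.
Qed.

Lemma cmod_kern_large y t : 1 <= `|y| -> cmod (kern (y +i* t)) <= 2.
Proof.
move=> y1; have h := expR_large y1; have g := sqrt_S4_gap y t.
have e0 := expR_gt0 `|y|; rewrite cmod_kern ler_pdivrMr; last by lra.
have : expR y <= expR `|y| by rewrite ler_expR ler_norm.
by lra.
Qed.

Lemma invS4_large y t : 1 <= `|y| -> 2 / S4 y t <= 8 * expR (- `|y|).
Proof.
move=> y1; have h := expR_large y1; have g := sqrt_S4_gap y t.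
have e0 := expR_gt0 `|y|.
have e1 : 1 <= expR `|y| by rewrite -[leLHS]expR0 ler_expR.
have r0 : expR `|y| / 2 <= Num.sqrt (S4 y t) by lra.
have S0 : (expR `|y| / 2) ^+ 2 <= S4 y t.
  by rewrite -(sqr_sqrtr (S4_ge0 y t)) ler_pXn2r// nnegrE; lra.
have q0 : 0 < (expR `|y| / 2) ^+ 2 by rewrite exprn_gt0// divr_gt0.
rewrite ler_pdivrMr ?(lt_le_trans q0)//.
apply: (@le_trans _ _ (8 * expR (- `|y|) * (expR `|y| / 2) ^+ 2)); last first.
  by rewrite ler_wpM2l// mulr_ge0// expR_ge0.
have := ef `|y|; move: (expR `|y|) (expR (- `|y|)) e1 => e f e1 ee.
have -> : 8 * f * (e / 2) ^+ 2 = 2 * (e * f) * e by field.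
by rewrite ee mulr1; lra.
Qed.

Lemma Im_kern_large y t : 1 <= `|y| ->
  `|Im (kern (y +i* t))| <= 8 * expR (- `|y|).
Proof.
move=> y1; apply: le_trans (invS4_large t y1).
rewrite Im_kern normrM normrV ?unitfE; last first.
  rewrite gt_eqF//.
  have h := expR_large y1; have g := sqrt_S4_gap y t; have e0 := expR_gt0 `|y|.
  by rewrite -sqrtr_gt0; lra.
rewrite (ger0_norm (S4_ge0 y t)) ler_wpM2r ?invr_ge0 ?S4_ge0//.
rewrite normrN !normrM (ger0_norm (ler0n _ 2)).
have := sin_max t; have := cos_max t.
by move: `|cos t| `|sin t| (normr_ge0 (cos t)) (normr_ge0 (sin t)) => a b; nra.
Qed.

(** Away from the pole, uniformly in [x]. *)
Lemma cmod_kern_le y t (t1 : R) : 0 < t1 -> t1 <= t <= pi / 2 ->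
  cmod (kern (y +i* t)) <= 2 + 2 * expR 1 / t1.
Proof.
move=> t10 /andP[a b]; have e1 := expR_gt0 (1 : R).
have q0 : 0 <= 2 * expR 1 / t1 by rewrite divr_ge0 ?mulr_ge0// ltW.
have [y1|y1] := leP 1 `|y|; first by rewrite (le_trans (cmod_kern_large t y1)) ?lerDl.
have ht : 0 <= t <= pi / 2 by rewrite b andbT; lra.
have h := dist_cmod_kern y ht; have k0 := cmod_ge0 (kern (y +i* t)).
have : cmod (kern (y +i* t)) <= 2 * expR 1 / t1; last by lra.
rewrite ler_pdivlMr//.
have : expR y <= expR 1 by rewrite ler_expR; have := ler_norm y; lra.
have : t1 * cmod (kern (y +i* t)) <= (`|y| + t) * cmod (kern (y +i* t)).
  by rewrite ler_wpM2r//; have := normr_ge0 y; lra.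
by lra.
Qed.

Lemma cmod_kern'_le y t (t1 : R) : 0 < t1 -> t1 <= t <= pi / 2 ->
  cmod (kern' (y +i* t)) <= (8 + 8 * expR 1 / t1 ^+ 2) * expR (- `|y|).
Proof.
move=> t10 /andP[a b]; have e1 := expR_gt0 (1 : R); rewrite cmod_kern'.
have q0 : 0 <= 8 * expR 1 / t1 ^+ 2 * expR (- `|y|).
  by rewrite mulr_ge0 ?expR_ge0// divr_ge0 ?mulr_ge0 ?sqr_ge0// ltW.
rewrite [leRHS]mulrDl; have [y1|y1] := leP 1 `|y|.
  by rewrite (le_trans (invS4_large t y1)) ?lerDl.
have ht : 0 <= t <= pi / 2 by rewrite b andbT; lra.
have S0 : (t1 / 2) ^+ 2 <= S4 y t.
  rewrite -(sqr_sqrtr (S4_ge0 y t)) ler_pXn2r ?nnegrE ?sqrtr_ge0//; last by lra.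
  by have := sqrt_S4_ge y ht; have := normr_ge0 y; lra.
have r0 : 0 < (t1 / 2) ^+ 2 by rewrite exprn_gt0//; lra.
apply: (@le_trans _ _ (8 * expR 1 / t1 ^+ 2 * expR (- `|y|))); last first.
  by rewrite lerDr mulr_ge0// expR_ge0.
apply: (@le_trans _ _ (2 / (t1 / 2) ^+ 2)).
  by rewrite ler_wpM2l// lef_pV2// posrE (lt_le_trans r0).
have -> : 2 / (t1 / 2) ^+ 2 = 8 / t1 ^+ 2 by field; rewrite gt_eqF.
rewrite -!mulrA ler_wpM2l// mulrCA ler_peMr ?invr_ge0 ?sqr_ge0//.
by rewrite -expRD -[leLHS]expR0 ler_expR; lra.
Qed.

End cauchy_kernel.


Ltac nneg := repeat first [done | exact: expR_ge0 | exact: cmod_ge0 | apply: mulr_ge0].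

Section poisson_representation.
Context {R : realType}.
Notation mu := (@lebesgue_measure R).
Variables (delta lambda : R).
Hypothesis (hdelta : 0 < delta < 2) (hlambda : 0 < lambda).
Implicit Types (x t : R) (z : R[i]).

Local Notation gext := (gext delta lambda).
Local Notation gext' := (gext' delta lambda).
Local Notation C1 := (Cgext' delta lambda).
Local Notation C2 := (1 + Cgpow delta lambda).
Local Notation kap := (kappa delta lambda).

Let pi2_gt0 : 0 < pi / 2 :> R. Proof. by rewrite divr_gt0// pi_gt0. Qed.
Let pi2_le2 : pi / 2 <= 2 :> R. Proof. by case/andP: (@pihalf_02_cos_pihalf R).1. Qed.
Let C10 : 0 < C1. Proof. exact: Cgext'_gt0. Qed.
Let C20 : 0 < C2. Proof. by rewrite addr_gt0// expR_gt0. Qed.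
Let kap0 : 0 < kap. Proof. exact: kappa_gt0. Qed.
Let C1ge : 0 <= C1. Proof. exact: ltW. Qed.
Let C2ge : 0 <= C2. Proof. exact: ltW. Qed.
Let kapge : 0 <= kap. Proof. exact: ltW. Qed.

Lemma cvg_dist_le (F : set_system R) {FF : Filter F} (f g : R -> R) (l : R) :
  (\forall x \near F, `|l - f x| <= g x) -> g x @[x --> F] --> (0 : R) ->
  f x @[x --> F] --> l.
Proof.
move=> h gl; apply/cvgrPdist_le => e e0; near=> x.
apply: le_trans (near h x _) _ => //.
near: x; move/cvgrPdist_le : gl => /(_ e e0); apply: filterS => x.
by rewrite sub0r normrN; apply: le_trans; exact: ler_norm.
Unshelve. end_near. Qed.

Lemma cvg_expRN_scale (c : R) : 0 < c -> expR (- (c * x)) @[x --> +oo] --> (0 : R).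
Proof.
move=> c0; apply: (cvg_comp (fun x => c * x) (fun y => expR (- y)) _ (@cvgr_expR R)).
by apply: gt0_cvgMry => //; exact: cvg_id.
Qed.

Variable x0 : R.
Let g0 : R := dagum lambda delta (expR x0).

Let H z := (gext z - g0%:C) * kern (z - x0%:C).
Let H' z := gext' z * kern (z - x0%:C) + (gext z - g0%:C) * kern' (z - x0%:C).

Let shiftE x t : x +i* t - x0%:C = (x - x0) +i* t.
Proof. by apply: complex_eqP; rewrite /= ?subr0. Qed.

Let denom_neq0 y t : 0 <= t <= pi / 2 -> 0 < `|y| + t ->
  cexp ((y +i* t) + (y +i* t)) - 1 != 0.
Proof.
move=> ht yt; apply/eqP => h; have := cmod_kern_denom y t.
rewrite h (cmodR 0) normr0 => /esym/eqP; rewrite mulf_eq0 gt_eqF ?expR_gt0//=.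
by rewrite gt_eqF//; apply: lt_le_trans (sqrt_S4_ge y ht); rewrite divr_gt0.
Qed.

Let holoH x t : 0 <= t <= pi / 2 -> 0 < `|x - x0| + t -> holo H (x +i* t) (H' (x +i* t)).
Proof.
move=> ht xt; have n0 := denom_neq0 ht xt.
have h1 := holoB (holo_gext lambda hdelta x ht) (holo_cst g0%:C _).
have n1 : cexp ((x +i* t - x0%:C) + (x +i* t - x0%:C)) - 1 != 0 by rewrite shiftE.
have h2 := holo_comp (holoB (holo_id (x +i* t)) (holo_cst x0%:C _)) (holo_kern n1).
by apply: (holo_eq (holoM h1 h2)); rewrite subr0 subr0 mul1r.
Qed.

Let holoH' x t : 0 <= t <= pi / 2 -> 0 < `|x - x0| + t -> exists d, holo H' (x +i* t) d.
Proof.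
move=> ht xt; have n0 := denom_neq0 ht xt.
have n1 : cexp ((x +i* t - x0%:C) + (x +i* t - x0%:C)) - 1 != 0 by rewrite shiftE.
have s := holoB (holo_id (x +i* t)) (holo_cst x0%:C _).
have h1 := holoB (holo_gext lambda hdelta x ht) (holo_cst g0%:C _).
have h2 := holo_comp s (holo_kern n1).
have [k' hk'] := holo_kern' n1; have h3 := holo_comp s hk'.
have [g' hg'] := holo_gext' lambda hdelta x ht.
by eexists; exact: (holoD (holoM hg' h2) (holoM h1 h3)).
Qed.

Let g0E : g0%:C = gext (x0 +i* 0).
Proof. by rewrite gext_real. Qed.

Let h00 : 0 <= (0 : R) <= pi / 2. Proof. by rewrite lexx ltW. Qed.

Let cmod_g0 : cmod g0%:C <= C2.
Proof. by rewrite g0E cmod_gext_le. Qed.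

Let cmod_diff_le x t : 0 <= t <= pi / 2 -> cmod (gext (x +i* t) - g0%:C) <= 2 * C2.
Proof.
move=> ht; apply: (le_trans (ler_cmodB _ _)); have := cmod_g0.
by have := cmod_gext_le hdelta hlambda x ht; lra.
Qed.

Let expRN_le1 (u : R) : 0 <= u -> expR (- u) <= 1.
Proof. by move=> u0; rewrite -[leRHS]expR0 ler_expR oppr_le0. Qed.

Let cmod_diff_lip x t : 0 <= t <= pi / 2 ->
  cmod (gext (x +i* t) - g0%:C) <= 2 * C1 * (`|x - x0| + t).
Proof.
move=> ht; have /andP[t0 _] := ht; apply: (le_trans (ler_cmod _)).
rewrite ReB ImB /= subr0.
have [h1 h2] := gext_dist_t hdelta hlambda x ht.
have h3 := gext_dist_x hdelta hlambda x x0.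
have e1 : expR (- (kap * `|x|)) <= 1 by apply: expRN_le1; rewrite mulr_ge0.
have h4 : C1 * expR (- (kap * `|x|)) * t <= C1 * t.
  by rewrite ler_wpM2r// ler_piMr.
have h5 : `|Re (gext (x +i* t)) - g0| <=
    `|Re (gext (x +i* t)) - Re (gext (x +i* 0))| + `|Re (gext (x +i* 0)) - Re (gext (x0 +i* 0))|.
  by rewrite -g0E /= (le_trans _ (ler_normD _ _))// addrA subrK.
have h6 : 0 <= C1 * `|x - x0| by nneg.
by lra.
Qed.

Let Phi x := 4 * C1 * expR (- (kap * `|x|)) +
  (16 * C2 + 4 * C1 * expR 2) * expR (- (1 * `|x - x0|)).

Let integrable_Phi A B : mu.-integrable setT (EFin \o (fun x =>
  A * expR (- (kap * `|x|)) + B * expR (- (1 * `|x - x0|)))).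
Proof.
apply: integrableD_R => //; apply: integrableZl_R => //.
  have := integrable_expRN_norm 0 kap0.
  by under eq_fun do rewrite subr0.
exact: integrable_expRN_norm.
Qed.

Let ImH_le x t : 0 <= t <= pi / 2 -> `|Im (H (x +i* t))| <= Phi x.
Proof.
move=> ht; have /andP[t0 t1] := ht; rewrite /Phi mul1r.
have e2 := expR_gt0 (2 : R); have ex := expR_gt0 (- (kap * `|x|)).
have ey := expR_gt0 (- `|x - x0|).
have p0 : 0 <= 4 * C1 * expR 2 * expR (- `|x - x0|) by nneg.
have [y1|y1] := leP 1 `|x - x0|.
  suff : `|Im (H (x +i* t))| <= 4 * C1 * expR (- (kap * `|x|)) +
    16 * C2 * expR (- `|x - x0|) by lra.
  rewrite /H shiftE ImM.
  apply: (le_trans (ler_normD _ _)); rewrite addrC !normrM; apply: lerD.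
    have [h1 _] := gext_dist_t hdelta hlambda x ht.
    have h2 := le_trans (ler_Re_cmod _) (cmod_kern_large t y1).
    have h3 : C1 * expR (- (kap * `|x|)) * t <= C1 * expR (- (kap * `|x|)) * 2.
      by apply: ler_wpM2l; [nneg|exact: le_trans t1 pi2_le2].
    rewrite ImB /= subr0.
    apply: (@le_trans _ _ (C1 * expR (- (kap * `|x|)) * 2 * 2)); last by lra.
    by rewrite ler_pM// (le_trans h1).
  have h2 := Im_kern_large t y1.
  have h1 := le_trans (ler_Re_cmod _) (cmod_diff_le x ht).
  apply: (@le_trans _ _ (2 * C2 * (8 * expR (- `|x - x0|)))); last by lra.
  by rewrite ler_pM.
apply: (le_trans (ler_Im_cmod _)); rewrite /H shiftE cmodM.
have h1 := cmod_diff_lip x ht; have h2 := dist_cmod_kern (x - x0) ht.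
have h3 : cmod (gext (x +i* t) - g0%:C) * cmod (kern ((x - x0) +i* t)) <=
  2 * C1 * (2 * expR (x - x0)).
  apply: (@le_trans _ _ (2 * C1 * (`|x - x0| + t) * cmod (kern ((x - x0) +i* t)))).
    by rewrite ler_wpM2r// cmod_ge0.
  by rewrite -mulrA ler_wpM2l// mulr_ge0// ltW.
apply: (le_trans h3).
have h4 : expR (x - x0) <= expR 2 * expR (- `|x - x0|).
  by rewrite -expRD ler_expR; have := ler_norm (x - x0); lra.
have h5 : 4 * C1 * expR (x - x0) <= 4 * C1 * (expR 2 * expR (- `|x - x0|)).
  by apply: ler_wpM2l => //; nneg.
have h6 : 0 <= 4 * C1 * expR (- (kap * `|x|)) by nneg.
have h7 : 0 <= 16 * C2 * expR (- `|x - x0|) by nneg.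
by lra.
Qed.

Let H'_le (t1 : R) x t : 0 < t1 -> t1 <= t <= pi / 2 -> cmod (H' (x +i* t)) <=
  C1 * (2 + 2 * expR 1 / t1) * expR (- (kap * `|x|)) +
  2 * C2 * (8 + 8 * expR 1 / t1 ^+ 2) * expR (- (1 * `|x - x0|)).
Proof.
move=> t10 tt; have ht : 0 <= t <= pi / 2.
  by case/andP: tt => a ->; rewrite andbT; lra.
rewrite mul1r /H' shiftE; apply: (le_trans (ler_cmodD _ _)).
rewrite (cmodM (gext' _)) (cmodM (gext _ - _)); apply: lerD.
  rewrite [leRHS]mulrAC; apply: ler_pM; rewrite ?cmod_ge0//.
    exact: cmod_gext'_le.
  exact: cmod_kern_le.
rewrite -[leRHS](mulrA (2 * C2)); apply: ler_pM; rewrite ?cmod_ge0//.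
  exact: cmod_diff_le.
exact: cmod_kern'_le.
Qed.

Let pos_dist x t : 0 < t -> 0 < `|x - x0| + t.
Proof. by move=> t0; rewrite ltr_wpDl. Qed.

Let continuous_ImH t : 0 < t <= pi / 2 -> continuous (fun x => Im (H (x +i* t))).
Proof.
move=> /andP[t0 t1] x.
have ht : 0 <= t <= pi / 2 by rewrite ltW.
by have [] := holo_continuous (holoH ht (pos_dist x t0)) (erefl _) (is_cderive_x x t).
Qed.

Let integrable_ImH t : 0 < t <= pi / 2 ->
  mu.-integrable setT (EFin \o (fun x => Im (H (x +i* t)))).
Proof.
move=> ht; apply: (@integrable_le _ _ _ mu _ Phi) => //.
- by apply: continuous_measurable_setT; exact: continuous_ImH.
- by move=> x _; apply: ImH_le; case/andP: ht => /ltW -> ->.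
- exact: integrable_Phi.
Qed.

Let J t := \int[mu]_x Im (H (x +i* t)).

Let cvg_ReH_Ny t : 0 < t <= pi / 2 -> Re (H (x +i* t)) @[x --> -oo] --> (0 : R).
Proof.
move=> /andP[t0 t1]; have ht : 0 <= t <= pi / 2 by rewrite ltW.
apply: (@cvg_dist_le _ _ _ (fun x => 2 * C2 * (2 / t) * expR (x - x0))).
  apply: nearW => x; rewrite sub0r normrN; apply: (le_trans (ler_Re_cmod _)).
  rewrite /H shiftE cmodM -mulrA ler_pM ?cmod_ge0 ?cmod_diff_le//.
  have := dist_cmod_kern (x - x0) ht; have := cmod_ge0 (kern ((x - x0) +i* t)).
  move: (cmod _) => c c0; rewrite mulrAC ler_pdivlMr//.
  have : 0 <= `|x - x0| * c by rewrite mulr_ge0.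
  by lra.
rewrite -(mulr0 (2 * C2 * (2 / t))); apply: cvgM; first exact: cvg_cst.
apply/cvgNy_compNP.
have -> : (fun x => expR (x - x0)) \o -%R = (fun u => expR (- x0) * expR (- (1 * u))).
  by apply/funext => u /=; rewrite -expRD; congr expR; lra.
have h : expR (- x0) * expR (- (1 * u)) @[u --> +oo] --> expR (- x0) * (0 : R).
  by apply: cvgM; [exact: cvg_cst|exact: cvg_expRN_scale].
by rewrite mulr0 in h.
Qed.

Let kern_sub1 y t : 0 < t <= pi / 2 ->
  cmod (kern (y +i* t) - 1) <= (2 + 2 * expR 1 / t) * expR (- (2 * y)).
Proof.
move=> /andP[t0 t1]; have ht : 0 <= t <= pi / 2 by rewrite ltW.
have yt : 0 < `|y| + t by rewrite ltr_wpDl.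
have n0 := denom_neq0 ht yt.
have -> : kern (y +i* t) - 1 = kern (y +i* t) * (cexp ((y +i* t) + (y +i* t)))^-1.
  rewrite /kern; have := cexp_neq0 ((y +i* t) + (y +i* t)).
  by move: n0; move: (cexp _) => e n0 e0; field; rewrite n0 e0.
rewrite cmodM cmodV cmod_cexp /= -expRN (_ : - (y + y) = - (2 * y)); last by ring.
rewrite ler_wpM2r ?expR_ge0//; apply: cmod_kern_le => //.
by rewrite lexx.
Qed.

Let cvg_ReH_y t : 0 < t <= pi / 2 -> Re (H (x +i* t)) @[x --> +oo] --> - g0.
Proof.
move=> /andP[t0 t1]; have ht : 0 <= t <= pi / 2 by rewrite ltW.
have tt : 0 < t <= pi / 2 by rewrite t0.
pose Kb := 2 + 2 * expR 1 / t.
have Kb0 : 0 <= Kb by rewrite addr_ge0// divr_ge0 ?mulr_ge0 ?expR_ge0// ltW.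
apply: (@cvg_dist_le _ _ _ (fun x =>
    (2 * C1 * t * expR (- (kap * x)) + lambda * expR (- (delta * x))) * Kb +
    C2 * (Kb * (expR (2 * x0) * expR (- (2 * x)))))).
  near=> x; have xpos : 0 <= x by near: x; exact: nbhs_pinfty_ge.
  have -> : - g0 - Re (H (x +i* t)) = - Re (gext (x +i* t) * kern ((x - x0) +i* t)
      - g0%:C * (kern ((x - x0) +i* t) - 1)).
    by rewrite /H shiftE mulrBl ReB ReB (ReM g0%:C) (ReM g0%:C) ReB /=; ring.
  rewrite normrN; apply: (le_trans (ler_Re_cmod _)); apply: (le_trans (ler_cmodB _ _)).
  rewrite (cmodM (gext _)) (cmodM _%:C); apply: lerD.
    apply: ler_pM; rewrite ?cmod_ge0//; last first.
      by apply: cmod_kern_le => //; rewrite lexx.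
    apply: (le_trans (ler_cmod _)); have [h1 h2] := gext_dist_t hdelta hlambda x ht.
    have /andP[h3 h4] := dagum_expR_bounds delta hlambda x.
    have h5 : `|Re (gext (x +i* 0))| <= lambda * expR (- (delta * x)).
      by rewrite gext_real /= ger0_norm.
    have h6 : `|Re (gext (x +i* t))| <=
      `|Re (gext (x +i* t)) - Re (gext (x +i* 0))| + `|Re (gext (x +i* 0))|.
      by rewrite (le_trans _ (ler_normD _ _))// subrK.
    by rewrite (ger0_norm xpos) in h1 h2; lra.
  apply: ler_pM; rewrite ?cmod_ge0// ?cmod_g0//; apply: (le_trans (kern_sub1 _ tt)).
  by rewrite -expRD; apply: ler_wpM2l => //; rewrite ler_expR; lra.
have e c : 0 < c -> expR (- (c * x)) @[x --> +oo] --> (0 : R) by exact: cvg_expRN_scale.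
have -> : (0 : R) = (2 * C1 * t * 0 + lambda * 0) * Kb + C2 * (Kb * (expR (2 * x0) * 0)).
  by rewrite !(mulr0, mul0r, addr0).
have d0 : 0 < delta by case/andP: hdelta.
apply: cvgD; apply: cvgM; [|exact: cvg_cst|exact: cvg_cst|].
  by apply: cvgD; apply: cvgM; [exact: cvg_cst|exact: e|exact: cvg_cst|exact: e].
by apply: cvgM; [exact: cvg_cst|apply: cvgM; [exact: cvg_cst|exact: e]].
Unshelve. end_near. Qed.

(** Cauchy-Riemann turns the derivative in the angle into the integral of a
    derivative along the ray, hence into boundary terms. *)
Let is_derive_J t : 0 < t < pi / 2 -> is_derive t 1 J (- g0).
Proof.
move=> /andP[t0 t1].
have itvt s : s \in `]t / 2, pi / 2[ -> 0 < s <= pi / 2 /\ t / 2 <= s <= pi / 2.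
  rewrite in_itv/= => /andP[a b]; split; apply/andP; split; try exact: ltW; lra.
have It : t \in `]t / 2, pi / 2[ by rewrite in_itv/= t1 andbT; lra.
have dI s x : s \in `]t / 2, pi / 2[ ->
    is_derive s 1 (fun s => Im (H (x +i* s))) (Re (H' (x +i* s))).
  move=> /itvt[/andP[s0 s1] _]; have hs : 0 <= s <= pi / 2 by rewrite ltW.
  have [_ h] := holoH hs (pos_dist x s0) (erefl _) (is_cderive_t x s).
  by apply: (is_derive_eq h); rewrite ImM/= mul0r add0r mul1r.
have intG := integrable_Phi (C1 * (2 + 2 * expR 1 / (t / 2)))
   (2 * C2 * (8 + 8 * expR 1 / (t / 2) ^+ 2)).
set G := (fun x : R => _) in intG.
have h1 s : s \in `]t / 2, pi / 2[ ->
    mu.-integrable setT (EFin \o (fun x => Im (H (x +i* s)))).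
  by move=> /itvt[/integrable_ImH].
have h2 s x : s \in `]t / 2, pi / 2[ -> [set: R] x ->
    derivable (fun s => Im (H (x +i* s))) s 1.
  by move=> hs _; case: (dI s x hs).
have p1 s x : s \in `]t / 2, pi / 2[ ->
    partial1of2 (fun s x => Im (H (x +i* s))) s x = Re (H' (x +i* s)).
  by move=> hs; rewrite partial1of2E; have [_ ->] := dI s x hs.
have G0 x : 0 <= G x.
  have hq : t / 2 <= t <= pi / 2 by apply/andP; split; lra.
  by apply: le_trans (H'_le x _ hq); [exact: cmod_ge0|lra].
have h3 s x : s \in `]t / 2, pi / 2[ -> [set: R] x ->
    `|partial1of2 (fun s x => Im (H (x +i* s))) s x| <= G x.
  move=> hs _; rewrite p1//; apply: (le_trans (ler_Re_cmod _)).
  by apply: H'_le; [lra|case: (itvt s hs)].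
have dJ := @derivable_under_integral R _ _ mu (fun s x => Im (H (x +i* s)))
  setT measurableT t (t / 2) (pi / 2) It h1 h2 G G0 intG h3.
have eJ := @differentiation_under_integral R _ _ mu (fun s x => Im (H (x +i* s)))
  setT measurableT t (t / 2) (pi / 2) It h1 h2 G G0 intG h3.
split => //; rewrite -derive1E; apply: (eq_trans eJ).
have ht : 0 < t <= pi / 2 by rewrite t0 ltW.
have ht' : 0 <= t <= pi / 2 by rewrite !ltW.
transitivity (\int[mu]_x Re (H' (x +i* t))).
  by apply: eq_Rintegral => x _; exact: p1.
have cH' : continuous (fun x => Re (H' (x +i* t))).
  move=> x; have [k hk] := holoH' ht' (pos_dist x t0).
  by have [] := holo_continuous hk (erefl _) (is_cderive_x x t).
have iH' : mu.-integrable setT (EFin \o (fun x => Re (H' (x +i* t)))).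
  apply: (@integrable_le _ _ _ mu _ G) => //.
    exact: continuous_measurable_setT.
  by move=> x _; rewrite -p1//; exact: h3.
have dH x : is_derive x 1 (fun x => Re (H (x +i* t))) (Re (H' (x +i* t))).
  have [h _] := holoH ht' (pos_dist x t0) (erefl _) (is_cderive_x x t).
  by apply: (is_derive_eq h); rewrite mul1r.
by rewrite (Rintegral_primitive cH' iH' dH (cvg_ReH_Ny ht) (cvg_ReH_y ht)) subr0.
Qed.

Let eps (n : nat) : R := pi / 8 * n.+1%:R^-1.

Let eps_bound n : 0 < eps n <= pi / 8.
Proof.
have p8 : 0 < pi / 8 :> R by rewrite divr_gt0// pi_gt0.
rewrite /eps mulr_gt0 ?invr_gt0//=; apply: ler_piMr; first exact: ltW.
by rewrite invf_le1// ler1n.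
Qed.

Let cvg_eps : eps n @[n --> \oo] --> 0.
Proof.
rewrite -(mulr0 (pi / 8)); apply: cvgM; first exact: cvg_cst.
exact: cvg_harmonic.
Qed.

Let J_increment n : J (pi / 2 - eps n) - J (eps n) = - g0 * (pi / 2 - eps n - eps n).
Proof.
have /andP[e0 e1] := eps_bound n; have p0 := @pi_gt0 R.
have ab : eps n <= pi / 2 - eps n by lra.
have [||c _ ->//] := @MVT_segment R J (fun=> - g0) (eps n) (pi / 2 - eps n) ab.
  move=> x /itvP xab; apply: is_derive_J.
  by apply/andP; split; [rewrite (lt_trans e0)// xab|rewrite (lt_trans (y := pi / 2 - eps n)) ?xab//; lra].
apply: derivable_within_continuous => x; rewrite in_itv/= => /andP[xa xb].
by have [] : is_derive x 1 J (- g0) by apply: is_derive_J; apply/andP; split; lra.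
Qed.

Let cvg_J (s : nat -> R) (l : R) : (forall n, 0 < s n <= pi / 2) -> 0 <= l <= pi / 2 ->
  s n @[n --> \oo] --> l ->
  measurable_fun setT (fun x => Im (H (x +i* l))) ->
  J (s n) @[n --> \oo] --> J l.
Proof.
move=> hs hl sl ml.
apply: (@cvg_Rintegral _ _ _ mu (fun n x => Im (H (x +i* s n))) _ Phi) => //.
- by move=> n; apply: continuous_measurable_setT; exact: continuous_ImH.
- exists [set x0]; split; [exact: measurable_set1|exact: lebesgue_measure_set1|].
  move=> x /=; apply: contra_notP => /eqP xx0.
  have pd : 0 < `|x - x0| + l.
    by rewrite ltr_pwDl ?normr_gt0 ?subr_eq0//; case/andP: hl.
  have [_ cH] := holo_continuous (holoH hl pd) (erefl _) (is_cderive_t x l).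
  exact: (cvg_comp _ _ sl cH).
- exact: integrable_Phi.
- by move=> n x; apply: ImH_le; case/andP: (hs n) => /ltW -> ->.
Qed.

Let ImH_real x : Im (H (x +i* 0)) = 0.
Proof.
rewrite /H shiftE gext_real -(rmorphB (real_complex R)).
have -> : kern ((x - x0) +i* 0) = (expR (x - x0 + (x - x0)) * (expR (x - x0 + (x - x0)) - 1)^-1)%:C.
  have e : ((x - x0) +i* 0) + ((x - x0) +i* 0) = (x - x0 + (x - x0))%:C.
    by apply: complex_eqP; rewrite /= ?addr0.
  by rewrite /kern e cexpR -(rmorphB (real_complex R) _ 1) -fmorphV -rmorphM.
by rewrite -rmorphM.
Qed.

Let J_pi2 : J (pi / 2) = - g0 * (pi / 2).
Proof.
have h1 : J (eps n) @[n --> \oo] --> J 0.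
  apply: cvg_J.
  - move=> n; have /andP[e0 e1] := eps_bound n; have p0 := @pi_gt0 R.
    by apply/andP; split; lra.
  - exact: h00.
  - exact: cvg_eps.
  - by rewrite (_ : (fun _ => _) = cst 0)//; apply/funext => x; exact: ImH_real.
have h2 : J (pi / 2 - eps n) @[n --> \oo] --> J (pi / 2).
  apply: cvg_J.
  - move=> n; have /andP[e0 e1] := eps_bound n; have p0 := @pi_gt0 R.
    by apply/andP; split; lra.
  - by rewrite lexx ltW.
  - rewrite -[X in _ --> X]subr0; apply: cvgB; first exact: cvg_cst.
    exact: cvg_eps.
  - apply: continuous_measurable_setT; apply: continuous_ImH.
    by rewrite lexx pi2_gt0.
have J0 : J 0 = 0.
  rewrite /J; under eq_Rintegral do rewrite ImH_real.
  by rewrite Rintegral_cst// mul0r.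
have h3 : J (pi / 2 - eps n) - J (eps n) @[n --> \oo] --> J (pi / 2).
  by rewrite -[X in _ --> X]subr0 -J0; exact: cvgB.
have h4 : J (pi / 2 - eps n) - J (eps n) @[n --> \oo] --> - g0 * (pi / 2 - 0 - 0).
  under eq_fun do rewrite J_increment.
  apply: cvgM; first exact: cvg_cst.
  apply: cvgB; last exact: cvg_eps.
  by apply: cvgB; [exact: cvg_cst|exact: cvg_eps].
rewrite !subr0 in h4; exact: (cvg_unique (@Rhausdorff R) h3 h4).
Qed.

Let ImH_pi2 x : Im (H (x +i* (pi / 2))) = Im (gext (x +i* (pi / 2))) *
  (expR x ^+ 2 / (expR x ^+ 2 + expR x0 ^+ 2)).
Proof.
rewrite /H shiftE.
have -> : kern ((x - x0) +i* (pi / 2)) = (expR x ^+ 2 / (expR x ^+ 2 + expR x0 ^+ 2))%:C.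
  have e : cexp (((x - x0) +i* (pi / 2)) + ((x - x0) +i* (pi / 2))) =
      (- (expR x / expR x0) ^+ 2)%:C.
    rewrite /cexp/= -splitr cospi sinpi mulr0 mulrN1.
    by rewrite expRD -expr2 expRD expRN.
  rewrite /kern e -(rmorphB (real_complex R) _ 1) -fmorphV -rmorphM; congr (_%:C).
  have := expR_gt0 x; have := expR_gt0 x0; move: (expR x) (expR x0) => a b b0 a0.
  have s0 : a ^+ 2 + b ^+ 2 != 0 by rewrite gt_eqF// addr_gt0// exprn_gt0.
  have b1 : b != 0 by rewrite gt_eqF.
  have -> : - (a / b) ^+ 2 - 1 = - ((a ^+ 2 + b ^+ 2) / b ^+ 2) by field.
  by field; rewrite b1 s0.
by rewrite ImM ReB ImB /= !subr0 mulr0 add0r.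
Qed.

(** The Dagum function as a superposition of the functions
    [u |-> (t ^ 2 + u ^ 2)^-1], with [t = expR x]. *)
Lemma dagum_poisson : dagum lambda delta (expR x0) =
  \int[mu]_x (- (2 / pi) * Im (gext (x +i* (pi / 2))) *
    (expR x ^+ 2 / (expR x ^+ 2 + expR x0 ^+ 2))).
Proof.
have hp : 0 < (pi / 2 : R) <= pi / 2 by rewrite pi2_gt0 /=.
have -> : \int[mu]_x (- (2 / pi) * Im (gext (x +i* (pi / 2))) *
    (expR x ^+ 2 / (expR x ^+ 2 + expR x0 ^+ 2))) = - (2 / pi) * J (pi / 2).
  rewrite /J -RintegralZl//; last exact: integrable_ImH.
  by apply: eq_Rintegral => x _; rewrite ImH_pi2 mulrA.
have p0 : (pi : R) != 0 by rewrite gt_eqF// pi_gt0.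
rewrite J_pi2 -/g0; move: g0 => r.
move: p0; move: (pi : R) => p p0.
by field.
Qed.

End poisson_representation.

(** * The modified Bessel function of the second kind *)

Section bessel_integral.
Context {R : realType}.
Notation mu := (@lebesgue_measure R).
Implicit Types (nu x u v : R).

Lemma integral_gauss (s : R) : 0 < s ->
  (\int[mu]_x (expR (- (s * x ^+ 2)))%:E = (Num.sqrt (pi / s))%:E)%E.
Proof.
move=> s0; have r0 : 0 < Num.sqrt s by rewrite sqrtr_gt0.
have := @integral_affine R gauss_fun (Num.sqrt s) 0 r0 (@continuous_gauss_fun R)
  (@gauss_fun_ge0 R).
rewrite integralT_gauss => h.
have mg : measurable_fun setT (fun x : R => expR (- (s * x ^+ 2))).
  apply: continuous_measurable_setT => x.
  apply: (@continuous_comp _ _ _ (fun x : R => - (s * x ^+ 2)) expR);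
    last exact: continuous_expR.
  by apply: cvgN; apply: cvgM; [exact: cvg_cst|apply: cvgM; exact: cvg_id].
have {}h : ((Num.sqrt s)%:E * \int[mu]_x (expR (- (s * x ^+ 2)))%:E = (Num.sqrt pi)%:E)%E.
  rewrite -ge0_integralZl//=.
  - rewrite -h; apply: eq_integral => x _; rewrite /gauss_fun addr0 exprMn.
    by rewrite sqr_sqrtr ?ltW// -EFinM mulrC.
  - exact/measurable_EFinP.
move: h; case: (integral _ _ _) => [r||].
- move=> [h]; congr (_%:E); apply: (mulfI (lt0r_neq0 r0)); rewrite h.
  by rewrite -sqrtrM ?ltW// mulrCA mulfV ?mulr1// gt_eqF.
- by rewrite gt0_muley ?lte_fin// => h; discriminate h.
- by rewrite gt0_muleNy ?lte_fin// => h; discriminate h.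
Qed.

Lemma integrable_gauss (s : R) : 0 < s ->
  mu.-integrable setT (EFin \o (fun x => expR (- (s * x ^+ 2)))).
Proof.
move=> s0; apply/integrableP; split.
  apply/measurable_EFinP; apply: continuous_measurable_setT => x.
  apply: (@continuous_comp _ _ _ (fun x : R => - (s * x ^+ 2)) expR);
    last exact: continuous_expR.
  by apply: cvgN; apply: cvgM; [exact: cvg_cst|apply: cvgM; exact: cvg_id].
under eq_integral do rewrite /= ger0_norm ?expR_ge0//.
by rewrite integral_gauss// ltry.
Qed.

Definition bessel_fun nu x u : R := expR (nu * u - x * ((expR u + expR (- u)) / 2)).

Lemma is_derive_bessel_fun_u nu x u : is_derive u 1 (bessel_fun nu x)
  (nu * bessel_fun nu x u - x / 2 * (bessel_fun (nu + 1) x u - bessel_fun (nu - 1) x u)).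
Proof.
have h := is_derive1D (is_derive1_expR (is_derive1_id u))
  (is_derive1_expR (is_derive1N (is_derive1_id u))).
have h1 := is_derive1B (is_derive1Zl nu (is_derive1_id u))
  (is_derive1Zl x (is_derive1M h (is_derive1_cst (2^-1) u))).
apply: (is_derive_eq (is_derive1_expR h1)); rewrite -/(bessel_fun nu x u).
have -> : bessel_fun (nu + 1) x u = bessel_fun nu x u * expR u.
  by rewrite /bessel_fun -expRD; congr expR; ring.
have -> : bessel_fun (nu - 1) x u = bessel_fun nu x u * expR (- u).
  by rewrite /bessel_fun -expRD; congr expR; ring.
by field.
Qed.

Lemma continuous_bessel_fun nu x : continuous (bessel_fun nu x).
Proof. exact: is_derive1_continuousT (is_derive_bessel_fun_u nu x). Qed.

Lemma bessel_fun_gt0 nu x u : 0 < bessel_fun nu x u. Proof. exact: expR_gt0. Qed.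

Lemma quad_bound (a q : R) : 0 < q -> 0 <= a -> forall v : R,
  expR (a * `|v| - q * v ^+ 2) <= expR ((a + 1) ^+ 2 / (4 * q)) * expR (- `|v|).
Proof.
move=> q0 a0 v; rewrite -expRD ler_expR -(real_normK (num_real v)).
have : 0 <= (q * `|v| - (a + 1) / 2) ^+ 2 / q by rewrite divr_ge0 ?sqr_ge0// ltW.
have -> : (q * `|v| - (a + 1) / 2) ^+ 2 / q =
  q * `|v| ^+ 2 - (a + 1) * `|v| + (a + 1) ^+ 2 / (4 * q) by field; rewrite gt_eqF.
lra.
Qed.

Lemma cosh_ge u : u ^+ 2 / 4 <= (expR u + expR (- u)) / 2.
Proof.
have k w : 0 <= w -> w ^+ 2 / 4 <= expR w / 2 :> R.
  move=> w0; have := @expR_ge1Dxn _ w 1 w0.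
  by rewrite (_ : 2`!%:R = 2) //; lra.
have := expR_gt0 u; have := expR_gt0 (- u).
have [u0|u0] := leP 0 u; first by have := k u u0; lra.
by have := k (- u); rewrite sqrrN => /(_ ltac:(lra)); lra.
Qed.

Lemma bessel_fun_le nu x u : 0 < x -> bessel_fun nu x u <=
  expR ((`|nu| + 1) ^+ 2 / x) * expR (- `|u|).
Proof.
move=> x0; have := @quad_bound `|nu| (x / 4) ltac:(lra) (normr_ge0 nu) u.
rewrite (_ : 4 * (x / 4) = x); last by field.
apply: le_trans; rewrite ler_expR.
have h1 : nu * u <= `|nu| * `|u| by rewrite -normrM ler_norm.
have h2 : x * (u ^+ 2 / 4) <= x * ((expR u + expR (- u)) / 2).
  by rewrite ler_wpM2l ?cosh_ge// ltW.
by lra.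
Qed.

Lemma integrable_bessel_fun nu x : 0 < x ->
  mu.-integrable setT (EFin \o (bessel_fun nu x)).
Proof.
move=> x0; apply: (@integrable_le _ _ _ mu _ (fun u => expR ((`|nu| + 1) ^+ 2 / x) * expR (- (1 * `|u - 0|)))) => //.
- by apply: continuous_measurable_setT; exact: continuous_bessel_fun.
- move=> u _; rewrite (gtr0_norm (bessel_fun_gt0 _ _ _)) subr0 mul1r.
  exact: bessel_fun_le.
- by apply: integrableZl_R => //; exact: integrable_expRN_norm.
Qed.

Definition bessel_int nu x : R := \int[mu]_u bessel_fun nu x u.

Lemma cvg_expRN_norm_y : expR (- `|u|) @[u --> +oo] --> (0 : R).
Proof.
apply: cvg_trans (@cvgr_expR R); apply: near_eq_cvg; near=> u.
by rewrite ger0_norm//; near: u; exact: nbhs_pinfty_ge.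
Unshelve. end_near. Qed.

Lemma cvg_expRN_norm_Ny : expR (- `|u|) @[u --> -oo] --> (0 : R).
Proof.
apply/cvgNy_compNP; under eq_fun do rewrite /= normrN.
exact: cvg_expRN_norm_y.
Qed.

Lemma bessel_int_rec nu x : 0 < x ->
  nu * bessel_int nu x = x / 2 * (bessel_int (nu + 1) x - bessel_int (nu - 1) x).
Proof.
move=> x0; have I n := @integrable_bessel_fun n x x0.
have I1 := integrableB_R measurableT (I (nu + 1)) (I (nu - 1)).
have : \int[mu]_u (nu * bessel_fun nu x u -
    x / 2 * (bessel_fun (nu + 1) x u - bessel_fun (nu - 1) x u)) = 0 - 0.
  apply: (@Rintegral_primitive _ _ (bessel_fun nu x)).
  - move=> u; apply: cvgB.
      by apply: cvgM; [exact: cvg_cst|exact: continuous_bessel_fun].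
    apply: cvgM; first exact: cvg_cst.
    by apply: cvgB; exact: continuous_bessel_fun.
  - by apply: integrableB_R => //; apply: integrableZl_R.
  - exact: is_derive_bessel_fun_u.
  - apply: (@cvg_dist_le _ _ _ _ (fun u => expR ((`|nu| + 1) ^+ 2 / x) * expR (- `|u|))).
      apply: nearW => u; rewrite sub0r normrN gtr0_norm ?bessel_fun_gt0//.
      exact: bessel_fun_le.
    rewrite -[X in _ --> X](mulr0 (expR ((`|nu| + 1) ^+ 2 / x))).
    by apply: cvgM; [exact: cvg_cst|exact: cvg_expRN_norm_Ny].
  - apply: (@cvg_dist_le _ _ _ _ (fun u => expR ((`|nu| + 1) ^+ 2 / x) * expR (- `|u|))).
      apply: nearW => u; rewrite sub0r normrN gtr0_norm ?bessel_fun_gt0//.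
      exact: bessel_fun_le.
    rewrite -[X in _ --> X](mulr0 (expR ((`|nu| + 1) ^+ 2 / x))).
    by apply: cvgM; [exact: cvg_cst|exact: cvg_expRN_norm_y].
rewrite RintegralB//; [|exact: integrableZl_R|exact: integrableZl_R].
rewrite RintegralZl// RintegralZl// RintegralB// -/(bessel_int _ _) => h.
by apply/eqP; rewrite -subr_eq0; apply/eqP; rewrite h subrr.
Qed.

Lemma is_derive_bessel_int nu x : 0 < x -> is_derive x 1 (bessel_int nu)
  (- (bessel_int (nu + 1) x + bessel_int (nu - 1) x) / 2).
Proof.
move=> x0.
have pos (y : R) : y \in `]x / 2, x + 1[ -> x / 2 <= y.
  by rewrite in_itv/= => /andP[/ltW].
have Ix : x \in `]x / 2, x + 1[ by rewrite in_itv/=; apply/andP; split; lra.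
have dI (y u : R) : is_derive y 1 (fun y => bessel_fun nu y u)
   (- (bessel_fun (nu + 1) y u + bessel_fun (nu - 1) y u) / 2).
  have h := is_derive1B (is_derive1_cst (nu * u) y)
    (is_derive1M (is_derive1_id y) (is_derive1_cst ((expR u + expR (- u)) / 2) y)).
  apply: (is_derive_eq (is_derive1_expR h)); rewrite -/(bessel_fun nu y u).
  have -> : bessel_fun (nu + 1) y u = bessel_fun nu y u * expR u.
    by rewrite /bessel_fun -expRD; congr expR; ring.
  have -> : bessel_fun (nu - 1) y u = bessel_fun nu y u * expR (- u).
    by rewrite /bessel_fun -expRD; congr expR; ring.
  by field.
have p1 (y u : R) : partial1of2 (bessel_fun nu) y u =
    - (bessel_fun (nu + 1) y u + bessel_fun (nu - 1) y u) / 2.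
  by rewrite partial1of2E; have [_ ->] := dI y u.
pose G u := 2^-1 * (bessel_fun (nu + 1) (x / 2) u + bessel_fun (nu - 1) (x / 2) u).
have x2 : 0 < x / 2 by lra.
have G0 u : 0 <= G u by rewrite mulr_ge0// addr_ge0// ltW// bessel_fun_gt0.
have mono (n y u : R) : y \in `]x / 2, x + 1[ -> bessel_fun n y u <= bessel_fun n (x / 2) u.
  move=> /pos xy; rewrite ler_expR; have := expR_gt0 u; have := expR_gt0 (- u) => a b.
  by rewrite lerB// ler_wpM2r// divr_ge0// addr_ge0// ltW.
have intG : mu.-integrable setT (EFin \o G).
  by apply: integrableZl_R => //; apply: integrableD_R => //; exact: integrable_bessel_fun.
have h1 (y : R) : y \in `]x / 2, x + 1[ -> mu.-integrable setT (EFin \o bessel_fun nu y).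
  by move=> /pos xy; apply: integrable_bessel_fun; lra.
have h2 (y u : R) : y \in `]x / 2, x + 1[ -> [set: R] u -> derivable (fun y => bessel_fun nu y u) y 1.
  by move=> _ _; case: (dI y u).
have h3 (y u : R) : y \in `]x / 2, x + 1[ -> [set: R] u -> `|partial1of2 (bessel_fun nu) y u| <= G u.
  move=> hy _; rewrite p1 mulNr normrN ger0_norm; last first.
    by rewrite divr_ge0// addr_ge0// ltW// bessel_fun_gt0.
  by have := mono (nu + 1) y u hy; have := mono (nu - 1) y u hy; rewrite /G; lra.
have dJ := @derivable_under_integral R _ _ mu (bessel_fun nu)
  setT measurableT x (x / 2) (x + 1) Ix h1 h2 G G0 intG h3.
have eJ := @differentiation_under_integral R _ _ mu (bessel_fun nu)
  setT measurableT x (x / 2) (x + 1) Ix h1 h2 G G0 intG h3.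
split => //; rewrite -derive1E; apply: (eq_trans eJ).
have I n := @integrable_bessel_fun n x x0.
transitivity (\int[mu]_u (- 2^-1 * (bessel_fun (nu + 1) x u + bessel_fun (nu - 1) x u))).
  by apply: eq_Rintegral => u _; rewrite p1; ring.
rewrite RintegralZl//; last exact: integrableD_R.
rewrite RintegralD//; rewrite -[X in X + _]/(bessel_int (nu + 1) x) -[X in _ + X]/(bessel_int (nu - 1) x).
by move: (bessel_int _ _) (bessel_int _ _) => a b; ring.
Qed.

Lemma Rintegral_gt0 (f : R -> R) : mu.-integrable setT (EFin \o f) ->
  (forall x, 0 < f x) -> 0 < \int[mu]_x f x.
Proof.
move=> fi f0; rewrite lt_neqAle Rintegral_ge0 ?andbT; last by move=> x _; exact: ltW.
apply/eqP => h.
have : (\int[mu]_x `|(EFin \o f) x| = 0)%E.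
  under eq_integral do rewrite /= gtr0_norm//.
  by rewrite -EFin_Rintegral// -h.
move/(@ae_eq_integral_abs _ _ _ mu setT measurableT _ (measurable_int _ fi)).
case=> N [mN N0 sub].
have : mu [set: R] = 0.
  apply/eqP; rewrite -measure_le0 -N0 le_measure ?inE//.
  move=> x _; apply: sub => /= /(_ I) [h0].
  by have := f0 x; rewrite h0 ltxx.
by rewrite -set_itvE lebesgue_measure_itv.
Qed.

Lemma bessel_int_gt0 nu x : 0 < x -> 0 < bessel_int nu x.
Proof.
move=> x0; apply: Rintegral_gt0; first exact: integrable_bessel_fun.
by move=> u; exact: bessel_fun_gt0.
Qed.

(** Twice the integral representation of the Bessel function; the sign of the
    parameter is the one met in the mixture of Gaussians below. *)
Definition bessel_K nu x : R := 2^-1 * bessel_int (- nu) x.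

Let is_derive_K nu x : 0 < x -> is_derive x 1 (bessel_K nu)
  (- (bessel_int (- nu + 1) x + bessel_int (- nu - 1) x) / 4).
Proof.
move=> x0; apply: (is_derive_eq (is_derive1Zl 2^-1 (is_derive_bessel_int (- nu) x0))).
by move: (bessel_int _ _) (bessel_int _ _) => a b; field.
Qed.

Let is_derive_K' nu x : 0 < x -> is_derive x 1 (derive1 (bessel_K nu))
  ((bessel_int (- nu + 2) x + 2 * bessel_int (- nu) x + bessel_int (- nu - 2) x) / 8).
Proof.
move=> x0; have h1 := is_derive_bessel_int (- nu + 1) x0.
have h2 := is_derive_bessel_int (- nu - 1) x0.
rewrite -addrA addrK (_ : 1 + 1 = 2) in h1; last by ring.
rewrite subrK -addrA (_ : - 1 - 1 = - 2) in h2; last by ring.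
have h := is_derive1Zl (- 4^-1) (is_derive1D h1 h2).
apply: near_eq_is_derive; last first.
  apply: (is_derive_eq h); clear.
  by move: (bessel_int _ _) (bessel_int _ _) (bessel_int _ _) => a b c; field.
near=> y; have y0 : 0 < y by near: y; exact: lt_nbhsr.
rewrite derive1E; have [_ ->] := is_derive_K nu y0; clear.
by move: (bessel_int _ _) (bessel_int _ _) => a b; field.
Unshelve. end_near. Qed.

Lemma bessel_K_ode nu x : 0 < x ->
  x ^+ 2 * derive1n 2 (bessel_K nu) x + x * derive1 (bessel_K nu) x
  - (x ^+ 2 + nu ^+ 2) * bessel_K nu x = 0.
Proof.
move=> x0; rewrite derive1nS derive1n1 !derive1E.
have [_ ->] := is_derive_K' nu x0; have [_ ->] := is_derive_K nu x0.
have r0 := bessel_int_rec (- nu) x0.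
have r1 := bessel_int_rec (- nu + 1) x0.
have r2 := bessel_int_rec (- nu - 1) x0.
rewrite -addrA addrK (_ : 1 + 1 = 2) in r1; last by ring.
rewrite subrK -addrA (_ : - 1 - 1 = - 2) in r2; last by ring.
rewrite /bessel_K; move: (bessel_int (- nu) x) (bessel_int (- nu + 1) x)
  (bessel_int (- nu - 1) x) (bessel_int (- nu + 2) x) (bessel_int (- nu - 2) x)
  r0 r1 r2 => i0 ip im ipp imm r0 r1 r2; clear -r0 r1 r2.
transitivity (x / 4 * ((x / 2 * (ipp - i0) - (- nu + 1) * ip) -
  (x / 2 * (i0 - imm) - (- nu - 1) * im)) - nu / 2 * (x / 2 * (ip - im) - - nu * i0)).
  by field.
by rewrite -r0 -r1 -r2 !subrr !mulr0 subrr.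
Qed.

Let cvg_sinh_ratio (h : nat -> R) : (forall n, h n != 0) -> h n @[n --> \oo] --> 0 ->
  (expR (h n) - expR (- h n)) / h n @[n --> \oo] --> (2 : R).
Proof.
move=> h0 hc.
have d : is_derive (0 : R) 1 (fun y => expR y - expR (- y)) (2 : R).
  apply: (is_derive_eq (is_derive1B (is_derive1_expR (is_derive1_id 0))
    (is_derive1_expR (is_derive1N (is_derive1_id 0))))).
  by rewrite oppr0 expR0; ring.
have [/cvg_ex[l dl] dv] := d.
have dl' := dl; move/cvg_lim : (dl) => /(_ (@Rhausdorff R)) e.
have {}e : l = 2 by rewrite -e -dv.
move: dl'; rewrite e => /cvgr_dnbhsP /(_ h (conj h0 hc)).
apply: cvg_trans; apply: near_eq_cvg; apply: nearW => n /=.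
by rewrite addr0 oppr0 subrr subr0 /GRing.scale/= mulr1 mulrC.
Qed.

Let scaled nu x v : R := let c := Num.sqrt x^-1 in
  expR (nu * (c * v) - x * ((expR (c * v) + expR (- (c * v))) / 2 - 1)).

Let scaled_le nu x v : 1 <= x -> scaled nu x v <= 
  expR ((`|nu| + 1) ^+ 2 / (4 * 8^-1)) * expR (- `|v|).
Proof.
move=> x1; have x0 : 0 < x by lra.
have c2 : x * Num.sqrt x^-1 ^+ 2 = 1.
  by rewrite sqr_sqrtr ?mulfV ?gt_eqF// invr_ge0 ltW.
have c0 := sqrtr_ge0 x^-1.
have c1 : Num.sqrt x^-1 <= 1.
  by rewrite -[leRHS]sqrtr1 ler_wsqrtr// invf_le1.
rewrite /scaled; move: (Num.sqrt _) c2 c0 c1 => c c2 c0 c1.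
apply: (le_trans _ (@quad_bound `|nu| 8^-1 _ (normr_ge0 nu) v)) => //.
rewrite ler_expR.
have h1 : nu * (c * v) <= `|nu| * `|v|.
  apply: (le_trans (ler_norm _)); rewrite !normrM (ger0_norm c0) ler_wpM2l//.
  by rewrite ler_piMl.
have h2 : (c * v) ^+ 2 / 8 <= (expR (c * v) + expR (- (c * v))) / 2 - 1.
  have g : `|c * v / 2| ^+ 2 <= `|expR (c * v / 2) - expR (- (c * v / 2))| ^+ 2.
    by rewrite ler_pXn2r ?nnegrE// expR_gap.
  move: g; rewrite !real_normK ?num_real//.
  have e1 : expR (c * v) = expR (c * v / 2) ^+ 2 by rewrite -expRM_natl; congr expR; field.
  have e2 : expR (- (c * v)) = expR (- (c * v / 2)) ^+ 2.
    by rewrite -expRM_natl; congr expR; field.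
  have e3 : expR (c * v / 2) * expR (- (c * v / 2)) = 1 by rewrite -expRD subrr expR0.
  rewrite e1 e2; move: (expR (c * v / 2)) (expR (- (c * v / 2))) e3 => a b ab.
  have -> : (a - b) ^+ 2 = a ^+ 2 + b ^+ 2 - 2 * (a * b) by ring.
  rewrite ab expr_div_n; lra.
have h3 : x * ((c * v) ^+ 2 / 8) <= x * ((expR (c * v) + expR (- (c * v))) / 2 - 1).
  by rewrite ler_wpM2l// ltW.
have h4 : x * ((c * v) ^+ 2 / 8) = v ^+ 2 / 8.
  by transitivity (x * c ^+ 2 * (v ^+ 2 / 8)); [field|rewrite c2 mul1r].
by lra.
Qed.

Let continuous_scaled nu x : continuous (scaled nu x).
Proof.
move=> v; pose c := Num.sqrt x^-1.
have d1 := is_derive1Zl c (is_derive1_id v).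
have h := is_derive1B (is_derive1Zl nu d1) (is_derive1Zl x (is_derive1B (is_derive1M
  (is_derive1D (is_derive1_expR d1) (is_derive1_expR (is_derive1N d1)))
  (is_derive1_cst 2^-1 v)) (is_derive1_cst 1 v))).
exact: is_derive1_continuous (is_derive1_expR h).
Qed.

Let integrable_dom (C : R) : mu.-integrable setT (EFin \o (fun v => C * expR (- `|v|))).
Proof.
apply: integrableZl_R => //.
have := @integrable_expRN_norm R 1 0 ltr01.
by under eq_fun do rewrite subr0 mul1r.
Qed.

Let integrable_scaled nu x : 1 <= x -> mu.-integrable setT (EFin \o scaled nu x).
Proof.
move=> x1; apply: (@integrable_le _ _ _ mu _ _ _ _ _ _ (integrable_dom _)) => //.
  by apply: continuous_measurable_setT; exact: continuous_scaled.
by move=> v _; rewrite ger0_norm ?expR_ge0//; exact: scaled_le.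
Qed.

Let bessel_scaled nu x : 1 <= x ->
  expR x * bessel_int nu x = Num.sqrt x^-1 * \int[mu]_v scaled nu x v.
Proof.
move=> x1; have x0 : 0 < x by lra.
have c0 : 0 < Num.sqrt x^-1 by rewrite sqrtr_gt0 invr_gt0.
have cf : continuous (fun u => expR x * bessel_fun nu x u).
  by move=> u; apply: cvgM; [exact: cvg_cst|exact: continuous_bessel_fun].
have f0 u : 0 <= expR x * bessel_fun nu x u by rewrite mulr_ge0 ?expR_ge0.
have := @integral_affine R _ (Num.sqrt x^-1) 0 c0 cf f0.
rewrite /bessel_int -(RintegralZl _ measurableT (integrable_bessel_fun nu x0)).
rewrite -(RintegralZl _ measurableT (integrable_scaled nu x1)).
rewrite /Rintegral => <-; congr fine; apply: eq_integral => v _; congr (_%:E).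
rewrite addr0 mulrC; congr (_ * _).
by rewrite /bessel_fun /scaled -expRD; congr expR; ring.
Qed.

Let cvg_scaled nu (u : nat -> R) : (forall n, 1 <= u n) -> u n @[n --> \oo] --> +oo ->
  \int[mu]_v scaled nu (u n) v @[n --> \oo] --> Num.sqrt (2 * pi).
Proof.
move=> u1 uy.
have u0 n : 0 < u n by apply: lt_le_trans (u1 n).
have uV : (u n)^-1 @[n --> \oo] --> 0 by apply/gtr0_cvgV0 => //; exact: nearW.
have c0 : Num.sqrt (u n)^-1 @[n --> \oo] --> 0.
  by rewrite -[X in _ --> X](@sqrtr0 R); apply: (cvg_comp _ _ uV (@sqrt_continuous R 0)).
have -> : Num.sqrt (2 * pi) = \int[mu]_v expR (- (2^-1 * v ^+ 2)).
  by rewrite /Rintegral integral_gauss// invrK mulrC.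
have mE : measurable_fun setT (fun v : R => expR (- (2^-1 * v ^+ 2))).
  have h2 : 0 < 2^-1 :> R by rewrite invr_gt0.
  exact: measurable_integrable (integrable_gauss h2).
apply: (@cvg_Rintegral _ _ _ mu (fun n v => scaled nu (u n) v) _ _ _ _ (integrable_dom _)) => //.
- by move=> n; apply: continuous_measurable_setT; exact: continuous_scaled.
- apply/aeW => v.
  have E n : scaled nu (u n) v = expR (nu * (Num.sqrt (u n)^-1 * v)) *
     expR (- (u n * ((expR (Num.sqrt (u n)^-1 * v) + expR (- (Num.sqrt (u n)^-1 * v))) / 2 - 1))).
    by rewrite -expRD.
  rewrite (_ : (fun n => _) = (fun n => expR (nu * (Num.sqrt (u n)^-1 * v)) *
     expR (- (u n * ((expR (Num.sqrt (u n)^-1 * v) + expR (- (Num.sqrt (u n)^-1 * v))) / 2 - 1)))));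
    last exact/funext.
  rewrite -[X in _ --> X]mul1r; apply: cvgM.
    have -> : 1 = expR (nu * (0 * v)) :> R by rewrite mul0r mulr0 expR0.
    have k : nu * (Num.sqrt (u n)^-1 * v) @[n --> \oo] --> nu * (0 * v).
      by apply: cvgM; [exact: cvg_cst|apply: cvgM; [exact: c0|exact: cvg_cst]].
    exact: (cvg_comp _ _ k (@continuous_expR R _)).
  pose q n := u n * ((expR (Num.sqrt (u n)^-1 * v) + expR (- (Num.sqrt (u n)^-1 * v))) / 2 - 1).
  suff k : - q n @[n --> \oo] --> - (2^-1 * v ^+ 2).
    exact: (cvg_comp _ _ k (@continuous_expR R _)).
  apply: cvgN; rewrite /q.
  have [v0|v0] := eqVneq v 0.
    rewrite v0 expr0n/= mulr0 (_ : (fun n => _) = cst 0); first exact: cvg_cst.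
    apply/funext => n; rewrite mulr0 oppr0 expR0.
    by rewrite (_ : (1 + 1) / 2 - 1 = 0 :> R) ?mulr0//; field.
  pose h n := Num.sqrt (u n)^-1 * v / 2.
  have h0 n : h n != 0.
    by rewrite !mulf_neq0// ?invr_eq0// gt_eqF// sqrtr_gt0 invr_gt0.
  have hc : h n @[n --> \oo] --> 0.
    have -> : (0 : R) = 0 * v / 2 by rewrite mul0r mul0r.
    by apply: cvgM; [apply: cvgM; [exact: c0|exact: cvg_cst]|exact: cvg_cst].
  have F n : u n * ((expR (Num.sqrt (u n)^-1 * v) + expR (- (Num.sqrt (u n)^-1 * v))) / 2 - 1) =
      v ^+ 2 / 8 * ((expR (h n) - expR (- h n)) / h n) ^+ 2.
    have -> : Num.sqrt (u n)^-1 * v = h n + h n by rewrite /h; field.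
    have -> : u n = v ^+ 2 / (4 * h n ^+ 2).
      have un0 : u n != 0 by rewrite gt_eqF.
      rewrite /h expr_div_n exprMn sqr_sqrtr ?invr_ge0 ?ltW//; field.
      by rewrite v0 un0.
    have e3 : expR (h n) * expR (- h n) = 1 by rewrite -expRD subrr expR0.
    rewrite opprD !expRD; move: (h0 n) e3.
    move: (expR (h n)) (expR (- h n)) => a b; move: (h n) => k k0 ab.
    have -> : (a * a + b * b) / 2 - 1 = (a - b) ^+ 2 / 2.
      by transitivity ((a * a + b * b) / 2 - a * b); [rewrite ab|field].
    by field.
  rewrite (_ : (fun n => _) = (fun n => v ^+ 2 / 8 * ((expR (h n) - expR (- h n)) / h n) ^+ 2));
    last exact/funext.
  have -> : 2^-1 * v ^+ 2 = v ^+ 2 / 8 * 2 ^+ 2 by field.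
  apply: cvgM; first exact: cvg_cst.
  by rewrite expr2; apply: cvgM; exact: cvg_sinh_ratio.
- by move=> n v; rewrite ger0_norm ?expR_ge0//; exact: scaled_le.
Qed.

Lemma bessel_K_asymptotic nu :
  bessel_K nu x / (Num.sqrt (pi / (2 * x)) * expR (- x)) @[x --> +oo] --> (1 : R).
Proof.
apply/cvg_pinftyP => u uy.
pose w n := Num.max 1 (u n).
have w1 n : 1 <= w n by rewrite /w le_max lexx.
have uw : \forall n \near \oo, u n = w n.
  have : \forall n \near \oo, 1 <= u n by move/cvgryPge : uy; apply.
  by apply: filterS => n h; rewrite /w max_r.
have wy : w n @[n --> \oo] --> +oo.
  by apply: cvg_trans uy; apply: near_eq_cvg; apply: filterS uw.
have E n : bessel_K nu (w n) / (Num.sqrt (pi / (2 * w n)) * expR (- w n)) =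
    (2 * Num.sqrt (pi / 2))^-1 * \int[mu]_v scaled (- nu) (w n) v.
  have w0 : 0 < w n by apply: lt_le_trans (w1 n).
  have p0 := @pi_gt0 R.
  have c0 : 0 < Num.sqrt (w n)^-1 by rewrite sqrtr_gt0 invr_gt0.
  have q0 : 0 < Num.sqrt (pi / 2 : R) by rewrite sqrtr_gt0 divr_gt0.
  have -> : Num.sqrt (pi / (2 * w n)) = Num.sqrt (pi / 2) * Num.sqrt (w n)^-1.
    by rewrite -sqrtrM ?divr_ge0 ?ltW// invfM mulrA.
  have := bessel_scaled (- nu) (w1 n); rewrite /bessel_K expRN.
  have := expR_gt0 (w n).
  move: (bessel_int _ _) (Rintegral _ _ _) (expR _) (Num.sqrt _^-1) (Num.sqrt (pi / 2)) c0 q0 => b I e c q c0 q0 e0 h.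
  have -> : b = c * I / e by rewrite -h mulrAC mulfV ?mul1r// gt_eqF.
  by field; rewrite !gt_eqF.
apply: (@cvg_trans _ (bessel_K nu (w n) / (Num.sqrt (pi / (2 * w n)) * expR (- w n)) @[n --> \oo])).
  by apply: near_eq_cvg; apply: filterS uw => n ->.
rewrite (_ : (fun n => _) = (fun n => (2 * Num.sqrt (pi / 2))^-1 *
  \int[mu]_v scaled (- nu) (w n) v)); last exact/funext.
have p0 := @pi_gt0 R.
have q0 : 0 < Num.sqrt (pi / 2 : R) by rewrite sqrtr_gt0 divr_gt0.
have e : (2 * Num.sqrt (pi / 2))^-1 * Num.sqrt (2 * pi) = 1 :> R.
  have -> : 2 * pi = 2 ^+ 2 * (pi / 2) :> R by field.
  rewrite (@sqrtrM _ (2 ^+ 2)) ?exprn_ge0// sqrtr_sqr ger0_norm// mulVf//.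
  by apply: mulf_neq0 => //; rewrite gt_eqF.
have k := cvg_scaled (- nu) w1 wy.
have {}k : (2 * Num.sqrt (pi / 2))^-1 * \int[mu]_v scaled (- nu) (w n) v @[n --> \oo] -->
    (2 * Num.sqrt (pi / 2))^-1 * Num.sqrt (2 * pi).
  by apply: cvgM; [exact: cvg_cst|exact: k].
by rewrite e in k.
Qed.

Lemma is_besselK_bessel_K nu : is_besselK nu (bessel_K nu).
Proof.
split.
- by move=> x x0; case: (is_derive_K nu x0).
- by move=> x x0; case: (is_derive_K' nu x0).
- exact: bessel_K_ode.
- exact: bessel_K_asymptotic.
Qed.

Lemma bessel_K_gt0 nu x : 0 < x -> 0 < bessel_K nu x.
Proof. by move=> x0; rewrite mulr_gt0// bessel_int_gt0. Qed.

End bessel_integral.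

Section bessel_uniqueness.
Context {R : realType}.
Notation mu := (@lebesgue_measure R).
Implicit Types (nu x : R) (K : R -> R).

(** The decaying solution of the modified Bessel equation is determined by its
    asymptotics: by Abel's formula [(K2 / K1)' = c / (x * K1 ^ 2)], which is
    unbounded at infinity unless [c = 0]. *)
Lemma is_besselK_unique nu K1 K2 : is_besselK nu K1 -> (forall x, 0 < x -> 0 < K1 x) ->
  is_besselK nu K2 -> forall x, 0 < x -> K2 x = K1 x.
Proof.
move=> [d1 d1' ode1 as1] K1pos [d2 d2' ode2 as2].
have D1 x (x0 : 0 < x) : is_derive x 1 K1 (derive1 K1 x).
  by apply: DeriveDef; [exact: d1|rewrite derive1E].
have D2 x (x0 : 0 < x) : is_derive x 1 K2 (derive1 K2 x).
  by apply: DeriveDef; [exact: d2|rewrite derive1E].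
have D1' x (x0 : 0 < x) : is_derive x 1 (derive1 K1) (derive1n 2 K1 x).
  by apply: DeriveDef; [exact: d1'|rewrite derive1nS derive1n1 derive1E].
have D2' x (x0 : 0 < x) : is_derive x 1 (derive1 K2) (derive1n 2 K2 x).
  by apply: DeriveDef; [exact: d2'|rewrite derive1nS derive1n1 derive1E].
pose W x := x * (K1 x * derive1 K2 x - derive1 K1 x * K2 x).
have dW x (x0 : 0 < x) : is_derive x 1 W 0.
  have h := is_derive1M (is_derive1_id x) (is_derive1B (is_derive1M (D1 x x0) (D2' x x0))
    (is_derive1M (D1' x x0) (D2 x x0))).
  apply: (is_derive_eq h); have := ode1 x x0; have := ode2 x x0.
  move: (derive1n 2 K1 x) (derive1n 2 K2 x) (derive1 K1 x) (derive1 K2 x) (K1 x) (K2 x) => a2 b2 a1 b1 a b h2 h1.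
  have xn : x != 0 by rewrite gt_eqF.
  transitivity (x^-1 * (a * (x ^+ 2 * b2 + x * b1 - (x ^+ 2 + nu ^+ 2) * b) -
     b * (x ^+ 2 * a2 + x * a1 - (x ^+ 2 + nu ^+ 2) * a))); first by field.
  by rewrite h1 h2 !mulr0 subrr mulr0.
have cst (f f' : R -> R) : (forall x, 0 < x -> is_derive x 1 f (f' x)) ->
    (forall x, 0 < x -> f' x = 0) -> forall x y, 0 < x -> x <= y -> f y = f x.
  move=> df f0 x y x0 xy.
  have := @le_dist_derive _ f f' x y 0 xy; rewrite mul0r normr_le0 subr_eq0 => h.
  apply/eqP/h => s /andP[xs _]; first by apply: df; exact: lt_le_trans xs.
  by rewrite f0 ?normr0//; exact: lt_le_trans xs.
pose c := W 1.
have Wc x : 0 < x -> W x = c.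
  move=> x0; have [x1|x1] := leP 1 x; first by apply: (cst W (fun=> 0)) => //.
  by apply/esym/(cst W (fun=> 0)) => //; exact: ltW.
pose q x := K2 x / K1 x.
have dq x (x0 : 0 < x) : is_derive x 1 q (c / (x * K1 x ^+ 2)).
  have k0 : K1 x != 0 by rewrite gt_eqF// K1pos.
  apply: (is_derive_eq (is_derive1M (D2 x x0) (is_derive1V k0 (D1 x x0)))).
  by rewrite -(Wc x x0) /W; field; rewrite k0 gt_eqF.
pose A x := Num.sqrt (pi / (2 * x)) * expR (- x) : R.
have A0 x : 0 < x -> 0 < A x.
  by move=> x0; rewrite mulr_gt0 ?expR_gt0// sqrtr_gt0 divr_gt0 ?pi_gt0// mulr_gt0.
have q1 : q x @[x --> +oo] --> (1 : R).
  have h : (K2 x / A x) * (K1 x / A x)^-1 @[x --> +oo] --> (1 : R) * 1^-1.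
    by apply: cvgM; [exact: as2|apply: cvgV; [exact: oner_neq0|exact: as1]].
  rewrite invr1 mulr1 in h; apply: cvg_trans h; apply: near_eq_cvg; near=> x.
  have x0 : 0 < x by near: x; exact: nbhs_pinfty_gt.
  rewrite /q; have := A0 x x0; have := K1pos x x0; move: (K1 x) (K2 x) (A x) => a b k a0 k0.
  by field; rewrite !gt_eqF.
have small : x * K1 x ^+ 2 @[x --> +oo] --> (0 : R).
  have h : pi / 2 * expR (- (2 * x)) * ((K1 x / A x) * (K1 x / A x)) @[x --> +oo] -->
      pi / 2 * 0 * ((1 : R) * 1).
    apply: cvgM; last by apply: cvgM; exact: as1.
    by apply: cvgM; [exact: cvg_cst|exact: cvg_expRN_scale].
  rewrite mulr0 mul0r in h; apply: cvg_trans h; apply: near_eq_cvg; near=> x.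
  have x0 : 0 < x by near: x; exact: nbhs_pinfty_gt.
  have p0 := @pi_gt0 R.
  have A2 : A x ^+ 2 = pi / 2 * expR (- (2 * x)) / x.
    rewrite /A exprMn sqr_sqrtr ?divr_ge0// ?ltW// ?mulr_gt0// -expRM_natl.
    rewrite (_ : 2%:R * - x = - (2 * x)); last by ring.
    by move: (expR _) => e; field; rewrite gt_eqF.
  have -> : pi / 2 * expR (- (2 * x)) = A x ^+ 2 * x by rewrite A2 mulfVK// gt_eqF.
  have := A0 x x0; move: (K1 x) (A x) => a k k0.
  by field; rewrite gt_eqF.
have c0 : c = 0.
  apply/eqP/negPn/negP => cn0.
  move/cvgrPdist_lt : q1 => /(_ 2^-1); rewrite invr_gt0 => /(_ (ltr0n _ 2)) [N1 [_ hN1]].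
  move/cvgrPdist_le : small => /(_ `|c|); rewrite normr_gt0 => /(_ cn0) [N2 [_ hN2]].
  pose X := `|N1| + `|N2| + 1 : R.
  have n1 := normr_ge0 N1; have n2 := normr_ge0 N2.
  have k1 := ler_norm N1; have k2 := ler_norm N2.
  have pos y : X <= y -> 0 < y by rewrite /X; lra.
  have hX y : X <= y -> `|q y - 1| < 2^-1 /\ y * K1 y ^+ 2 <= `|c|.
    move=> Xy; split; first by rewrite distrC; apply: hN1; move: Xy; rewrite /X; lra.
    have := hN2 y; rewrite /= sub0r normrN => h.
    by apply: (le_trans (ler_norm _)); apply: h; move: Xy; rewrite /X; lra.
  have XX : X <= X + 1 by lra.
  have [s /itvP hs|s|z /itvP zX] := @MVT_segment R q (fun x => c / (x * K1 x ^+ 2)) X (X + 1) XX.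
  - by apply: dq; apply: pos; rewrite hs.
  - apply: derivable_within_continuous => y; rewrite in_itv/= => /andP[Xy _].
    by case: (dq y (pos y Xy)).
  have Xz : X <= z by rewrite zX.
  have z0 := pos z Xz; have [_ hz] := hX z Xz.
  have zk : 0 < z * K1 z ^+ 2 by rewrite mulr_gt0// exprn_gt0// K1pos.
  have [h1 _] := hX X (lexx X); have [h2 _] := hX (X + 1) XX.
  rewrite (_ : X + 1 - X = 1) ?mulr1; last by ring.
  move=> e; have : 1 <= `|q (X + 1) - q X|.
    rewrite e normrM normfV (gtr0_norm zk) ler_pdivlMr//. by rewrite mul1r.
  have : `|q (X + 1) - q X| <= `|q (X + 1) - 1| + `|q X - 1|.
    by rewrite (distrC (q X)) (le_trans _ (ler_normD _ _))// addrA subrK.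
  lra.
move=> x x0.
have qx : q x = 1.
  apply: (cvg_unique (@Rhausdorff R) _ q1).
  apply: cvg_near_cst; near=> y.
  have xy : x <= y by near: y; apply: nbhs_pinfty_ge; exact: num_real.
  apply: (cst q (fun x => c / (x * K1 x ^+ 2))) => // s s0.
  by rewrite c0 mul0r.
by move: qx; rewrite /q => /divr1_eq.
Unshelve. all: end_near. Qed.

Lemma besselKE nu x : 0 < x -> besselK nu x = bessel_K nu x.
Proof.
move=> x0; have h : is_besselK nu (besselK nu).
  by apply: (@xgetPex _ (fun=> 0) (is_besselK nu)); exists (bessel_K nu);
    exact: is_besselK_bessel_K.
by apply: (is_besselK_unique (@is_besselK_bessel_K R nu) _ h) => // y; exact: bessel_K_gt0.
Qed.

(** The substitution [sigma = tau + ln (z / 2) - x] symmetrises the exponent. *)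
Lemma bessel_gauss_mixture nu x (z : R) : 0 < z ->
  let f (sg : R) := expR (- nu * sg - (expR (sg + 2 * x) + z ^+ 2 / 4 * expR (- sg))) in
  mu.-integrable setT (EFin \o f) /\
  \int[mu]_sg f sg =
    2 * expR (- nu * (ln (z / 2) - x)) * besselK nu (z * expR x).
Proof.
move=> z0 f; have ex := expR_gt0 x.
have w0 : 0 < z * expR x by rewrite mulr_gt0.
have h0 : 0 < z / 2 by rewrite divr_gt0.
rewrite besselKE//; set b := ln (z / 2) - x.
have fE t : f (1 * t + b) * 1 = expR (- nu * b) * bessel_fun (- nu) (z * expR x) t.
  rewrite mulr1 mul1r /f /bessel_fun -expRD; congr expR.
  have -> : expR (t + b + 2 * x) = expR t * (z / 2 * expR x).
    by rewrite -(lnK h0) -!expRD; congr expR; rewrite /b; ring.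
  have -> : expR (- (t + b)) = expR (- t) * ((z / 2)^-1 * expR x).
    by rewrite -(lnK h0) -expRN -!expRD; congr expR; rewrite /b; ring.
  by move: (expR t) (expR (- t)) (expR x) => p q r; field; rewrite gt_eqF.
have dfun (sg : R) : is_derive sg 1 (fun sg => - nu * sg - (expR (sg + 2 * x) + z ^+ 2 / 4 * expR (- sg)))
   (- nu * 1 - (expR (sg + 2 * x) * (1 + 0) + z ^+ 2 / 4 * (expR (- sg) * - 1))).
  exact: (is_derive1B (is_derive1Zl (- nu) (is_derive1_id sg)) (is_derive1D
   (is_derive1_expR (is_derive1D (is_derive1_id sg) (is_derive1_cst (2 * x) sg)))
   (is_derive1Zl (z ^+ 2 / 4) (is_derive1_expR (is_derive1N (is_derive1_id sg)))))).
have cf : continuous f.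
  by move=> sg; exact: is_derive1_continuous (is_derive1_expR (dfun sg)).
have f0 (sg : R) : 0 <= f sg by exact: expR_ge0.
have := integral_affine b ltr01 cf f0.
have iB := integrable_bessel_fun (- nu) w0.
have -> : (\int[mu]_x0 (f (1 * x0 + b) * 1)%:E =
    (expR (- nu * b) * bessel_int (- nu) (z * expR x))%:E)%E.
  rewrite /bessel_int -(RintegralZl _ measurableT iB) EFin_Rintegral//.
    by apply: eq_integral => t _; rewrite fE.
  exact: integrableZl_R.
move=> e; split.
  apply/integrableP; split; first by apply/measurable_EFinP; exact: continuous_measurable_setT.
  by under eq_integral do rewrite /= ger0_norm//; rewrite -e ltry.
by rewrite /Rintegral -e /= /bessel_K; move: (expR _) (bessel_int _ _) => p q; field.
Qed.

End bessel_uniqueness.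

(** * The Dagum function as a mixture of Gaussians *)

Section gaussian_mixture.
Context {R : realType}.
Notation mu := (@lebesgue_measure R).
Implicit Types (x y sg : R).

(** The Gumbel density. *)
Definition gumbel (a sg : R) : R := a * expR sg * expR (- (a * expR sg)).

Lemma is_derive_gumbel a sg : is_derive sg 1 (fun sg => - expR (- (a * expR sg))) (gumbel a sg).
Proof.
apply: (is_derive_eq (is_derive1N (is_derive1_expR (is_derive1N
  (is_derive1Zl a (is_derive1_expR (is_derive1_id sg))))))).
by rewrite /gumbel; ring.
Qed.

Lemma continuous_gumbel a : continuous (gumbel a).
Proof.
move=> sg; have h1 := is_derive1Zl a (is_derive1_expR (is_derive1_id sg)).
exact: is_derive1_continuous (is_derive1M h1 (is_derive1_expR (is_derive1N h1))).
Qed.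

Lemma gumbel_ge0 a sg : 0 < a -> 0 <= gumbel a sg.
Proof. by move=> a0; rewrite !mulr_ge0 ?expR_ge0// ltW. Qed.

Lemma integrable_gumbel a : 0 < a -> mu.-integrable setT (EFin \o gumbel a).
Proof.
move=> a0; apply: (@integrable_bounded_primitive _ _ _ 1).
- by move=> sg; exact: gumbel_ge0.
- exact: continuous_gumbel.
- exact: is_derive_gumbel.
- move=> sg; rewrite normrN ger0_norm ?expR_ge0// -[leRHS]expR0 ler_expR oppr_le0.
  by rewrite mulr_ge0 ?expR_ge0// ltW.
Qed.

Lemma Rintegral_gumbel a : 0 < a -> \int[mu]_sg gumbel a sg = 1.
Proof.
move=> a0; rewrite (@Rintegral_primitive _ _ _ (- 1) 0 (@continuous_gumbel a)
  (integrable_gumbel a0) (@is_derive_gumbel a)) ?sub0r ?opprK//.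
  have -> : - 1 = - expR (- (a * 0)) :> R by rewrite mulr0 oppr0 expR0.
  apply: cvgN.
  have k : - (a * expR sg) @[sg --> -oo] --> - (a * 0).
    apply: cvgN; apply: cvgM; first exact: cvg_cst.
    by apply/cvgNy_compNP; exact: cvgr_expR.
  exact: (cvg_comp _ _ k (@continuous_expR R _)).
rewrite -[X in _ --> X]oppr0; apply: cvgN.
apply: (@cvg_dist_le _ _ _ _ (fun sg => expR (- (a * sg)))); last exact: cvg_expRN_scale.
apply: nearW => sg; rewrite sub0r normrN ger0_norm ?expR_ge0// ler_expR lerN2.
by rewrite ler_pM2l//; have := @expR_ge1Dx _ sg; lra.
Qed.

Variables (M : R -> R) (C kap : R).
Hypotheses (mM : measurable_fun setT M) (kap0 : 0 < kap).
Hypothesis M_le : forall x, `|M x| <= C * expR (- (kap * `|x|)).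

Let integrable_M : mu.-integrable setT (EFin \o M).
Proof.
apply: (@integrable_le _ _ _ mu _ (fun x => C * expR (- (kap * `|x - 0|)))) => //.
- by move=> x _; rewrite subr0.
- by apply: integrableZl_R => //; exact: integrable_expRN_norm.
Qed.

(** The joint density, in logarithmic coordinates [t = expR x], [s = expR sg],
    of [t * M * expR (- s * t ^ 2)]. *)
Definition mix_joint (p : R * R) : R :=
  M p.1 * (expR (2 * p.1) * expR p.2 * expR (- (expR (2 * p.1) * expR p.2))).

Definition mix_density sg : R := \int[mu]_x mix_joint (x, sg).

Let measurable_joint : measurable_fun setT mix_joint.
Proof.
have m1 : measurable_fun setT (fun p : R * R => expR (2 * p.1)).
  apply: (measurableT_comp (continuous_measurable_setT (@continuous_expR R))).
  by apply: measurable_funM => //; exact: measurable_fst.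
have m2 : measurable_fun setT (fun p : R * R => expR p.2).
  apply: (measurableT_comp (continuous_measurable_setT (@continuous_expR R))).
  exact: measurable_snd.
apply: measurable_funM; first exact: (measurableT_comp mM measurable_fst).
apply: measurable_funM; first exact: measurable_funM.
apply: (measurableT_comp (continuous_measurable_setT (@continuous_expR R))).
by apply: measurableT_comp => //; exact: measurable_funM.
Qed.

Lemma integrable_mix_joint : (mu \x mu)%E.-integrable setT (EFin \o mix_joint).
Proof.
apply: (@integrable_prod12 _ _ (measurableTypeR R) (measurableTypeR R) R mu mu) => //.
- move=> x; have e0 := expR_gt0 (2 * x).
  exact: (integrableZl_R (M x) measurableT (integrable_gumbel e0)).
- rewrite (_ : (fun _ => _) = (fun x => `|M x|)); first exact: integrable_norm_R.
  apply/funext => x; have e0 := expR_gt0 (2 * x).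
  under eq_Rintegral do rewrite /mix_joint/= normrM [X in _ * X]ger0_norm ?(gumbel_ge0 _ e0)//.
  by rewrite (RintegralZl _ measurableT (integrable_gumbel e0)) Rintegral_gumbel// mulr1.
Qed.

Lemma integrable_mix_density : mu.-integrable setT (EFin \o mix_density).
Proof. exact: (integrable_Rfubini2 integrable_mix_joint). Qed.

(** Integrating the mixture against a bounded weight [w]. *)
Lemma mix_density_weight (w : R -> R) (B : R) : measurable_fun setT w ->
  (forall sg, `|w sg| <= B) ->
  mu.-integrable setT (EFin \o (fun x => M x * expR (2 * x) *
    \int[mu]_sg (expR sg * expR (- (expR (2 * x) * expR sg)) * w sg))) /\
  \int[mu]_sg (mix_density sg * w sg) =
  \int[mu]_x (M x * expR (2 * x) *
    \int[mu]_sg (expR sg * expR (- (expR (2 * x) * expR sg)) * w sg)).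
Proof.
move=> mw wB; pose J (p : R * R) := mix_joint p * w p.2.
have B0 : 0 <= B := le_trans (normr_ge0 _) (wB 0).
have mJ : measurable_fun setT J.
  by apply: measurable_funM => //; exact: (measurableT_comp mw measurable_snd).
have iJ : (mu \x mu)%E.-integrable setT (EFin \o J).
  apply: (@integrable_le _ _ _ (mu \x mu)%E J (fun p => B * `|mix_joint p|)) => //.
    by move=> p _; rewrite normrM mulrC ler_wpM2r.
  by apply: integrableZl_R => //; apply: integrable_norm_R => //; exact: integrable_mix_joint.
have iw (g : R -> R) : mu.-integrable setT (EFin \o g) ->
    mu.-integrable setT (EFin \o (fun sg => g sg * w sg)).
  move=> ig; apply: (@integrable_le _ _ _ mu _ (fun sg => B * `|g sg|)) => //.
  - by apply: measurable_funM => //; exact: measurable_integrable ig.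
  - by move=> s _; rewrite normrM mulrC ler_wpM2r.
  - by apply: integrableZl_R => //; exact: integrable_norm_R.
have EJ x : \int[mu]_sg J (x, sg) = M x * expR (2 * x) *
    \int[mu]_sg (expR sg * expR (- (expR (2 * x) * expR sg)) * w sg).
  have e0 := expR_gt0 (2 * x).
  have i1 : mu.-integrable setT (EFin \o
      (fun sg => expR sg * expR (- (expR (2 * x) * expR sg)) * w sg)).
    apply: iw; have := integrableZl_R (expR (2 * x))^-1 measurableT (integrable_gumbel e0).
    rewrite /gumbel; under eq_fun do rewrite !mulrA mulVf ?gt_eqF// mul1r.
    exact.
  rewrite -(RintegralZl _ measurableT i1); apply: eq_Rintegral => sg _.
  by rewrite /J /mix_joint/=; ring.
split.
  have := integrable_Rfubini1 iJ.
  by under eq_fun do rewrite EJ.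
transitivity (\int[mu]_sg \int[mu]_x J (x, sg)); last first.
  by rewrite -(Rfubini iJ); apply: eq_Rintegral => x _; rewrite EJ.
apply/esym.
(* sections of the joint density are integrable for every [sg] *)
apply: eq_Rintegral => sg _; rewrite /mix_density /J /=.
rewrite RintegralZr//.
apply: (@integrable_le _ _ _ mu _ (fun x => `|M x|)) => //.
- exact: (measurable_fun_pair1 sg measurable_joint).
- move=> x _; rewrite /mix_joint normrM ler_piMr//=.
  have e0 : 0 < expR (2 * x) * expR sg by rewrite mulr_gt0 ?expR_gt0.
  rewrite ger0_norm; last by rewrite mulr_ge0 ?expR_ge0// ltW.
  rewrite expRN -ler_pdivlMr ?invr_gt0 ?expR_gt0// invrK mul1r.
  by have := @expR_ge1Dx _ (expR (2 * x) * expR sg); lra.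
- exact: integrable_norm_R.
Qed.

(** Mixing the Gaussians [expR (- (s * U))] gives back the superposition of
    Cauchy-type kernels. *)
Lemma mix_density_laplace (U : R) : 0 < U ->
  \int[mu]_sg (mix_density sg * expR (- (expR sg * U))) =
  \int[mu]_x (M x * (expR (2 * x) / (expR (2 * x) + U))).
Proof.
move=> U0.
have mw : measurable_fun setT (fun sg => expR (- (expR sg * U))).
  apply: continuous_measurable_setT => sg.
  exact: is_derive1_continuous (is_derive1_expR (is_derive1N
    (is_derive1M (is_derive1_expR (is_derive1_id sg)) (is_derive1_cst U sg)))).
have wB sg : `|expR (- (expR sg * U))| <= 1.
  rewrite ger0_norm ?expR_ge0// -[leRHS]expR0 ler_expR oppr_le0.
  by rewrite mulr_ge0 ?expR_ge0// ltW.
rewrite (mix_density_weight mw wB).2; apply: eq_Rintegral => x _.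
rewrite -mulrA; congr (_ * (_ * _)).
have e0 : 0 < expR (2 * x) + U by rewrite addr_gt0// expR_gt0.
rewrite -[RHS]mulr1 -[X in _ = _ * X](Rintegral_gumbel e0) -(RintegralZl _ measurableT (integrable_gumbel e0)).
apply: eq_Rintegral => sg _; rewrite /gumbel -(mulrA (_ + U)) mulKf ?gt_eqF//.
by rewrite -mulrA -expRD; congr (_ * expR _); ring.
Qed.

End gaussian_mixture.

Section gaussian_weight.
Context {R : realType}.
Notation mu := (@lebesgue_measure R).
Variables (d : nat) (hd : (1 < d)%N).
Implicit Types (y sg : R).

(** [s ^ (- d / 2) * expR (- y / s)] at [s = expR sg]. *)
Definition gweight y sg : R := expR (- (d%:R / 2 * sg) - y * expR (- sg)).

Definition gweight_cst y : R := expR ((d%:R / 2 + 1) ^+ 2 / (4 * (y / 2))).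

Lemma gweight_le (y0 y sg : R) : 0 < y0 -> y0 <= y ->
  gweight y sg <= gweight_cst y0 * expR (- `|sg|).
Proof.
move=> y00 yy; have d2 : 1 <= d%:R / 2 :> R.
  by rewrite ler_pdivlMr// mul1r ler_nat.
have d0 : 0 <= d%:R / 2 :> R by lra.
have e0 := expR_gt0 (- sg); have [s0|s0] := leP 0 sg.
  rewrite (ger0_norm s0) -expRD ler_expR.
  have h1 : sg <= d%:R / 2 * sg by rewrite ler_peMl.
  have h2 : 0 <= y * expR (- sg) by rewrite mulr_ge0 ?expR_ge0//; lra.
  have h3 : 0 <= (d%:R / 2 + 1) ^+ 2 / (4 * (y0 / 2)).
    by rewrite divr_ge0 ?sqr_ge0//; lra.
  lra.
have q0 : 0 < y0 / 2 by lra.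
apply: (le_trans _ (@quad_bound _ (d%:R / 2) (y0 / 2) q0 d0 sg)).
rewrite ler_expR (ltr0_norm s0).
have k : sg ^+ 2 / 2 <= expR (- sg).
  have := @expR_ge1Dxn _ (- sg) 1 _; rewrite sqrrN (_ : 2`!%:R = 2)// => h.
  by have := h ltac:(lra); lra.
have h1 : y0 * (sg ^+ 2 / 2) <= y * expR (- sg).
  by apply: ler_pM => //; [lra|rewrite divr_ge0 ?sqr_ge0].
lra.
Qed.

Lemma gweight_bound (y0 y sg : R) : 0 < y0 -> y0 <= y -> gweight y sg <= gweight_cst y0.
Proof.
move=> a b; apply: le_trans (gweight_le sg a b) _.
by rewrite ler_piMr ?expR_ge0// -[leRHS]expR0 ler_expR oppr_le0.
Qed.

Lemma gweight_gt0 y sg : 0 < gweight y sg. Proof. exact: expR_gt0. Qed.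

Lemma continuous_gweight y : continuous (gweight y).
Proof.
move=> sg; exact: is_derive1_continuous (is_derive1_expR (is_derive1B
  (is_derive1N (is_derive1Zl (d%:R / 2) (is_derive1_id sg)))
  (is_derive1Zl y (is_derive1_expR (is_derive1N (is_derive1_id sg)))))).
Qed.

Lemma integrable_gweight y : 0 < y -> mu.-integrable setT (EFin \o gweight y).
Proof.
move=> y0; apply: (@integrable_le _ _ _ mu _ (fun sg => gweight_cst y * expR (- (1 * `|sg - 0|)))) => //.
- by apply: continuous_measurable_setT; exact: continuous_gweight.
- by move=> sg _; rewrite (gtr0_norm (gweight_gt0 _ _)) subr0 mul1r; exact: gweight_le.
- by apply: integrableZl_R => //; exact: integrable_expRN_norm.
Qed.

Let nu : R := d%:R / 2 - 1.

(** Integrating a Gaussian weight against a single Laplace exponential gives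
    the Bessel function: this is the Fourier transform of [(t ^ 2 + r ^ 2)^-1]. *)
Lemma bessel_weight x (z : R) : 0 < z ->
  \int[mu]_sg (expR sg * expR (- (expR (2 * x) * expR sg)) * gweight (z ^+ 2 / 4) sg) =
  2 * expR (- nu * (ln (z / 2) - x)) * besselK nu (z * expR x).
Proof.
move=> z0; have [_ <-] := bessel_gauss_mixture nu x z0.
apply: eq_Rintegral => sg _; rewrite /gweight -!expRD; congr expR.
by rewrite (addrC sg) !expRD /nu; ring.
Qed.

(** Integrability of the Bessel function against [t ^ (d / 2)]. *)
Lemma integrable_bessel_power (z : R) : 0 < z -> mu.-integrable setT
  (EFin \o (fun x => besselK nu (z * expR x) * expR (d%:R / 2 * x) * expR x)).
Proof.
move=> z0; have y0 : 0 < z ^+ 2 / 4 by rewrite divr_gt0// exprn_gt0.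
pose P (p : R * R) := expR (2 * p.1) * (expR p.2 *
  expR (- (expR (2 * p.1) * expR p.2)) * gweight (z ^+ 2 / 4) p.2).
have cE := continuous_measurable_setT (@continuous_expR R).
have mP : measurable_fun setT P.
  have m1 : measurable_fun setT (fun p : R * R => expR (2 * p.1)).
    by apply: (measurableT_comp cE); apply: measurable_funM => //; exact: measurable_fst.
  have m2 : measurable_fun setT (fun p : R * R => expR p.2).
    by apply: (measurableT_comp cE); exact: measurable_snd.
  apply: measurable_funM => //; apply: measurable_funM.
    apply: measurable_funM => //; apply: (measurableT_comp cE).
    by apply: measurableT_comp => //; exact: measurable_funM.
  apply: (measurableT_comp (continuous_measurable_setT (@continuous_gweight _))).
  exact: measurable_snd.
have gE (b x : R) : gumbel b (2 * x + 0) * 2 = 2 * (b * expR (2 * x) * expR (- (expR (2 * x) * b))).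
  by rewrite /gumbel addr0 (mulrC (expR (2 * x)) b); ring.
have il (b : R) : 0 < b -> mu.-integrable setT
    (EFin \o (fun x => b * expR (2 * x) * expR (- (expR (2 * x) * b)))) /\
    \int[mu]_x (b * expR (2 * x) * expR (- (expR (2 * x) * b))) = 2^-1.
  move=> b0; have := integral_affine 0 (ltr0n R 2) (@continuous_gumbel R b)
    (fun x => gumbel_ge0 x b0).
  rewrite -(EFin_Rintegral measurableT (integrable_gumbel b0)) Rintegral_gumbel// => e.
  have cg : continuous (fun x : R => gumbel b (2 * x + 0)).
    move=> x; apply: (@continuous_comp _ _ _ (fun x : R => 2 * x + 0) (gumbel b)).
      exact: is_derive1_continuous (is_derive1_affine 2 0 x).
    exact: continuous_gumbel.
  have i2 : mu.-integrable setT (EFin \o (fun x => gumbel b (2 * x + 0) * 2)).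
    apply/integrableP; split.
      apply/measurable_EFinP; apply: measurable_funM => //.
      exact: continuous_measurable_setT.
    have g0 (x : R) : 0 <= gumbel b (2 * x + 0) * 2.
      by apply: mulr_ge0 => //; exact: gumbel_ge0.
    by under eq_integral do rewrite /= ger0_norm//; rewrite e ltry.
  have i1 : mu.-integrable setT (EFin \o (fun x => b * expR (2 * x) * expR (- (expR (2 * x) * b)))).
    have := integrableZl_R 2^-1 measurableT i2.
    by under eq_fun do rewrite gE mulKf//.
  split => //; apply: (@mulfI _ 2) => //; rewrite -(RintegralZl _ measurableT i1) mulfV//.
  by under eq_Rintegral do rewrite -gE; rewrite /Rintegral e.
have PE x sg : P (x, sg) = gweight (z ^+ 2 / 4) sg *
    (expR sg * expR (2 * x) * expR (- (expR (2 * x) * expR sg))).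
  by rewrite /P/=; ring.
have iP : (mu \x mu)%E.-integrable setT (EFin \o P).
  apply: (@integrable_prod21 _ _ (measurableTypeR R) (measurableTypeR R) R mu mu) => //.
  - move=> sg; under eq_fun do rewrite PE.
    exact: (integrableZl_R (gweight (z ^+ 2 / 4) sg) measurableT (il _ (expR_gt0 sg)).1).
  - rewrite (_ : (fun _ => _) = (fun sg => 2^-1 * gweight (z ^+ 2 / 4) sg)).
      by apply: integrableZl_R => //; exact: integrable_gweight.
    apply/funext => sg; rewrite -(il _ (expR_gt0 sg)).2 mulrC.
    rewrite -(RintegralZl _ measurableT (il _ (expR_gt0 sg)).1).
    apply: eq_Rintegral => x _; rewrite PE ger0_norm//.
    by rewrite mulr_ge0 ?mulr_ge0 ?expR_ge0.
have := integrable_Rfubini1 iP.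
have E x : \int[mu]_sg P (x, sg) = 2 * expR (- nu * ln (z / 2)) *
    (besselK nu (z * expR x) * expR (d%:R / 2 * x) * expR x).
  have iw : mu.-integrable setT (EFin \o (fun sg => expR sg *
      expR (- (expR (2 * x) * expR sg)) * gweight (z ^+ 2 / 4) sg)).
    have [ii _] := bessel_gauss_mixture nu x z0.
    apply: eq_integrable ii => // sg _; rewrite /gweight /= -!expRD; congr (expR _)%:E.
    by rewrite (addrC sg) !expRD /nu; ring.
  rewrite /P/= (RintegralZl _ measurableT iw) (bessel_weight x z0).
  have -> : expR (2 * x) * (2 * expR (- nu * (ln (z / 2) - x)) * besselK nu (z * expR x)) =
    2 * (expR (2 * x) * expR (- nu * (ln (z / 2) - x))) * besselK nu (z * expR x) by ring.
  have -> : 2 * expR (- nu * ln (z / 2)) * (besselK nu (z * expR x) * expR (d%:R / 2 * x) * expR x) =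
    2 * (expR (- nu * ln (z / 2)) * (expR (d%:R / 2 * x) * expR x)) * besselK nu (z * expR x) by ring.
  by congr (_ * _ * _); rewrite -!expRD /nu; congr expR; ring.
under eq_fun do rewrite E.
have c0 : 2 * expR (- nu * ln (z / 2)) != 0 by rewrite gt_eqF// mulr_gt0// expR_gt0.
move=> /(integrableZl_R (2 * expR (- nu * ln (z / 2)))^-1 measurableT).
by under eq_fun do rewrite mulKf//.
Qed.

End gaussian_weight.

(** * The integrand in logarithmic coordinates *)

Section integrand.
Context {R : realType}.
Notation mu := (@lebesgue_measure R).


Lemma continuous_pos_expR (f : R -> R) : continuous (fun x => f (expR x)) ->
  {in `]0, +oo[, continuous f}.
Proof.
move=> cf t; rewrite in_itv/= andbT => t0.
have k : {for t, continuous (fun s => f (expR (ln s)))}.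
  exact: (cvg_comp _ _ (continuous_ln t0) (cf (ln t))).
rewrite /continuous_at -{2}(lnK t0); apply: cvg_trans k; apply: near_eq_cvg.
near=> s; rewrite lnK// posrE; near: s; exact: lt_nbhsr.
Unshelve. all: by end_near. Qed.

Lemma continuous_bessel_K nu (z : R) : 0 < z -> continuous (fun x => bessel_K nu (z * expR x)).
Proof.
move=> z0 x; have zx : 0 < z * expR x by rewrite mulr_gt0 ?expR_gt0.
have h1 := is_derive1Zl z (is_derive1_expR (is_derive1_id x)).
exact: is_derive1_continuous (is_derive1Zl 2^-1 (is_derive1_comp h1
  (is_derive_bessel_int (- nu) zx))).
Qed.

Lemma carg_atan (w : R[i]) : 0 <= Im w -> 0 < Re w + cmod w ->
  carg w = 2 * atan (Im w / (Re w + cmod w)).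
Proof.
move=> i0 s0; have rr := ler_Re_cmod w; have r0 : 0 < cmod w.
  by move: rr; rewrite ler_norml => /andP[_ ?]; lra.
rewrite /carg ltNge i0/=; set v := _ / (Re w + _).
have v0 : 0 <= v by apply: divr_ge0 => //; exact: ltW.
have a0 : 0 <= atan v by rewrite -(@atan0 R); exact: le_atan.
have a1 := atan_ltpi2 v; have c0 : 0 < cos (atan v).
  by apply: cos_gt0_pihalf; apply/andP; split => //; exact: atan_gtNpi2.
have -> : Re w / cmod w = cos (2 * atan v).
  have -> : cos (2 * atan v) = 2 * cos (atan v) ^+ 2 - 1.
    by rewrite !mulr_natl cos_mulr2n.
  have := cos2_tan2 (lt0r_neq0 c0); rewrite atanK => h.
  have sv : 1 + v ^+ 2 = 2 * cmod w / (Re w + cmod w).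
    rewrite /v expr_div_n; have e := sqr_cmod w.
    have s1 : Re w + cmod w != 0 by rewrite gt_eqF.
    have -> : Im w ^+ 2 = cmod w ^+ 2 - Re w ^+ 2 by rewrite e; ring.
    by move: (Re w) (cmod w) s1 => a b s1; field.
  have -> : cos (atan v) ^+ 2 = (1 + v ^+ 2)^-1 by rewrite -h invrK.
  rewrite sv; move: s0 r0; move: (Re w) (cmod w) => a b s0 r0.
  by field; rewrite !gt_eqF.
by rewrite cosK// in_itv/=; apply/andP; split; lra.
Qed.

Variables (d : nat) (hd : (1 < d)%N) (delta lambda : R).
Hypotheses (hdelta : 0 < delta < 2) (hlambda : 0 < lambda).

Let gx x : R[i] := gext delta lambda (x +i* (pi / 2)).

Let pi2P : 0 <= (pi / 2 : R) <= pi / 2.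
Proof. by rewrite lexx andbT divr_ge0// pi_ge0. Qed.

Lemma Im_onewpow_ge0 x : 0 <= Im (1 + wpow delta (x +i* (pi / 2))).
Proof.
rewrite Im_1Dwpow; have /andP[d0 d2] := hdelta.
have p0 := @pi_gt0 R; have h1 : 0 < delta * (pi / 2) by rewrite mulr_gt0// divr_gt0.
have h2 : delta * (pi / 2) < 2 * (pi / 2) by rewrite ltr_pM2r// divr_gt0.
have s0 : 0 <= sin (delta * (pi / 2) / 2) by apply: sin_ge0_pi; apply/andP; split; lra.
have c0 : 0 <= cos (delta * (pi / 2) / 2) by apply: cos_ge0_pihalf; apply/andP; split; lra.
apply: mulr_ge0; first exact: expR_ge0.
by apply: mulr_ge0 => //; apply: mulr_ge0.
Qed.

Lemma gext_dagum_factor x : 1 - (expR x `^ (delta * lambda))%:C *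
    cexp (0 +i* (pi * (delta * lambda) / 2)) /
    cpow (1 + cexp (0 +i* (pi * delta / 2)) * (expR x `^ delta)%:C) lambda%:C = gx x.
Proof.
have wE : cexp (0 +i* (pi * delta / 2)) * (expR x `^ delta)%:C =
    wpow delta (x +i* (pi / 2)).
  rewrite -expRM -cexpR -cexpD /wpow; congr cexp.
  by apply: complex_eqP; rewrite !ReImE/=; ring.
rewrite wE /cpow (negPf (onewpow_neq0 hdelta x pi2P)) /gx /gext /gpow.
congr (1 - _); rewrite mulrBr cexpD cexpN; congr (_ * _^-1).
  rewrite -expRM -cexpR -cexpD; congr cexp.
  by apply: complex_eqP; rewrite !ReImE/=; ring.
rewrite /clog /clog2 carg_atan//; first exact: Im_onewpow_ge0.
exact: onewpow_slit.
Qed.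

Lemma dagum_integrand_expR z x : dagum_integrand d delta lambda z (expR x) =
  (besselK (d%:R / 2 - 1) (z * expR x))%:C * gx x * (expR (d%:R / 2 * x))%:C.
Proof. by rewrite /dagum_integrand gext_dagum_factor -expRM (mulrC x). Qed.


Let gx_le x : cmod (gx x) <= 1 + Cgpow delta lambda.
Proof. exact: cmod_gext_le. Qed.

Lemma continuous_gext : continuous (fun x => Re (gx x)) /\ continuous (fun x => Im (gx x)).
Proof.
by split=> x; have [h1 h2] := holo_gext lambda hdelta x pi2P _ _ _ (erefl _)
  (is_cderive_x x (pi / 2)); [exact: is_derive1_continuous h1|exact: is_derive1_continuous h2].
Qed.

Let part (p : R[i] -> R) (z : R) : continuous (fun x => p (gx x)) ->
  (forall w, `|p w| <= cmod w) -> (forall (a : R) w, p (a%:C * w) = a * p w) -> 0 < z ->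
  mu.-integrable `]0, +oo[ (EFin \o (fun t => p (dagum_integrand d delta lambda z t))) /\
  \int[mu]_(t in `]0, +oo[) p (dagum_integrand d delta lambda z t) =
  \int[mu]_x (besselK (d%:R / 2 - 1) (z * expR x) * p (gx x) * expR (d%:R / 2 * x) * expR x) /\
  mu.-integrable setT (EFin \o (fun x => besselK (d%:R / 2 - 1) (z * expR x) *
    p (gx x) * expR (d%:R / 2 * x) * expR x)).
Proof.
move=> cp pl pZ z0; pose f t := p (dagum_integrand d delta lambda z t).
have fE x : f (expR x) = besselK (d%:R / 2 - 1) (z * expR x) * p (gx x) * expR (d%:R / 2 * x).
  by rewrite /f dagum_integrand_expR mulrC !pZ mulrC.
have cf : continuous (fun x => f (expR x)).
  rewrite (_ : (fun x => f (expR x)) = fun x => bessel_K (d%:R / 2 - 1) (z * expR x) *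
      p (gx x) * expR (d%:R / 2 * x)); last first.
    by apply/funext => x; rewrite fE besselKE// mulr_gt0// expR_gt0.
  move=> x; have h := is_derive1_continuous (is_derive1_expR
    (is_derive1Zl (d%:R / 2) (is_derive1_id x))).
  exact: (cvgM (cvgM (@continuous_bessel_K (d%:R / 2 - 1) z z0 x) (cp x)) h).
have cpos := continuous_pos_expR cf.
have fi : mu.-integrable setT (EFin \o (fun x => f (expR x) * expR x)).
  apply: (@integrable_le _ _ _ mu _ (fun x => (1 + Cgpow delta lambda) *
      (besselK (d%:R / 2 - 1) (z * expR x) * expR (d%:R / 2 * x) * expR x))) => //.
  - apply: measurable_funM; apply: continuous_measurable_setT => //.
    exact: continuous_expR.
  - move=> x _; rewrite fE (_ : _ * expR x = p (gx x) * (besselK (d%:R / 2 - 1) (z * expR x) *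
        expR (d%:R / 2 * x) * expR x)); last by ring.
    have zx : 0 < z * expR x by rewrite mulr_gt0 ?expR_gt0.
    have b0 : 0 <= besselK (d%:R / 2 - 1) (z * expR x) * expR (d%:R / 2 * x) * expR x.
      rewrite besselKE//; apply: mulr_ge0; last exact: expR_ge0.
      by apply: mulr_ge0; [apply: ltW; exact: bessel_K_gt0|exact: expR_ge0].
    rewrite normrM [X in _ * X]ger0_norm//; apply: ler_wpM2r => //.
    exact: le_trans (pl _) (gx_le x).
  - by apply: integrableZl_R => //; exact: integrable_bessel_power.
split; first exact: (integrable_expR_subst cpos fi).
split.
  rewrite (Rintegral_expR_subst cpos fi).
  by apply: eq_Rintegral => x _; rewrite fE.
by apply: eq_integrable fi => // x _; rewrite /= fE.
Qed.

Lemma cintegrable_dagum_integrand z : 0 < z ->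
  cintegrable mu `]0, +oo[ (dagum_integrand d delta lambda z).
Proof.
move=> z0; have [c1 c2] := continuous_gext; split.
  have pR (a : R) w : Re (a%:C * w) = a * Re w by rewrite ReM/= mul0r subr0.
  exact: (part (p := @complex.Re R) c1 (@ler_Re_cmod R) pR z0).1.
have pI (a : R) w : Im (a%:C * w) = a * Im w by rewrite ImM/= mul0r addr0.
exact: (part (p := @complex.Im R) c2 (@ler_Im_cmod R) pI z0).1.
Qed.

(** The mixing density of the Dagum function, over logarithmic scales. *)
Definition dagum_mix : R -> R := mix_density (fun x => - (2 / pi) * Im (gx x)).

(** The spectral density at distance [z] from the origin, as the corresponding
    mixture of the Fourier transforms of the Gaussians. *)
Definition dagum_density (z : R) : R := (4 * pi) `^ (- (d%:R / 2)) *
  \int[mu]_sg (dagum_mix sg * gweight d (z ^+ 2 / 4) sg).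

Let M x : R := - (2 / pi) * Im (gx x).

Let mM : measurable_fun setT M.
Proof.
apply: measurable_funM => //; apply: continuous_measurable_setT.
by have [] := continuous_gext.
Qed.

Let M_le x : `|M x| <= Cgext' delta lambda * expR (- (kappa delta lambda * `|x|)).
Proof.
rewrite normrM normrN [X in X * _]ger0_norm ?divr_ge0 ?pi_ge0//.
have [h _] := gext_dist_t hdelta hlambda x pi2P.
rewrite -ler_pdivlMl ?divr_gt0 ?pi_gt0//; apply: (le_trans h).
by rewrite invf_div mulrC.
Qed.

Lemma integrable_dagum_mix : mu.-integrable setT (EFin \o dagum_mix).
Proof. exact: (integrable_mix_density mM (kappa_gt0 hdelta hlambda) M_le). Qed.

Lemma dagum_mixture u : 0 < u ->
  dagum lambda delta u = \int[mu]_sg (dagum_mix sg * expR (- (expR sg * u ^+ 2))).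
Proof.
move=> u0; have U0 : 0 < u ^+ 2 by rewrite exprn_gt0.
rewrite (mix_density_laplace mM (kappa_gt0 hdelta hlambda) M_le U0).
rewrite -{1}(lnK u0) (dagum_poisson hdelta hlambda) lnK//.
apply: eq_Rintegral => x _; rewrite (_ : expR (2 * x) = expR x ^+ 2)//.
by rewrite expr2 -expRD; congr expR; ring.
Qed.

Lemma dagum_densityE z : 0 < z -> dagum_density z =
  - (z `^ (1 - d%:R / 2) / (2 `^ (d%:R / 2 - 1) * pi `^ (d%:R / 2 + 1))) *
  Im (cintegral mu `]0, +oo[ (dagum_integrand d delta lambda z)).
Proof.
move=> z0; have y0 : 0 < z ^+ 2 / 4 by rewrite divr_gt0// exprn_gt0.
have mw := continuous_measurable_setT (@continuous_gweight R d (z ^+ 2 / 4)).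
have wB sg : `|gweight d (z ^+ 2 / 4) sg| <= gweight_cst d (z ^+ 2 / 4).
  by rewrite (gtr0_norm (gweight_gt0 _ _ _)); exact: gweight_bound.
have [c1 c2] := continuous_gext.
have pI (a : R) w : Im (a%:C * w) = a * Im w by rewrite ImM/= mul0r addr0.
rewrite /dagum_density (mix_density_weight mM (kappa_gt0 hdelta hlambda) M_le mw wB).2.
have [_ [eI iI]] := part (p := @complex.Im R) c2 (@ler_Im_cmod R) pI z0.
have -> : Im (cintegral mu `]0, +oo[ (dagum_integrand d delta lambda z)) =
  \int[mu]_x (besselK (d%:R / 2 - 1) (z * expR x) * Im (gx x) * expR (d%:R / 2 * x) * expR x).
  exact: eI.
set c := - (2 / pi) * 2 * expR (- (d%:R / 2 - 1) * ln (z / 2)).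
have E x : M x * expR (2 * x) * \int[mu]_sg (expR sg *
    expR (- (expR (2 * x) * expR sg)) * gweight d (z ^+ 2 / 4) sg) =
  c * (besselK (d%:R / 2 - 1) (z * expR x) * Im (gx x) * expR (d%:R / 2 * x) * expR x).
  rewrite bessel_weight// /M /c; set nu := d%:R / 2 - 1.
  have e : expR (2 * x) * expR (- nu * (ln (z / 2) - x)) =
      expR (- nu * ln (z / 2)) * expR (d%:R / 2 * x) * expR x.
    by rewrite -!expRD /nu; congr expR; ring.
  move: e; move: (expR (2 * x)) (expR (- nu * (_ - x))) => a b e.
  rewrite (_ : _ * (2 * b * _) = - (2 / pi) * 2 * (a * b) * (besselK nu (z * expR x) * Im (gx x))).
    by rewrite e; ring.
  by ring.
under eq_Rintegral do rewrite E.
rewrite (RintegralZl _ measurableT iI) mulrA; congr (_ * _).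
have p0 := @pi_gt0 R; have z2 : 0 < z / 2 by rewrite divr_gt0.
rewrite /c !mulNr mulrN; congr (- _).
have -> : (2 / pi) * 2 = expR (2 * ln 2 - ln pi) :> R.
  by rewrite expRB lnK ?posrE// (_ : 2 * ln 2 = ln 2 + ln 2) ?expRD ?lnK ?posrE//; ring.
have l4 : ln (4 * pi) = 2 * ln 2 + ln pi :> R.
  rewrite lnM ?posrE// (_ : 4 = 2 * 2 :> R); last by ring.
  by rewrite lnM ?posrE//; ring.
have lz : ln (z / 2) = ln z - ln 2 by rewrite ln_div ?posrE.
have p4 : 0 < 4 * pi :> R by rewrite mulr_gt0.
rewrite /powR !gt_eqF//= -expRD -expRB -!expRD l4 lz; congr expR.
by ring.
Qed.

End integrand.

(** * Functions on [R^n] and their integrals *)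

Section rV_measurability.
Context {R : realType}.

Let rV_box (n : nat) (q : 'rV[rat]_n) (k : nat) : set 'rV[R]_n :=
  [set x | forall i, `|ratr (q ord0 i) - x ord0 i| < k.+1%:R^-1].

Let measurable_box n q k : measurable (@rV_box n q k).
Proof.
have -> : @rV_box n q k = \bigcap_(i in [set: 'I_n])
    [set x | `|ratr (q ord0 i) - x ord0 i| < k.+1%:R^-1].
  by apply/seteqP; split => x /= h i; [move=> _; exact: h|exact: h].
apply: fin_bigcap_measurable; first exact: finite_finset.
move=> i _; rewrite -[X in measurable X]setTI.
have m1 : measurable_fun setT (fun x : 'rV[R]_n => `|ratr (q ord0 i) - x ord0 i|).
  apply: measurableT_comp => //; apply: measurable_funB => //.
  exact: measurable_coord.
have := m1 measurableT [set y | y < k.+1%:R^-1].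
by apply; rewrite -set_itvNyo; exact: measurable_itv.
Qed.

Lemma continuous_measurable_rV n (f : 'rV[R]_n -> R) :
  continuous f -> measurable_fun setT f.
Proof.
move=> /continuousP cf; apply: (measurability _ (RGenOpens.measurableE R)).
move=> _ [_ [a [b ->] <-]]; rewrite setTI.
have oU : open (f @^-1` `]a, b[) by apply: cf; exact: interval_open.
move: (f @^-1` _) oU => U oU.
have -> : U = \bigcup_(p : 'rV[rat]_n * nat) (if `[< rV_box p.1 p.2 `<=` U >]
    then rV_box p.1 p.2 else set0).
  apply/seteqP; split => x; last first.
    by move=> [p _]; case: ifPn => // /asboolP; exact.
  move=> Ux; have /nbhs_ballP[e /= e0 he] : nbhs x U by exact: open_nbhs_nbhs.
  have [k _ hk] : \forall k \near \oo, k.+1%:R^-1 < e / 2.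
    near=> k; rewrite -[ltRHS]invrK ltf_pV2 ?posrE ?invr_gt0 ?divr_gt0//.
    rewrite (@lt_le_trans _ _ k%:R)// ?ler_nat//.
    near: k; exact: nbhs_infty_gtr.
  have {}hk := hk _ (leqnn k).
  have [q hq] : exists q : 'rV[rat]_n, rV_box q k x.
    have Q i : {r : rat | `|ratr r - x ord0 i| < k.+1%:R^-1}.
      apply: cid.
      have [r] := @rat_in_itvoo R (x ord0 i - k.+1%:R^-1) (x ord0 i + k.+1%:R^-1)
        (ltac:(by rewrite ltrBlDr -addrA ltrDl addr_gt0)).
      rewrite in_itv/= => /andP[r1 r2]; exists r.
      by rewrite ltr_norml ltrBrDr ltrBlDl (addrC (- _)) r1.
    by exists (\row_i sval (Q i)) => i; rewrite mxE; exact: (svalP (Q i)).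
  exists (q, k) => //; rewrite ifT//; apply/asboolP => y hy /=; apply: he.
  split => // i j; rewrite ord1 -ball_normE /ball_/=.
  rewrite (le_lt_trans (ler_distD (ratr (q ord0 j)) _ _))// (splitr e) ltrD//.
    by rewrite distrC (lt_trans (hq j)).
  exact: lt_trans (hy j) hk.
apply: countable_bigcupT_measurable; first exact: countableP.
by move=> p; case: ifPn => // _; exact: measurable_box.
Unshelve. all: by end_near. Qed.

End rV_measurability.

Section rV_integration.
Context {R : realType}.
Notation mu := (@lebesgue_measure R).
Notation m n := (@lebesgue_rV R n).

Lemma rV_uncons_surj n (x : 'rV[R]_n.+1) : exists t v, x = rV_cons (t, v).
Proof.
exists (rV_uncons x).1, (rV_uncons x).2; apply/rowP => i.
by case: (unliftP ord0 i) => [j ->|->]; rewrite ?rV_consS ?rV_cons0//= mxE.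
Qed.

Lemma integral_rV_cons n (f : 'rV[R]_n.+1 -> R) : measurable_fun setT f ->
  (mu \x m n)%E.-integrable setT (EFin \o (fun p => f (rV_cons p))) ->
  (m n.+1).-integrable setT (EFin \o f) /\
  \int[m n.+1]_x f x = \int[mu]_t \int[m n]_v f (rV_cons (t, v)).
Proof.
move=> mf fi; have mF : measurable_fun setT (EFin \o f) by exact/measurable_EFinP.
split.
  exact: (integrable_pushforward (@measurable_rV_cons R n) mF).
rewrite -(Rintegral_prod fi); congr fine.
exact: (integral_pushforward (@measurable_rV_cons R n) mF).
Qed.

Lemma integrable_rV_prod n (g : 'I_n -> R -> R) :
  (forall i, mu.-integrable setT (EFin \o g i)) ->
  (m n).-integrable setT (EFin \o (fun x : 'rV[R]_n => \prod_i g i (x ord0 i))) /\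
  \int[m n]_x (\prod_i g i (x ord0 i)) = \prod_i \int[mu]_t g i t.
Proof.
elim: n g => [|n IH] g gi.
  have -> : (fun x : 'rV[R]_0 => \prod_i g i (x ord0 i)) = cst 1.
    by apply/funext => x; rewrite big_ord0.
  split; last first.
    by rewrite big_ord0 /Rintegral integral_dirac//= indicT mul1r.
  apply/integrableP; split; first exact/measurable_EFinP.
  by rewrite integral_dirac//= diracT mul1e ltry.
have [IH1 IH2] := IH (fun i => g (lift ord0 i)) (fun i => gi _).
have mg : measurable_fun setT (fun x : 'rV[R]_n.+1 => \prod_i g i (x ord0 i)).
  apply: measurable_prod => i _.
  exact: (measurableT_comp (measurable_integrable (gi i)) (measurable_coord i)).
have E (p : R * 'rV[R]_n) : \prod_i g i (rV_cons p ord0 i) =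
    g ord0 p.1 * \prod_i g (lift ord0 i) (p.2 ord0 i).
  rewrite big_ord_recl rV_cons0; congr (_ * _).
  by apply: eq_bigr => i _; rewrite rV_consS.
have mc := measurableT_comp mg (@measurable_rV_cons R n).
have pi : (mu \x m n)%E.-integrable setT
    (EFin \o (fun p => \prod_i g i (rV_cons p ord0 i))).
  apply: (@integrable_prodM _ _ (measurableTypeR R) _ R mu (m n) _
    (fun t => `|g ord0 t|) (fun v => `|\prod_i g (lift ord0 i) (v ord0 i)|)) => //.
  - exact: integrable_norm_R.
  - exact: integrable_norm_R.
  - by move=> x y; rewrite E normrM.
have [h1 h2] := integral_rV_cons mg pi; split => //.
rewrite h2 big_ord_recl -IH2 -(RintegralZr _ measurableT (gi ord0)).
apply: eq_Rintegral => t _; under eq_Rintegral do rewrite E /=.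
exact: (RintegralZl _ measurableT IH1).
Qed.

(** An integrable function dominating all continuous functions of compact
    support, which separates the coordinates. *)
Definition invsqr n (x : 'rV[R]_n) : R := \prod_i (1 + x ord0 i ^+ 2)^-1.

Lemma invsqr_gt0 n (x : 'rV[R]_n) : 0 < invsqr x.
Proof.
by apply: prodr_gt0 => i _; rewrite invr_gt0 ltr_wpDr// sqr_ge0.
Qed.

Lemma invsqr_cons n (t : R) (v : 'rV[R]_n) :
  invsqr (rV_cons (t, v)) = (1 + t ^+ 2)^-1 * invsqr v.
Proof.
rewrite /invsqr big_ord_recl rV_cons0; congr (_ * _).
by apply: eq_bigr => i _; rewrite rV_consS.
Qed.

Lemma integrable_invsqr n : (m n).-integrable setT (EFin \o @invsqr n).
Proof.
by apply: (@integrable_rV_prod n (fun=> fun t => (1 + t ^+ 2)^-1) _).1 => i;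
  exact: integrable_inv1Dsqr.
Qed.

Lemma integrable_le_invsqr n (f : 'rV[R]_n -> R) (C : R) : measurable_fun setT f ->
  (forall x, `|f x| <= C * invsqr x) -> (m n).-integrable setT (EFin \o f).
Proof.
move=> mf fC; apply: (@integrable_le _ _ _ (m n) _ (fun x => C * invsqr x)) => //.
by apply: integrableZl_R => //; exact: integrable_invsqr.
Qed.

End rV_integration.

Lemma Rintegral_eq0 d (T : measurableType d) (R : realType)
    (m : {measure set T -> \bar R}) (f : T -> R) : (forall x, f x = 0) ->
  \int[m]_x f x = 0.
Proof.
move=> f0; rewrite /Rintegral (_ : (fun x => (f x)%:E) = cst 0%E) ?integral0//.
by apply/funext => x; rewrite f0.
Qed.

Section rV_calculus.
Context {R : realType}.
Notation mu := (@lebesgue_measure R).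
Notation m n := (@lebesgue_rV R n).
Notation e_ i := (delta_mx ord0 i).

Lemma continuous_rV (T : topologicalType) n (F : T -> 'rV[R]_n) :
  (forall i, continuous (fun t => F t ord0 i)) -> continuous F.
Proof.
move=> cF t; apply/cvg_ballP => eps eps0.
have h : \forall s \near t, forall j, ball (F t ord0 j) eps (F s ord0 j).
  apply: (@filter_forall T 'I_n (fun j s => ball (F t ord0 j) eps (F s ord0 j))) => j.
  by move/cvg_ballP: (cF j t); exact.
by apply: filterS h => s hs; split => // i j; rewrite ord1.
Qed.

Lemma continuous_rV_cons_r n (t : R) : continuous (fun v : 'rV[R]_n => rV_cons (t, v)).
Proof.
apply: continuous_rV => i; case: (unliftP ord0 i) => [j ->|->].
  by under eq_fun do rewrite rV_consS; exact: coord_continuous.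
rewrite (_ : (fun v : 'rV[R]_n => rV_cons (t, v) ord0 ord0) = cst t).
  exact: cst_continuous.
by apply/funext => v; rewrite rV_cons0.
Qed.

Lemma continuous_rV_cons_l n (v : 'rV[R]_n) : continuous (fun t : R => rV_cons (t, v)).
Proof.
apply: continuous_rV => i; case: (unliftP ord0 i) => [j ->|->].
  rewrite (_ : (fun t : R => rV_cons (t, v) ord0 (lift ord0 j)) = cst (v ord0 j)).
    exact: cst_continuous.
  by apply/funext => t; rewrite rV_consS.
rewrite (_ : (fun t : R => rV_cons (t, v) ord0 ord0) = id).
  by move=> t; exact: cvg_id.
by apply/funext => t; rewrite rV_cons0.
Qed.

Lemma shift_rV_cons0 n (s : R) (v : 'rV[R]_n) :
  s *: e_ ord0 + rV_cons (0, v) = rV_cons (s, v).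
Proof.
apply/rowP => i; rewrite [LHS]mxE [X in X + _ = _]mxE [X in _ * X + _ = _]mxE.
case: (unliftP ord0 i) => [j ->|->].
  by rewrite !rV_consS mulr0 add0r.
by rewrite !rV_cons0 mulr1 addr0.
Qed.

Lemma shift_rV_consS n (s t : R) (v : 'rV[R]_n) j :
  s *: e_ (lift ord0 j) + rV_cons (t, v) = rV_cons (t, s *: e_ j + v).
Proof.
apply/rowP => i; rewrite [LHS]mxE [X in X + _ = _]mxE [X in _ * X + _ = _]mxE.
case: (unliftP ord0 i) => [k ->|->].
  by rewrite !rV_consS /= !mxE !eqxx/= (inj_eq lift_inj).
by rewrite !rV_cons0 mulr0 add0r.
Qed.

(** [g] is the partial derivative of [f] along the [i]-th coordinate; stated on
    lines, so that the one-variable rules apply. *)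
Definition pderiv n (i : 'I_n) (f g : 'rV[R]_n -> R) :=
  forall x (s : R), is_derive s 1 (fun s => f (s *: e_ i + x)) (g (s *: e_ i + x)).

Lemma pderiv_derive n (i : 'I_n) (f : 'rV[R]_n -> R) :
  (forall x, derivable f x (e_ i)) -> pderiv i f ('D_(e_ i) f).
Proof.
move=> df x s; have := df (s *: e_ i + x).
have E : (fun h : R => h^-1 *: (((fun s => f (s *: e_ i + x)) \o shift s) (h *: 1) -
    f (s *: e_ i + x))) = (fun h => h^-1 *: ((f \o shift (s *: e_ i + x)) (h *: e_ i) -
    f (s *: e_ i + x))).
  by apply/funext => h /=; rewrite [h *: 1]mulr1 scalerDl addrA.
by split; rewrite /derivable /derive E.
Qed.

Lemma pderivE n (i : 'I_n) (f g : 'rV[R]_n -> R) : pderiv i f g ->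
  (forall x, derivable f x (e_ i)) /\ 'D_(e_ i) f = g.
Proof.
move=> fg; have E x : (fun h : R => h^-1 *: (((fun s => f (s *: e_ i + x)) \o shift 0) (h *: 1) -
    f (0 *: e_ i + x))) = (fun h => h^-1 *: ((f \o shift x) (h *: e_ i) - f x)).
  by apply/funext => h /=; rewrite addr0 scale0r add0r [h *: 1]mulr1.
split=> [x|].
  by have [+ _] := fg x 0; rewrite /derivable E.
apply/funext => x; have [_ +] := fg x 0.
by rewrite /derive E scale0r add0r.
Qed.

Let inv1Dsqr_le (e t : R) : 0 < e -> e^-1 <= `|t| -> (1 + t ^+ 2)^-1 <= e.
Proof.
move=> e0 et; have ie0 : 0 < e^-1 by rewrite invr_gt0.
rewrite -[leRHS]invrK lef_pV2 ?posrE//; last by rewrite ltr_wpDr// sqr_ge0.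
rewrite -(real_normK (num_real t)); move: et; move: `|t| => a; have := sqr_ge0 (a - 1); nra.
Qed.

Lemma cvg_inv1Dsqr : (1 + t ^+ 2)^-1 @[t --> +oo] --> (0 : R) /\
  (1 + t ^+ 2)^-1 @[t --> -oo] --> (0 : R).
Proof.
have i0 (t : R) : 0 <= (1 + t ^+ 2)^-1 by rewrite invr_ge0 addr_ge0 ?sqr_ge0.
split; apply/cvgrPdist_le => e e0; near=> t; rewrite sub0r normrN ger0_norm//;
  apply: inv1Dsqr_le => //.
  by rewrite (le_trans _ (ler_norm _))//; near: t; apply: nbhs_pinfty_ge; exact: num_real.
rewrite -normrN (le_trans _ (ler_norm _))// lerNr.
by near: t; apply: nbhs_ninfty_le; exact: num_real.
Unshelve. all: by end_near. Qed.

(** The integral of a partial derivative vanishes. *)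
Lemma Rintegral_pderiv n (i : 'I_n) (f g : 'rV[R]_n -> R) (C : R) :
  pderiv i f g -> continuous g ->
  (forall x, `|f x| <= C * invsqr x) -> (forall x, `|g x| <= C * invsqr x) ->
  \int[m n]_x g x = 0.
Proof.
elim: n i f g C => [[]//|n IH] i f g C fg cg fC gC.
have mg := continuous_measurable_rV cg.
have mc := measurableT_comp mg (@measurable_rV_cons R n).
have i1 : mu.-integrable setT (EFin \o (fun t : R => C * (1 + t ^+ 2)^-1)).
  by apply: integrableZl_R => //; exact: integrable_inv1Dsqr.
have pi : (mu \x m n)%E.-integrable setT (EFin \o (fun p => g (rV_cons p))).
  apply: (@integrable_prodM _ _ (measurableTypeR R) _ R mu (m n) _
    (fun t => C * (1 + t ^+ 2)^-1) (@invsqr R n)) => //.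
  - exact: integrable_invsqr.
  - by move=> t v; rewrite (le_trans (gC _))// invsqr_cons mulrA.
rewrite (integral_rV_cons mg pi).2.
case: (unliftP ord0 i) => [j ij|i0].
  apply: Rintegral_eq0 => t.
  apply: (IH j (fun v => f (rV_cons (t, v))) _ (C * (1 + t ^+ 2)^-1)).
  - by move=> v s; have := fg (rV_cons (t, v)) s; rewrite ij; under eq_fun do rewrite shift_rV_consS;
      rewrite shift_rV_consS.
  - by move=> v; exact: (continuous_comp (@continuous_rV_cons_r n t v) (cg _)).
  - by move=> v; rewrite (le_trans (fC _))// invsqr_cons mulrA.
  - by move=> v; rewrite (le_trans (gC _))// invsqr_cons mulrA.
rewrite (Rfubini pi).
apply: Rintegral_eq0 => v.
have cgt : continuous (fun t : R => g (rV_cons (t, v))).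
  by move=> t; exact: (continuous_comp (@continuous_rV_cons_l n v t) (cg _)).
have dfg (t : R) : is_derive t 1 (fun t : R => f (rV_cons (t, v))) (g (rV_cons (t, v))).
  have := fg (rV_cons (0, v)) t; rewrite i0; under eq_fun do rewrite shift_rV_cons0.
  by rewrite shift_rV_cons0.
have ig : mu.-integrable setT (EFin \o (fun t => g (rV_cons (t, v)))).
  apply: (@integrable_le _ _ _ mu _ (fun t => invsqr v * (C * (1 + t ^+ 2)^-1))) => //.
  - exact: continuous_measurable_setT.
  - by move=> t _; rewrite (le_trans (gC _))// invsqr_cons; lra.
  - exact: integrableZl_R.
have f0 (F : set_system R) : ProperFilter F -> (1 + t ^+ 2)^-1 @[t --> F] --> (0 : R) ->
    f (rV_cons (t, v)) @[t --> F] --> (0 : R).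
  move=> FF e0; apply: (@cvg_dist_le _ _ _ _ (fun t => C * invsqr v * (1 + t ^+ 2)^-1)).
    apply: nearW => t; rewrite sub0r normrN (le_trans (fC _))// invsqr_cons.
    by rewrite -mulrA (mulrC (_^-1)).
  rewrite -[X in _ --> X](mulr0 (C * invsqr v)).
  by apply: cvgM => //; exact: cvg_cst.
have [c1 c2] := cvg_inv1Dsqr.
rewrite (Rintegral_primitive cgt ig dfg (f0 _ _ c2) (f0 _ _ c1)).
by rewrite subr0.
Qed.

End rV_calculus.

(** * Fourier transform of the Gaussian *)

Section gaussian_fourier.
Context {R : realType}.
Notation mu := (@lebesgue_measure R).
Notation m n := (@lebesgue_rV R n).

Lemma expRN_sqr_le (s t : R) : 0 < s ->
  expR (- (s * t ^+ 2)) <= (1 + s^-1) * (1 + t ^+ 2)^-1.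
Proof.
move=> s0; have t0 := sqr_ge0 t; have s1 : 0 < s^-1 by rewrite invr_gt0.
have e0 : 1 + s * t ^+ 2 <= expR (s * t ^+ 2) by exact: expR_ge1Dx.
rewrite expRN ler_pdivlMr ?ltr_wpDr// mulrC ler_pdivrMr ?expR_gt0//.
apply: (@le_trans _ _ ((1 + s^-1) * (1 + s * t ^+ 2))); last first.
  by apply: ler_wpM2l => //; lra.
have : s^-1 * (s * t ^+ 2) = t ^+ 2 by rewrite mulKf// gt_eqF.
move: (s^-1) (t ^+ 2) s1 t0 => a b a0 b0 h.
have -> : (1 + a) * (1 + s * b) = 1 + s * b + a + a * (s * b) by ring.
by rewrite h; have := mulr_ge0 (ltW s0) b0; lra.
Qed.

Section one_dim.
Variables (s : R) (s0 : 0 < s).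

Let g (t : R) := expR (- (s * t ^+ 2)).

Let dg (t : R) : is_derive t 1 g (- (2 * s * t) * g t).
Proof.
have h := is_derive1N (is_derive1Zl s (is_derive1M (is_derive1_id t) (is_derive1_id t))).
apply: (is_derive_eq (is_derive1_expR h)); rewrite /g expr2.
by move: (expR _) => e; ring.
Qed.

Let dphase (eta y t : R) : is_derive t 1 (fun t => y * t + eta) y.
Proof. exact: is_derive1_affine. Qed.

Let cg : continuous g. Proof. exact: is_derive1_continuousT dg. Qed.
Let ig : mu.-integrable setT (EFin \o g). Proof. exact: integrable_gauss. Qed.
Let g0 t : 0 < g t. Proof. exact: expR_gt0. Qed.

Lemma continuous_gauss_cos eta y : continuous (fun t : R => g t * cos (y * t + eta)).
Proof. by move=> t; exact: is_derive1_continuous (is_derive1M (dg t) (is_derive1_cos (dphase eta y t))). Qed.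

Lemma continuous_gauss_sin eta y : continuous (fun t : R => g t * sin (y * t + eta)).
Proof. by move=> t; exact: is_derive1_continuous (is_derive1M (dg t) (is_derive1_sin (dphase eta y t))). Qed.

Let cos_le x : `|cos x : R| <= 1. Proof. by rewrite ler_norml cos_geN1 cos_le1. Qed.
Let sin_le x : `|sin x : R| <= 1. Proof. by rewrite ler_norml sin_geN1 sin_le1. Qed.

Lemma integrable_gauss_cos eta y :
  mu.-integrable setT (EFin \o (fun t => g t * cos (y * t + eta))).
Proof.
apply: (@integrable_le _ _ _ mu _ g) => //.
- apply: continuous_measurable_setT; exact: continuous_gauss_cos.
- by move=> t _; rewrite normrM (gtr0_norm (g0 t)) ler_piMr// ltW.
Qed.

Let G t := (2^-1 + s^-1) * expR (- (s / 2 * t ^+ 2)).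

Let tg_le t : `|t| * g t <= G t.
Proof.
have s2 : 0 < s / 2 by rewrite divr_gt0.
have -> : g t = expR (- (s / 2 * t ^+ 2)) * expR (- (s / 2 * t ^+ 2)).
  by rewrite /g -expRD; congr expR; field.
rewrite mulrA; apply: ler_wpM2r; first exact: expR_ge0.
rewrite expRN ler_pdivrMr ?expR_gt0//.
have e0 : 1 + s / 2 * t ^+ 2 <= expR (s / 2 * t ^+ 2) by exact: expR_ge1Dx.
have i0 : 0 < s^-1 by rewrite invr_gt0.
apply: (@le_trans _ _ ((2^-1 + s^-1) * (1 + s / 2 * t ^+ 2))); last first.
  by apply: ler_wpM2l => //; lra.
have -> : (2^-1 + s^-1) * (1 + s / 2 * t ^+ 2) =
    2^-1 + 2^-1 * t ^+ 2 + (s^-1 + s / 4 * t ^+ 2) by field; rewrite gt_eqF.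
have := sqr_ge0 (`|t| - 1); have := mulr_ge0 (ltW s0) (sqr_ge0 t).
by rewrite -(real_normK (num_real t)); move: (`|t|) => a; nra.
Qed.

Let iG : mu.-integrable setT (EFin \o G).
Proof. by apply: integrableZl_R => //; apply: integrable_gauss; rewrite divr_gt0. Qed.

Let itg eta y : mu.-integrable setT (EFin \o (fun t => t * (g t * sin (y * t + eta)))).
Proof.
apply: (@integrable_le _ _ _ mu _ G) => //.
- by apply: measurable_funM => //; apply: continuous_measurable_setT; exact: continuous_gauss_sin.
- move=> t _; rewrite (le_trans _ (tg_le t))// normrM ler_wpM2l//.
  by rewrite normrM (gtr0_norm (g0 t)) ler_piMr// ltW.
Qed.

(** Integration by parts. *)
Let parts eta y : \int[mu]_t (t * (g t * sin (y * t + eta))) =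
  y / (2 * s) * \int[mu]_t (g t * cos (y * t + eta)).
Proof.
have dF (t : R) : is_derive t 1 (fun t => g t * sin (y * t + eta))
    (y * (g t * cos (y * t + eta)) - 2 * s * (t * (g t * sin (y * t + eta)))).
  apply: (is_derive_eq (is_derive1M (dg t) (is_derive1_sin (dphase eta y t)))).
  by ring.
have i1 := integrableZl_R y measurableT (integrable_gauss_cos eta y).
have i2 := integrableZl_R (2 * s) measurableT (itg eta y).
have cF : continuous (fun t => y * (g t * cos (y * t + eta)) -
    2 * s * (t * (g t * sin (y * t + eta)))).
  move=> t; apply: cvgB; apply: cvgM; try exact: cvg_cst.
    exact: continuous_gauss_cos.
  by apply: cvgM; [exact: cvg_id|exact: continuous_gauss_sin].
have lim0 (F : set_system R) : ProperFilter F -> (1 + t ^+ 2)^-1 @[t --> F] --> (0 : R) ->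
    g t * sin (y * t + eta) @[t --> F] --> (0 : R).
  move=> FF e0; apply: (@cvg_dist_le _ _ _ _ (fun t => (1 + s^-1) * (1 + t ^+ 2)^-1)).
    apply: nearW => t; rewrite sub0r normrN; apply: le_trans (expRN_sqr_le t s0).
    by rewrite normrM (gtr0_norm (g0 t)) ler_piMr// ltW.
  rewrite -[X in _ --> X](mulr0 (1 + s^-1)).
  by apply: cvgM => //; exact: cvg_cst.
have [c1 c2] := @cvg_inv1Dsqr R.
have := Rintegral_primitive cF (integrableB_R measurableT i1 i2) dF (lim0 _ _ c2) (lim0 _ _ c1).
rewrite (RintegralB measurableT i1 i2) (RintegralZl _ measurableT (integrable_gauss_cos eta y)).
rewrite (RintegralZl _ measurableT (itg eta y)) subr0.
move: (\int[mu]_t _) (\int[mu]_t _) => a b h.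
have -> : y / (2 * s) * a = (y * a - 2 * s * b) / (2 * s) + b.
  by field; rewrite gt_eqF.
by rewrite h mul0r add0r.
Qed.

Lemma is_derive_gauss_cos eta (y : R) :
  is_derive y 1 (fun y => \int[mu]_t (g t * cos (y * t + eta)))
    (- (y / (2 * s)) * \int[mu]_t (g t * cos (y * t + eta))).
Proof.
pose f (y t : R) := g t * cos (y * t + eta).
have dI (x t : R) : is_derive x 1 (fun x => f x t) (- (t * (g t * sin (x * t + eta)))).
  have h := is_derive1D (is_derive1M (is_derive1_id x) (is_derive1_cst t x)) (is_derive1_cst eta x).
  apply: (is_derive_eq (is_derive1Zl (g t) (is_derive1_cos h))).
  by ring.
have p1 (x t : R) : partial1of2 f x t = - (t * (g t * sin (x * t + eta))).
  by rewrite partial1of2E; have [_ ->] := dI x t.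
have Iy : y \in `]y - 1, y + 1[ by rewrite in_itv/=; apply/andP; split; lra.
have G0 t : 0 <= G t by apply: le_trans (tg_le t); rewrite mulr_ge0// ltW.
have h1 (x : R) : x \in `]y - 1, y + 1[ -> mu.-integrable setT (EFin \o f x).
  by move=> _; exact: integrable_gauss_cos.
have h2 (x t : R) : x \in `]y - 1, y + 1[ -> [set: R] t -> derivable (fun x => f x t) x 1.
  by move=> _ _; case: (dI x t).
have h3 (x t : R) : x \in `]y - 1, y + 1[ -> [set: R] t -> `|partial1of2 f x t| <= G t.
  move=> _ _; rewrite p1 normrN (le_trans _ (tg_le t))// normrM ler_wpM2l//.
  by rewrite normrM (gtr0_norm (g0 t)) ler_piMr// ltW.
have dJ := @derivable_under_integral R _ _ mu f
  setT measurableT y (y - 1) (y + 1) Iy h1 h2 G G0 iG h3.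
have eJ := @differentiation_under_integral R _ _ mu f
  setT measurableT y (y - 1) (y + 1) Iy h1 h2 G G0 iG h3.
split => //; rewrite -derive1E; apply: (eq_trans eJ).
rewrite mulNr -parts -mulN1r -(RintegralZl _ measurableT (itg eta y)).
by apply: eq_Rintegral => t _; rewrite p1 mulN1r.
Qed.

Lemma Rintegral_gauss_cos eta (y : R) : \int[mu]_t (g t * cos (y * t + eta)) =
  Num.sqrt (pi / s) * expR (- (y ^+ 2 / (4 * s))) * cos eta.
Proof.
pose I (y : R) := \int[mu]_t (g t * cos (y * t + eta)).
have dJ (x : R) : is_derive x 1 (fun x => I x * expR (x ^+ 2 / (4 * s))) 0.
  have h := is_derive1M (is_derive1M (is_derive1_id x) (is_derive1_id x))
    (is_derive1_cst (4 * s)^-1 x).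
  apply: (is_derive_eq (is_derive1M (is_derive_gauss_cos eta x) (is_derive1_expR h))).
  by move: (expR _) (\int[mu]_t _) => a b; field; rewrite gt_eqF.
have J0 : I y * expR (y ^+ 2 / (4 * s)) = I 0 * expR (0 ^+ 2 / (4 * s)).
  apply/eqP; rewrite -subr_eq0 -normr_le0.
  have := le_dist_deriveT dJ (M := 0) (fun x => _) 0 y; rewrite mul0r; apply.
  by rewrite normr0.
have I0 : I 0 = Num.sqrt (pi / s) * cos eta.
  rewrite /I; under eq_Rintegral do rewrite mul0r add0r.
  by rewrite (RintegralZr _ measurableT ig) /Rintegral integral_gauss.
rewrite -/(I y) mulrAC -I0 expRN -[LHS](mulfK (lt0r_neq0 (expR_gt0 (y ^+ 2 / (4 * s))))).
by rewrite J0 expr0n/= mul0r expR0 mulr1.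
Qed.

End one_dim.

Lemma dotp_cons n (p q : R * 'rV[R]_n) :
  dotp (rV_cons p) (rV_cons q) = p.1 * q.1 + dotp p.2 q.2.
Proof.
rewrite /dotp big_ord_recl !rV_cons0; congr (_ + _).
by apply: eq_bigr => i _; rewrite !rV_consS.
Qed.

Lemma dotp_ge0 n (x : 'rV[R]_n) : 0 <= dotp x x.
Proof. by apply: sumr_ge0 => i _; rewrite -expr2 sqr_ge0. Qed.

Lemma dotp_gt0 n (x : 'rV[R]_n) : x != 0 -> 0 < dotp x x.
Proof.
move=> x0; rewrite lt_neqAle dotp_ge0 andbT eq_sym; apply: contra x0.
rewrite psumr_eq0 => [/allP hx|i _]; last by rewrite -expr2 sqr_ge0.
apply/eqP/rowP => i; rewrite mxE; apply/eqP.
by have := hx i (mem_index_enum _); rewrite mulf_eq0 orbb.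
Qed.

Lemma sqr_enorm n (x : 'rV[R]_n) : enorm x ^+ 2 = dotp x x.
Proof. by rewrite sqr_sqrtr// dotp_ge0. Qed.

Lemma measurable_dotp d (T : measurableType d) n (F G : T -> 'rV[R]_n) :
  measurable_fun setT F -> measurable_fun setT G ->
  measurable_fun setT (fun x => dotp (F x) (G x)).
Proof.
move=> mF mG; apply: measurable_sum => i; apply: measurable_funM.
  exact: (measurableT_comp (measurable_coord i) mF).
exact: (measurableT_comp (measurable_coord i) mG).
Qed.

Lemma measurable_gauss n (s : R) :
  measurable_fun setT (fun r : 'rV[R]_n => expR (- (s * dotp r r))).
Proof.
apply: (measurableT_comp (continuous_measurable_setT (@continuous_expR R))).
by apply: measurableT_comp => //; apply: measurable_funM => //; exact: measurable_dotp.
Qed.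

Lemma integrable_gauss_rV n (s : R) : 0 < s ->
  (m n).-integrable setT (EFin \o (fun r : 'rV[R]_n => expR (- (s * dotp r r)))).
Proof.
move=> s0; have := (integrable_rV_prod (fun i : 'I_n => integrable_gauss s0)).1.
apply: eq_integrable => // r _; congr (_%:E).
by rewrite -expR_sum /dotp mulr_sumr -sumrN; congr expR.
Qed.

Lemma measurable_gauss_cos n (s eta : R) (z : 'rV[R]_n) :
  measurable_fun setT (fun r : 'rV[R]_n => expR (- (s * dotp r r)) * cos (dotp z r + eta)).
Proof.
apply: measurable_funM; first exact: measurable_gauss.
apply: (measurableT_comp (continuous_measurable_setT (@continuous_cos R))).
by apply: measurable_funD => //; exact: measurable_dotp.
Qed.

Lemma Rintegral_gauss_rV n (s eta : R) (z : 'rV[R]_n) : 0 < s ->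
  \int[m n]_r (expR (- (s * dotp r r)) * cos (dotp z r + eta)) =
  Num.sqrt (pi / s) ^+ n * expR (- (dotp z z / (4 * s))) * cos eta.
Proof.
move=> s0; have cos_le x : `|cos x : R| <= 1 by rewrite ler_norml cos_geN1 cos_le1.
elim: n eta z => [|n IH] eta z.
  rewrite /Rintegral integral_dirac//=; last first.
    by apply/measurable_EFinP; exact: measurable_gauss_cos.
  by rewrite /dotp !big_ord0 !mulr0 !mul0r oppr0 expR0 add0r indicT expr0 !mul1r.
have [z0 [z' ->]] := rV_uncons_surj z.
have mg := measurable_gauss_cos s eta (rV_cons (z0, z')).
have mc := measurableT_comp mg (@measurable_rV_cons R n).
have E (p : R * 'rV[R]_n) : expR (- (s * dotp (rV_cons p) (rV_cons p))) *
    cos (dotp (rV_cons (z0, z')) (rV_cons p) + eta) = expR (- (s * p.1 ^+ 2)) *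
    (expR (- (s * dotp p.2 p.2)) * cos (dotp z' p.2 + (z0 * p.1 + eta))).
  rewrite mulrA -expRD !dotp_cons/=; congr (expR _ * cos _); ring.
have pi : (mu \x m n)%E.-integrable setT (EFin \o (fun p =>
    expR (- (s * dotp (rV_cons p) (rV_cons p))) *
    cos (dotp (rV_cons (z0, z')) (rV_cons p) + eta))).
  apply: (@integrable_prodM _ _ (measurableTypeR R) _ R mu (m n) _
    (fun t => expR (- (s * t ^+ 2))) (fun v => expR (- (s * dotp v v)))) => //.
  - exact: integrable_gauss.
  - exact: integrable_gauss_rV.
  - move=> t v; rewrite E normrM [X in X * _ <= _]ger0_norm ?expR_ge0//=; apply: ler_wpM2l; first exact: expR_ge0.
    by rewrite normrM ger0_norm ?expR_ge0// ler_piMr ?expR_ge0.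
rewrite (integral_rV_cons mg pi).2.
have K t : \int[m n]_v (expR (- (s * dotp (rV_cons (t, v)) (rV_cons (t, v)))) *
    cos (dotp (rV_cons (z0, z')) (rV_cons (t, v)) + eta)) =
    Num.sqrt (trigo.pi / s) ^+ n * expR (- (dotp z' z' / (4 * s))) *
    (expR (- (s * t ^+ 2)) * cos (z0 * t + eta)).
  under eq_Rintegral do rewrite E /=.
  rewrite RintegralZl//.
    by rewrite IH; ring.
  apply: (@integrable_le _ _ _ (m n) _ (fun v => expR (- (s * dotp v v)))) => //.
  - exact: measurable_gauss_cos.
  - by move=> v _; rewrite normrM ger0_norm ?expR_ge0// ler_piMr ?expR_ge0.
  - exact: integrable_gauss_rV.
under eq_Rintegral do rewrite K.
rewrite (RintegralZl _ measurableT (integrable_gauss_cos s0 eta z0)).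
rewrite Rintegral_gauss_cos// dotp_cons/=.
have -> : expR (- ((z0 * z0 + dotp z' z') / (4 * s))) =
    expR (- (dotp z' z' / (4 * s))) * expR (- (z0 ^+ 2 / (4 * s))).
  by rewrite -expRD; congr expR; ring.
by rewrite (exprS _ n); ring.
Qed.

End gaussian_fourier.

(** * Fourier transforms of test functions *)

Section continuous_arithmetic.
Context {R : realType} {T : topologicalType}.
Implicit Types f g : T -> R.

Lemma continuous_add f g : continuous f -> continuous g -> continuous (fun x => f x + g x).
Proof. by move=> cf cg x; exact: (cvgD (cf x) (cg x)). Qed.

Lemma continuous_opp f : continuous f -> continuous (fun x => - f x).
Proof. by move=> cf x; exact: (cvgN (cf x)). Qed.

Lemma continuous_mul f g : continuous f -> continuous g -> continuous (fun x => f x * g x).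
Proof. by move=> cf cg x; exact: (cvgM (cf x) (cg x)). Qed.

Lemma continuous_const (c : R) : continuous ((fun=> c) : T -> R).
Proof. by move=> x; exact: cvg_cst. Qed.

Lemma continuous_compR (h : R -> R) f : continuous h -> continuous f ->
  continuous (fun x => h (f x)).
Proof. by move=> ch cf x; exact: (cvg_comp _ _ (cf x) (ch (f x))). Qed.

Lemma continuous_sum (I : finType) (F : I -> T -> R) : (forall i, continuous (F i)) ->
  continuous (fun x => \sum_i F i x).
Proof. by move=> cF; exact: (continuous_big (@add_continuous R) (fun i _ => cF i)). Qed.

Lemma continuous_prod (I : finType) (F : I -> T -> R) : (forall i, continuous (F i)) ->
  continuous (fun x => \prod_i F i x).
Proof. by move=> cF; exact: (continuous_big (@mul_continuous R) (fun i _ => cF i)). Qed.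

End continuous_arithmetic.

Section test_functions.
Context {R : realType}.
Variable n : nat.
Notation m := (@lebesgue_rV R n).
Notation e_ i := (delta_mx ord0 i).
Implicit Types (a : 'rV[R]_n -> R) (x z r : 'rV[R]_n).

Lemma continuous_coord (i : 'I_n) : continuous (fun x : 'rV[R]_n => x ord0 i).
Proof. exact: coord_continuous. Qed.

Lemma continuous_dotp_l r : continuous (fun z => dotp z r).
Proof.
rewrite /dotp; apply: continuous_sum => i; apply: continuous_mul.
  exact: continuous_coord.
exact: continuous_const.
Qed.

(** Real smooth functions of compact support. *)
Definition is_test a := smooth a /\
  exists2 S : set 'rV[R]_n, compact S & forall x, ~ S x -> a x = 0.

Lemma is_test_continuous a : is_test a -> continuous a.
Proof. by move=> [/(_ 0%N)[]]. Qed.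

Lemma is_test_pderiv (i : 'I_n) a : is_test a -> pderiv i a ('D_(e_ i) a).
Proof. by move=> [/(_ 1%N)[_ /(_ i)[da _]] _]; exact: pderiv_derive. Qed.

Lemma is_test_derive (i : 'I_n) a : is_test a -> is_test ('D_(e_ i) a).
Proof.
move=> [sa [S cS aS]]; split.
  by move=> k; have [_ /(_ i)[]] := sa k.+1.
exists S => // x Sx.
have oS : open (~` S).
  by apply: closed_openC; apply: compact_closed => //; exact: norm_hausdorff.
have nS : \forall y \near x, a y = 0.
  by apply: filterS (open_nbhs_nbhs (conj oS Sx)) => y; exact: aS.
rewrite (@near_eq_derive _ _ _ a (cst 0) x (e_ i) nS).
exact: derive_cst.
Qed.

Lemma compact_support_le a (S : set 'rV[R]_n) : continuous a -> compact S ->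
  (forall x, ~ S x -> a x = 0) -> exists2 C, 0 <= C & forall x, `|a x| <= C * invsqr x.
Proof.
move=> ca cS aS; pose f x := a x * \prod_i (1 + x ord0 i ^+ 2).
have cf : continuous f.
  apply: continuous_mul => //; apply: continuous_prod => i.
  apply: continuous_add; first exact: continuous_const.
  by apply: continuous_mul; exact: continuous_coord.
have fE x : a x = f x * invsqr x.
  rewrite /f /invsqr prodfV mulfK// gt_eqF// prodr_gt0// => i _.
  by rewrite ltr_wpDr// sqr_ge0.
have : bounded_set (f @` S).
  apply: compact_bounded; apply: continuous_compact => //.
  exact: continuous_subspaceT.
move=> /pinfty_ex_gt0[M M0 hM]; exists M; first exact: ltW.
move=> x; rewrite {1}fE normrM (gtr0_norm (invsqr_gt0 x)).
apply: ler_wpM2r; first exact/ltW/invsqr_gt0.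
have [Sx|Sx] := pselect (S x); first by apply: hM; exists x.
by rewrite /f aS// mul0r normr0 ltW.
Qed.

Lemma is_test_le a : is_test a -> exists2 C, 0 <= C & forall x, `|a x| <= C * invsqr x.
Proof.
move=> ta; have [_ [S cS aS]] := ta.
exact: compact_support_le (is_test_continuous ta) cS aS.
Qed.

Lemma integrable_test a : is_test a -> m.-integrable setT (EFin \o a).
Proof.
move=> ta; have [C _ aC] := is_test_le ta.
apply: (integrable_le_invsqr _ aC).
by apply: continuous_measurable_rV; exact: is_test_continuous.
Qed.

(** The Fourier transform with phase [eta]: its real and imaginary parts are
    obtained for [eta = 0] and [eta = - pi / 2]. *)
Definition cosft a (eta : R) r : R := \int[m]_z (cos (- dotp z r + eta) * a z).

Let cos_le (x : R) : `|cos x| <= 1. Proof. by rewrite ler_norml cos_geN1 cos_le1. Qed.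
Let sin_le (x : R) : `|sin x| <= 1. Proof. by rewrite ler_norml sin_geN1 sin_le1. Qed.

Let continuous_phase eta r : continuous (fun z => - dotp z r + eta).
Proof.
by apply: continuous_add; [apply: continuous_opp; exact: continuous_dotp_l|exact: continuous_const].
Qed.

Let continuous_cos_phase eta r : continuous (fun z => cos (- dotp z r + eta)).
Proof. have := continuous_compR (@continuous_cos R) (@continuous_phase eta r); exact. Qed.

Lemma integrable_cos_test a eta r : is_test a ->
  m.-integrable setT (EFin \o (fun z => cos (- dotp z r + eta) * a z)).
Proof.
move=> ta; apply: (@integrable_le _ _ _ m _ (fun z => `|a z|)) => //.
- by apply: continuous_measurable_rV; apply: continuous_mul => //; exact: is_test_continuous.
- by move=> z _; rewrite normrM ler_piMl.
- by apply: integrable_norm_R => //; exact: integrable_test.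
Qed.

Lemma cosft_le a eta r : is_test a -> `|cosft a eta r| <= \int[m]_z `|a z|.
Proof.
move=> ta; have ia := integrable_cos_test eta r ta.
apply: (le_trans (le_normr_Rintegral measurableT ia)).
apply: le_Rintegral => //.
- exact: (integrable_norm_R measurableT ia).
- by apply: integrable_norm_R => //; exact: integrable_test.
- by move=> z _; rewrite normrM ler_piMl.
Qed.

(** Integration by parts: decay of the Fourier transform. *)
Lemma cosft_derive (i : 'I_n) a eta r : is_test a ->
  r ord0 i * cosft a eta r = cosft ('D_(e_ i) a) (eta - pi / 2) r.
Proof.
move=> ta; have tb := is_test_derive i ta; set b := 'D_(e_ i) a in tb *.
have [C C0 aC] := is_test_le ta; have [C' C'0 bC] := is_test_le tb.
pose f z := sin (- dotp z r + eta) * a z.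
pose g z := - r ord0 i * (cos (- dotp z r + eta) * a z) +
  cos (- dotp z r + (eta - pi / 2)) * b z.
have fg : pderiv i f g.
  move=> x s; have dE (u : R) : dotp (u *: e_ i + x) r = r ord0 i * u + dotp x r.
    rewrite /dotp (bigD1 i)//= [X in _ = _ + X](bigD1 i)//= !mxE !eqxx/= mulr1 addrA.
    congr (_ + _); first by ring.
    by apply: eq_bigr => j ji; rewrite !mxE (negPf ji) mulr0 add0r.
  have h1 : is_derive s 1 (fun u : R => - (r ord0 i * u + dotp x r) + eta) (- r ord0 i).
    have h := is_derive1D (is_derive1N (is_derive1D (is_derive1Zl (r ord0 i)
      (is_derive1_id s)) (is_derive1_cst (dotp x r) s))) (is_derive1_cst eta s).
    by apply: (is_derive_eq h); rewrite mulr1 !addr0.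
  have h2 := is_derive1M (is_derive1_sin h1) (is_test_pderiv i ta x s).
  rewrite /f (_ : (fun u => _) = (fun u => sin (- (r ord0 i * u + dotp x r) + eta) *
    a (u *: e_ i + x))); last by apply/funext => u; rewrite dE.
  apply: (is_derive_eq h2); rewrite /g dE addrA cosBpihalf.
  rewrite (_ : 'D_(e_ i) a _ = b (s *: e_ i + x))//.
  by ring.
have cg : continuous g.
  apply: continuous_add; apply: continuous_mul => //; try exact: is_test_continuous.
    exact: continuous_const.
  by apply: continuous_mul => //; exact: is_test_continuous.
have r0 := normr_ge0 (r ord0 i).
have fC x : `|f x| <= (C + `|r ord0 i| * C + C') * invsqr x.
  have i0 := ltW (invsqr_gt0 x).
  apply: (@le_trans _ _ (C * invsqr x)).
    by apply: le_trans (aC x); rewrite normrM ler_piMl.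
  by apply: ler_wpM2r => //; have := mulr_ge0 r0 C0; lra.
have gC x : `|g x| <= (C + `|r ord0 i| * C + C') * invsqr x.
  have i0 := ltW (invsqr_gt0 x); apply: (le_trans (ler_normD _ _)).
  have h1 : `|- r ord0 i * (cos (- dotp x r + eta) * a x)| <= `|r ord0 i| * (C * invsqr x).
    rewrite normrM normrN; apply: ler_wpM2l => //.
    by apply: le_trans (aC x); rewrite normrM ler_piMl.
  have h2 : `|cos (- dotp x r + (eta - pi / 2)) * b x| <= C' * invsqr x.
    by apply: le_trans (bC x); rewrite normrM ler_piMl.
  apply: (le_trans (lerD h1 h2)); have := mulr_ge0 C0 i0.
  by rewrite mulrA !mulrDl; lra.
have := Rintegral_pderiv fg cg fC gC; rewrite /g.
have i1 := integrable_cos_test eta r ta.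
have i2 := integrable_cos_test (eta - pi / 2) r tb.
rewrite (RintegralD measurableT (integrableZl_R (- r ord0 i) measurableT i1) i2).
rewrite (RintegralZl _ measurableT i1) -/(cosft a eta r) -/(cosft b (eta - pi / 2) r).
by lra.
Qed.

Lemma cosft_decay (s : seq 'I_n) a : is_test a ->
  exists M, forall eta r, \prod_(i <- s) (1 + r ord0 i ^+ 2) * `|cosft a eta r| <= M.
Proof.
elim: s a => [|i s IH] a ta.
  by exists (\int[m]_z `|a z|) => eta r; rewrite big_nil mul1r; exact: cosft_le.
have ta' := is_test_derive i ta; have ta'' := is_test_derive i ta'.
have [M1 h1] := IH _ ta; have [M2 h2] := IH _ ta''.
exists (M1 + M2) => eta r; rewrite big_cons -mulrA mulrCA.
have -> : (1 + r ord0 i ^+ 2) * `|cosft a eta r| =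
    `|cosft a eta r| + `|cosft ('D_(e_ i) ('D_(e_ i) a)) (eta - pi / 2 - pi / 2) r|.
  rewrite -cosft_derive// -cosft_derive// mulrA normrM mulrDl mul1r -expr2.
  by rewrite ger0_norm ?sqr_ge0.
by rewrite mulrDr lerD.
Qed.

Lemma cosft_le_invsqr a : is_test a ->
  exists M, forall eta r, `|cosft a eta r| <= M * invsqr r.
Proof.
move=> /(cosft_decay (index_enum 'I_n))[M hM]; exists M => eta r.
by rewrite /invsqr prodfV ler_pdivlMr ?prodr_gt0// => [|i _];
  [rewrite mulrC; exact: hM|rewrite ltr_wpDr// sqr_ge0].
Qed.

Let mcos d (T : measurableType d) (f : T -> R) : measurable_fun setT f ->
  measurable_fun setT (fun w : T => cos (f w)).
Proof. exact: (measurableT_comp (continuous_measurable_setT (@continuous_cos R))). Qed.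

Lemma measurable_cosft a eta : is_test a -> measurable_fun setT (cosft a eta).
Proof.
move=> ta; have ma := continuous_measurable_rV (is_test_continuous ta).
have mi : measurable_fun setT (@invsqr R n) := measurable_integrable (integrable_invsqr n).
pose J (p : 'rV[R]_n * 'rV[R]_n) := invsqr p.1 * (cos (- dotp p.2 p.1 + eta) * a p.2).
have iJ : (m \x m)%E.-integrable setT (EFin \o J).
  apply: (@integrable_prodM _ _ _ _ R m m _ (@invsqr R n) (fun z => `|a z|)).
  - apply: measurable_funM; first exact: (measurableT_comp mi measurable_fst).
    apply: measurable_funM; last exact: (measurableT_comp ma measurable_snd).
    apply: mcos; apply: measurable_funD => //; apply: measurableT_comp => //.
    exact: measurable_dotp.
  - exact: integrable_invsqr.
  - by apply: integrable_norm_R => //; exact: integrable_test.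
  - move=> x y; rewrite normrM (gtr0_norm (invsqr_gt0 x)); apply: ler_wpM2l.
      exact/ltW/invsqr_gt0.
    by rewrite normrM ler_piMl.
have := measurable_integrable (integrable_Rfubini1 iJ).
have E r : \int[m]_z J (r, z) = invsqr r * cosft a eta r.
  by rewrite /J /= (RintegralZl _ measurableT (integrable_cos_test eta r ta)).
under eq_fun do rewrite E.
move=> mJ; have -> : cosft a eta = (fun r => (invsqr r)^-1 * (invsqr r * cosft a eta r)).
  by apply/funext => r; rewrite mulKf// gt_eqF// invsqr_gt0.
apply: measurable_funM => //.
rewrite (_ : (fun r => _) = (fun r : 'rV[R]_n => \prod_i (1 + r ord0 i ^+ 2))).
  apply: measurable_prod => i _; apply: measurable_funD => //.
  by apply: measurable_funX; exact: measurable_coord.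
by apply/funext => r; rewrite /invsqr prodfV invrK.
Qed.

Lemma integrable_cosft a eta : is_test a -> m.-integrable setT (EFin \o cosft a eta).
Proof.
move=> ta; have [M hM] := cosft_le_invsqr ta.
by apply: (integrable_le_invsqr (measurable_cosft eta ta) (hM eta)).
Qed.

End test_functions.

(** * The pairing with test functions *)

Section null_set.
Context {R : realType}.

Lemma ae_enorm_gt0 n : (0 < n)%N ->
  {ae @lebesgue_rV R n, forall r : 'rV[R]_n, 0 < enorm r}.
Proof.
case: n => // n _; exists [set r : 'rV[R]_n.+1 | r ord0 ord0 = 0]; split.
- rewrite -[X in measurable X]setTI.
  by have := @measurable_coord R n.+1 ord0 measurableT [set 0]; apply; exact: measurable_set1.
- rewrite /= /lebesgue_rVS /pushforward.
  rewrite (_ : _ @^-1` _ = [set (0 : measurableTypeR R)] `*` [set: 'rV[R]_n]).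
    by rewrite product_measure1E//= lebesgue_measure_set1 mul0e.
  by apply/seteqP; split => [[t v]|[t v]] /=; rewrite rV_cons0//= => -[].
- move=> r /=; apply: contra_notP => /eqP r0; rewrite sqrtr_gt0.
  rewrite /dotp (bigD1 ord0)//= ltr_pwDl//; first by rewrite -expr2 exprn_even_gt0.
  by apply: sumr_ge0 => i _; rewrite -expr2 sqr_ge0.
Qed.

End null_set.

Section pairing.
Context {R : realType}.
Variables (n : nat) (hn : (1 < n)%N) (delta lambda : R).
Hypotheses (hdelta : 0 < delta < 2) (hlambda : 0 < lambda).
Notation mu := (@lebesgue_measure R).
Notation m := (@lebesgue_rV R n).
Implicit Types (z r : 'rV[R]_n) (sg : R).

Let h : R -> R := dagum_mix delta lambda.
Let ih : mu.-integrable setT (EFin \o h).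
Proof. exact: integrable_dagum_mix. Qed.
Let mh : measurable_fun setT h. Proof. exact: measurable_integrable ih. Qed.

Let mexp d (T : measurableType d) (f : T -> R) : measurable_fun setT f ->
  measurable_fun setT (fun w : T => expR (f w)).
Proof. exact: (measurableT_comp (continuous_measurable_setT (@continuous_expR R))). Qed.

Let mcos d (T : measurableType d) (f : T -> R) : measurable_fun setT f ->
  measurable_fun setT (fun w : T => cos (f w)).
Proof. exact: (measurableT_comp (continuous_measurable_setT (@continuous_cos R))). Qed.

Let cos_le (x : R) : `|cos x| <= 1. Proof. by rewrite ler_norml cos_geN1 cos_le1. Qed.

Let gaussE sg z : Num.sqrt (pi / expR sg) ^+ n * expR (- (dotp z z / (4 * expR sg))) =
  Num.sqrt pi ^+ n * gweight n (dotp z z / 4) sg.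
Proof.
have e0 := expR_gt0 sg; have e2 : 0 < expR (sg / 2) by exact: expR_gt0.
have -> : Num.sqrt (pi / expR sg) = Num.sqrt pi * expR (- (sg / 2)).
  rewrite sqrtrM ?pi_ge0//; congr (_ * _).
  rewrite -expRN (_ : - sg = - (sg / 2) + - (sg / 2)) ?expRD -?expr2; last by field.
  by rewrite sqrtr_sqr gtr0_norm ?expR_gt0.
rewrite exprMn -mulrA; congr (_ * _); rewrite -expRM_natl -expRD /gweight; congr expR.
rewrite expRN invfM mulrA; congr (_ - _); rewrite -mulr_natl.
by field.
Qed.

Lemma integrable_test_gweight (a : 'rV[R]_n -> R) sg : is_test a ->
  m.-integrable setT (EFin \o (fun z => a z * gweight n (dotp z z / 4) sg)).
Proof.
move=> ta; have ia := integrable_test ta; have ma := measurable_integrable ia.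
apply: (@integrable_le _ _ _ m _ (fun z => expR (- (n%:R / 2 * sg)) * `|a z|)) => //.
- apply: measurable_funM => //; apply: mexp; apply: measurable_funB => //.
  by apply: measurable_funM => //; apply: measurable_funM => //; exact: measurable_dotp.
- move=> z _; rewrite normrM mulrC (gtr0_norm (gweight_gt0 _ _ _)); apply: ler_wpM2r => //.
  rewrite ler_expR gerBl; apply: mulr_ge0; last exact: expR_ge0.
  by apply: divr_ge0 => //; exact: dotp_ge0.
- by apply: integrableZl_R => //; exact: integrable_norm_R.
Qed.

(** The Fourier transform of a test function integrated against a Gaussian. *)
Lemma Rintegral_gauss_cosft (a : 'rV[R]_n -> R) eta sg : is_test a ->
  \int[m]_r (expR (- (expR sg * dotp r r)) * cosft a eta r) =
  Num.sqrt pi ^+ n * cos eta * \int[m]_z (a z * gweight n (dotp z z / 4) sg).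
Proof.
move=> ta; have s0 := expR_gt0 sg.
have ia := integrable_test ta; have ma := measurable_integrable ia.
pose J (p : 'rV[R]_n * 'rV[R]_n) := expR (- (expR sg * dotp p.1 p.1)) *
  (cos (- dotp p.2 p.1 + eta) * a p.2).
have iJ : (m \x m)%E.-integrable setT (EFin \o J).
  apply: (@integrable_prodM _ _ _ _ R m m _ (fun r => expR (- (expR sg * dotp r r)))
    (fun z => `|a z|)).
  - apply: measurable_funM; first exact: (measurableT_comp (@measurable_gauss R n (expR sg)) measurable_fst).
    apply: measurable_funM; last exact: (measurableT_comp ma measurable_snd).
    apply: mcos; apply: measurable_funD => //; apply: measurableT_comp => //.
    exact: measurable_dotp.
  - exact: integrable_gauss_rV.
  - exact: integrable_norm_R.
  - move=> x y; rewrite normrM ger0_norm ?expR_ge0//; apply: ler_wpM2l; first exact: expR_ge0.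
    by rewrite normrM ler_piMl.
transitivity (\int[m]_r \int[m]_z J (r, z)).
  apply: eq_Rintegral => r _.
  by rewrite /J /= (RintegralZl _ measurableT (integrable_cos_test eta r ta)).
rewrite (Rfubini iJ).
have E z : \int[m]_r J (r, z) = Num.sqrt pi ^+ n * cos eta * (a z * gweight n (dotp z z / 4) sg).
  have dN x y : dotp (- x : 'rV[R]_n) y = - dotp x y.
    by rewrite /dotp -sumrN; apply: eq_bigr => i _; rewrite mxE mulNr.
  have dNN : dotp (- z) (- z) = dotp z z.
    by rewrite /dotp; apply: eq_bigr => i _; rewrite mxE mulrNN.
  have ig : m.-integrable setT (EFin \o (fun r => expR (- (expR sg * dotp r r)) *
      cos (dotp (- z) r + eta))).
    apply: (@integrable_le _ _ _ m _ (fun r => expR (- (expR sg * dotp r r)))) => //.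
    - exact: measurable_gauss_cos.
    - by move=> r _; rewrite normrM ger0_norm ?expR_ge0// ler_piMr ?expR_ge0.
    - exact: integrable_gauss_rV.
  have := Rintegral_gauss_rV eta (- z) s0; rewrite dNN gaussE => e.
  rewrite (_ : _ * (a z * _) = a z * (Num.sqrt pi ^+ n * gweight n (dotp z z / 4) sg * cos eta));
    last by ring.
  rewrite -e -(RintegralZl _ measurableT ig); apply: eq_Rintegral => r _.
  by rewrite /J/= dN; ring.
under eq_Rintegral do rewrite E.
rewrite RintegralZl//.
exact: integrable_test_gweight.
Qed.

Let measurable_gauss_joint :
  measurable_fun setT (fun p : 'rV[R]_n * R => expR (- (expR p.2 * dotp p.1 p.1))).
Proof.
apply: mexp; apply: measurableT_comp => //; apply: measurable_funM.
  by apply: mexp; exact: measurable_snd.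
by apply: measurable_dotp; exact: measurable_fst.
Qed.

Let measurable_gweight_joint :
  measurable_fun setT (fun p : R * 'rV[R]_n => gweight n (dotp p.2 p.2 / 4) p.1).
Proof.
apply: mexp; apply: measurable_funB.
  by apply: measurableT_comp => //; apply: measurable_funM => //; exact: measurable_fst.
apply: measurable_funM.
  by apply: measurable_funM => //; apply: measurable_dotp; exact: measurable_snd.
by apply: mexp; apply: measurableT_comp => //; exact: measurable_fst.
Qed.

Lemma dagum_le1 (u : R) : 0 <= u -> `|dagum lambda delta u| <= 1.
Proof.
move=> u0; rewrite /dagum; have p0 := powR_ge0 u delta.
have q0 : 0 <= u `^ delta / (1 + u `^ delta) by rewrite divr_ge0// addr_ge0.
have q1 : u `^ delta / (1 + u `^ delta) <= 1.
  by rewrite ler_pdivrMr ?ltr_wpDr// mul1r lerDr.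
have h0 := powR_ge0 (u `^ delta / (1 + u `^ delta)) lambda.
have h1 : (u `^ delta / (1 + u `^ delta)) `^ lambda <= 1.
  have e1 : 1 `^ lambda = 1 :> R by rewrite powR1.
  by rewrite -[leRHS]e1; apply: ge0_ler_powR; rewrite ?nnegrE// ltW.
by rewrite ger0_norm; lra.
Qed.

Lemma measurable_dagum_enorm :
  measurable_fun setT (fun r : 'rV[R]_n => dagum lambda delta (enorm r)).
Proof.
have me : measurable_fun setT (fun r : 'rV[R]_n => enorm r).
  apply: (measurableT_comp (continuous_measurable_setT (@sqrt_continuous R))).
  exact: measurable_dotp.
have mp := measurableT_comp (measurable_powR delta) me.
apply: measurable_funB => //; apply: (measurableT_comp (measurable_powR lambda)).
apply: measurable_funM => //.
rewrite (_ : (fun r => _) = (fun r : 'rV[R]_n => (1 + enorm r `^ delta) `^ (- 1))).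
  by apply: (measurableT_comp (measurable_powR (- 1))); exact: measurable_funD.
by apply/funext => r; rewrite powR_inv1// addr_ge0// powR_ge0.
Qed.

Variable a : 'rV[R]_n -> R.
Hypothesis ta : is_test a.
Variable rho : R.
Hypotheses (rho0 : 0 < rho) (a_supp : forall z, a z != 0 -> rho <= dotp z z).

Let ia : m.-integrable setT (EFin \o a). Proof. exact: integrable_test. Qed.
Let ma : measurable_fun setT a. Proof. exact: measurable_integrable ia. Qed.

(** The Dagum function is paired with the Fourier transform of [a] by mixing
    over Gaussians; all the double integrals converge absolutely because the
    transform of [a] is integrable and [a] vanishes near the origin. *)
Lemma dagum_pairing eta :
  m.-integrable setT (EFin \o (fun r => dagum lambda delta (enorm r) * cosft a eta r)) /\
  \int[m]_r (dagum lambda delta (enorm r) * cosft a eta r) =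
  (2 * pi) ^+ n * cos eta * \int[m]_z (dagum_density n delta lambda (enorm z) * a z).
Proof.
pose J1 (p : 'rV[R]_n * R) := h p.2 * (expR (- (expR p.2 * dotp p.1 p.1)) * cosft a eta p.1).
have ic := integrable_cosft eta ta.
have iJ1 : (m \x mu)%E.-integrable setT (EFin \o J1).
  apply: (@integrable_prodM _ _ _ (measurableTypeR R) R m mu _ (fun r => `|cosft a eta r|)
    (fun sg => `|h sg|)).
  - apply: measurable_funM; first exact: (measurableT_comp mh measurable_snd).
    apply: measurable_funM => //.
    exact: (measurableT_comp (measurable_cosft eta ta) measurable_fst).
  - exact: integrable_norm_R.
  - exact: integrable_norm_R.
  - move=> r sg; rewrite normrM mulrC; apply: ler_wpM2r => //.
    rewrite normrM ler_piMl// ger0_norm ?expR_ge0// -[leRHS]expR0 ler_expR oppr_le0.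
    by apply: mulr_ge0; [exact: expR_ge0|exact: dotp_ge0].
have ig (u : R) : 0 < u -> mu.-integrable setT (EFin \o (fun sg => h sg * expR (- (expR sg * u ^+ 2)))).
  move=> u0; apply: (@integrable_le _ _ _ mu _ (fun sg => `|h sg|)) => //.
  - apply: measurable_funM => //; apply: mexp; apply: measurableT_comp => //.
    by apply: measurable_funM => //; apply: mexp.
  - move=> sg _; rewrite normrM ler_piMr// ger0_norm ?expR_ge0// -[leRHS]expR0 ler_expR oppr_le0.
    by apply: mulr_ge0; [exact: expR_ge0|exact: sqr_ge0].
  - exact: integrable_norm_R.
have E1 r : 0 < enorm r -> \int[mu]_sg J1 (r, sg) = dagum lambda delta (enorm r) * cosft a eta r.
  move=> r0; rewrite (dagum_mixture hdelta hlambda r0) -(RintegralZr _ measurableT (ig _ r0)).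
  by apply: eq_Rintegral => sg _; rewrite /J1 /= sqr_enorm; ring.
have iF := integrable_Rfubini1 iJ1.
have ae : ae_eq m setT (EFin \o (fun r => \int[mu]_sg J1 (r, sg)))
    (EFin \o (fun r => dagum lambda delta (enorm r) * cosft a eta r)).
  apply: filterS (ae_enorm_gt0 (ltnW hn)) => r r0 _.
  by rewrite /= E1.
have mD : measurable_fun setT (fun r => dagum lambda delta (enorm r) * cosft a eta r).
  by apply: measurable_funM; [exact: measurable_dagum_enorm|exact: measurable_cosft].
have iD : m.-integrable setT (EFin \o (fun r => dagum lambda delta (enorm r) * cosft a eta r)).
  apply: (@integrable_le _ _ _ m _ (fun r => `|cosft a eta r|)) => //.
    by move=> r _; rewrite normrM ler_piMl// dagum_le1// sqrtr_ge0.
  exact: integrable_norm_R.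
split => //.
transitivity (\int[m]_r \int[mu]_sg J1 (r, sg)).
  congr fine; apply/esym; apply: ae_eq_integral => //.
  - exact: measurable_int iF.
  - exact/measurable_EFinP.
rewrite (Rfubini iJ1).
pose J3 (p : R * 'rV[R]_n) := h p.1 * (a p.2 * gweight n (dotp p.2 p.2 / 4) p.1).
have iJ3 : (mu \x m)%E.-integrable setT (EFin \o J3).
  apply: (@integrable_prodM _ _ (measurableTypeR R) _ R mu m _ (fun sg => `|h sg|)
    (fun z => gweight_cst n (rho / 4) * `|a z|)).
  - apply: measurable_funM; first exact: (measurableT_comp mh measurable_fst).
    by apply: measurable_funM => //; exact: (measurableT_comp ma measurable_snd).
  - exact: integrable_norm_R.
  - by apply: integrableZl_R => //; exact: integrable_norm_R.
  - move=> sg z; rewrite normrM; apply: ler_wpM2l => //.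
    rewrite normrM mulrC; have [->|/a_supp az] := eqVneq (a z) 0; first by rewrite normr0 !mulr0.
    apply: ler_wpM2r => //; rewrite (gtr0_norm (gweight_gt0 _ _ _)).
    by apply: gweight_bound => //; rewrite ?divr_gt0// ler_wpM2r.
have E2 sg : \int[m]_r J1 (r, sg) = Num.sqrt pi ^+ n * cos eta * \int[m]_z J3 (sg, z).
  rewrite /J3 /= (RintegralZl _ measurableT (integrable_test_gweight sg ta)).
  rewrite mulrCA -Rintegral_gauss_cosft// /J1 /= RintegralZl//.
  apply: (@integrable_le _ _ _ m _ (fun r => `|cosft a eta r|)) => //.
  - by apply: measurable_funM; [exact: measurable_gauss|exact: measurable_cosft].
  - move=> r _; rewrite normrM ler_piMl// ger0_norm ?expR_ge0// -[leRHS]expR0 ler_expR oppr_le0.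
    by apply: mulr_ge0; [exact: expR_ge0|exact: dotp_ge0].
  - exact: integrable_norm_R.
under eq_Rintegral do rewrite E2.
rewrite RintegralZl//; last exact: (integrable_Rfubini1 iJ3).
rewrite (Rfubini iJ3).
have p4 : (4 * pi) `^ (n%:R / 2) != 0 :> R.
  by rewrite gt_eqF// powR_gt0// mulr_gt0// pi_gt0.
have E3 z : \int[mu]_sg J3 (sg, z) = (4 * pi) `^ (n%:R / 2) *
    (dagum_density n delta lambda (enorm z) * a z).
  rewrite /dagum_density powRN !mulrA mulfV// mul1r sqr_enorm.
  have [a0|/a_supp az] := eqVneq (a z) 0.
    by rewrite a0 mulr0; apply: Rintegral_eq0 => sg; rewrite /J3 /= a0 mul0r mulr0.
  rewrite -RintegralZr//.
    by apply: eq_Rintegral => sg _; rewrite /J3 /h /=; ring.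
  apply: (@integrable_le _ _ _ mu _ (fun sg => gweight_cst n (rho / 4) * `|h sg|)) => //.
  - apply: measurable_funM => //; apply: continuous_measurable_setT.
    exact: continuous_gweight.
  - move=> sg _; rewrite normrM mulrC; apply: ler_wpM2r => //.
    rewrite (gtr0_norm (gweight_gt0 _ _ _)).
    by apply: gweight_bound => //; rewrite ?divr_gt0// ler_wpM2r.
  - by apply: integrableZl_R => //; exact: integrable_norm_R.
have iE : m.-integrable setT (EFin \o (fun z => dagum_density n delta lambda (enorm z) * a z)).
  have := integrableZl_R ((4 * pi) `^ (n%:R / 2))^-1 measurableT (integrable_Rfubini2 iJ3).
  by under eq_fun do rewrite E3 mulKf//.
under eq_Rintegral do rewrite E3.
rewrite (RintegralZl _ measurableT iE) mulrA; congr (_ * _).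
rewrite mulrAC; congr (_ * _).
have s4 : Num.sqrt 4 = 2 :> R.
  by rewrite (_ : 4 = 2 ^+ 2 :> R) ?sqrtr_sqr ?ger0_norm// expr2 -natrM.
have q0 : 0 <= 4 * pi :> R by rewrite mulr_ge0// pi_ge0.
have -> : (4 * pi) `^ (n%:R / 2) = (2 * Num.sqrt pi) ^+ n :> R.
  rewrite (mulrC n%:R) powRrM powR12_sqrt// powR_mulrn ?sqrtr_ge0//; congr (_ ^+ _).
  by rewrite sqrtrM// s4.
rewrite -exprMn; congr (_ ^+ _); rewrite mulrCA -expr2 sqr_sqrtr// pi_ge0//.
Qed.

End pairing.

(** * The spectral density *)

Section density_continuity.
Context {R : realType}.
Variables (n : nat) (hn : (1 < n)%N) (delta lambda : R).
Hypotheses (hdelta : 0 < delta < 2) (hlambda : 0 < lambda).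
Notation mu := (@lebesgue_measure R).
Implicit Types (y sg : R).

Let h : R -> R := dagum_mix delta lambda.
Let ih : mu.-integrable setT (EFin \o h).
Proof. exact: integrable_dagum_mix. Qed.
Let mh : measurable_fun setT h. Proof. exact: measurable_integrable ih. Qed.

(** The derivative of the weight in [y] is, up to sign, the weight in dimension
    [n + 2], hence bounded away from [y = 0]. *)
Lemma gweight_lipschitz y0 y y' sg : 0 < y0 -> y0 <= y -> y0 <= y' ->
  `|gweight n y sg - gweight n y' sg| <= gweight_cst n.+2 y0 * `|y - y'|.
Proof.
move=> y00; wlog le : y y' / y' <= y => [W|] yy yy'.
  by have [?|/ltW ?] := leP y' y; [exact: W|rewrite distrC (distrC y); exact: W].
rewrite [X in _ <= _ * X]ger0_norm ?subr_ge0//.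
apply: (@le_dist_derive _ (fun y => gweight n y sg) (fun y => - gweight n.+2 y sg)) => //.
  move=> x _; have h1 := is_derive1B (is_derive1_cst (- (n%:R / 2 * sg)) x)
    (is_derive1M (is_derive1_id x) (is_derive1_cst (expR (- sg)) x)).
  apply: (is_derive_eq (is_derive1_expR h1)).
  rewrite mulr0 addr0 mul1r sub0r mulrN; congr (- _).
  rewrite /gweight -expRD; congr expR.
  by rewrite -addn2 natrD; field.
move=> x /andP[x1 x2]; rewrite normrN (gtr0_norm (gweight_gt0 _ _ _)).
by apply: gweight_bound => //; exact: le_trans x1.
Qed.

Let integrable_h_gweight y : 0 < y ->
  mu.-integrable setT (EFin \o (fun sg => h sg * gweight n y sg)).
Proof.
move=> y0; apply: (@integrable_le _ _ _ mu _ (fun sg => gweight_cst n y * `|h sg|)) => //.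
- apply: measurable_funM => //; apply: continuous_measurable_setT.
  exact: continuous_gweight.
- move=> sg _; rewrite normrM mulrC (gtr0_norm (gweight_gt0 _ _ _)); apply: ler_wpM2r => //.
  exact: gweight_bound.
- by apply: integrableZl_R => //; exact: integrable_norm_R.
Qed.

Lemma continuous_dagum_density (z : 'rV[R]_n) : z != 0 ->
  {for z, continuous (fun w : 'rV[R]_n => dagum_density n delta lambda (enorm w))}.
Proof.
move=> z0; pose y0 := dotp z z / 4 / 2; pose K := gweight_cst n.+2 y0 * \int[mu]_sg `|h sg|.
have dz := dotp_gt0 z0.
have y00 : 0 < y0 by rewrite !divr_gt0.
have cq : {for z, continuous (fun w : 'rV[R]_n => dotp w w / 4)}.
  apply: continuous_mul; last exact: continuous_const.
  apply: continuous_sum => i.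
  by apply: continuous_mul; exact: continuous_coord.
have FF : Filter (nbhs z) by exact: nbhs_filter.
have cy : `|dotp z z / 4 - dotp w w / 4| @[w --> z] --> (0 : R).
  rewrite -[X in _ --> X](normr0 R) -[X in `|X|](subrr (dotp z z / 4)).
  exact: (cvg_norm (cvgB (cvg_cst _) cq)).
have cK : K * `|dotp z z / 4 - dotp w w / 4| @[w --> z] --> (0 : R).
  by rewrite -[X in _ --> X](mulr0 K); exact: (cvgM (cvg_cst K) cy).
have near_y : \forall w \near z, y0 <= dotp w w / 4.
  have h1 : y0 < dotp z z / 4 by rewrite /y0 gtr_pMr ?invf_lt1 ?divr_gt0// ltr1n.
  exact: (cvgr_ge _ cq _ h1).
have cI : \int[mu]_sg (h sg * gweight n (dotp w w / 4) sg) @[w --> z] -->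
    \int[mu]_sg (h sg * gweight n (dotp z z / 4) sg).
  apply/cvgrPdist_le => e e0.
  have hK : \forall w \near z, K * `|dotp z z / 4 - dotp w w / 4| <= e.
    exact: (cvgr_le _ cK _ e0).
  apply: filterS2 near_y hK => w yw; apply: le_trans.
  have zy : y0 <= dotp z z / 4 by rewrite /y0 ler_piMr ?divr_ge0// ?dotp_ge0// invf_le1// ler1n.
  have i1 := integrable_h_gweight (lt_le_trans y00 zy).
  have i2 := integrable_h_gweight (lt_le_trans y00 yw).
  rewrite -(RintegralB measurableT i1 i2).
  apply: (le_trans (le_normr_Rintegral measurableT (integrableB_R measurableT i1 i2))).
  have i3 := integrable_norm_R measurableT ih.
  have -> : K * `|dotp z z / 4 - dotp w w / 4| =
      \int[mu]_sg (gweight_cst n.+2 y0 * `|dotp z z / 4 - dotp w w / 4| * `|h sg|).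
    by rewrite (RintegralZl _ measurableT i3) /K mulrAC.
  apply: le_Rintegral => //.
  - exact: (integrable_norm_R measurableT (integrableB_R measurableT i1 i2)).
  - exact: integrableZl_R.
  - move=> sg _; rewrite -mulrBr normrM mulrC; apply: ler_wpM2r => //.
    exact: gweight_lipschitz.
have E w : dagum_density n delta lambda (enorm w) =
    (4 * pi) `^ (- (n%:R / 2)) * \int[mu]_sg (h sg * gweight n (dotp w w / 4) sg).
  by rewrite /dagum_density sqr_enorm.
rewrite (_ : (fun w => _) = (fun w : 'rV[R]_n => (4 * pi) `^ (- (n%:R / 2)) *
    \int[mu]_sg (h sg * gweight n (dotp w w / 4) sg))); last by apply/funext.
exact: (cvgM (cvg_cst _) cI).
Qed.

End density_continuity.

Section existence.
Context {R : realType}.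
Variables (n : nat) (hn : (1 < n)%N) (delta lambda : R).
Hypotheses (hdelta : 0 < delta < 2) (hlambda : 0 < lambda).
Notation m := (@lebesgue_rV R n).
Implicit Types (z r : 'rV[R]_n) (phi : 'rV[R]_n -> R[i]).


Lemma test_function_is_test U phi : test_function U phi ->
  is_test (fun z => Re (phi z)) /\ is_test (fun z => Im (phi z)).
Proof.
by move=> [s1 s2 [S [cS _] pS]]; split; split => //; exists S => // x /pS ->.
Qed.

(** A test function supported off the origin vanishes near the origin. *)
Lemma test_function_support phi : test_function [set z | z != 0] phi ->
  exists2 rho : R, 0 < rho & forall z, phi z != 0 -> rho <= dotp z z.
Proof.
move=> [_ _ [S [cS S0] pS]].
have oS : open (~` S).
  by apply: closed_openC; apply: compact_closed => //; exact: norm_hausdorff.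
have n0 : nbhs (0 : 'rV[R]_n) (~` S).
  by apply: open_nbhs_nbhs; split => // /S0/=; rewrite eqxx.
have /nbhs_ballP[e /= e0 he] := n0.
exists (e ^+ 2) => [|z pz]; first by rewrite exprn_gt0.
rewrite leNgt; apply/negP => ze; move/eqP: pz; apply; apply: pS; apply: he.
split => // i j; rewrite ord1 mxE -ball_normE /ball_/= sub0r normrN.
rewrite -(@ltr_pXn2r _ 2) ?nnegrE ?(ltW e0)// real_normK ?num_real//.
apply: le_lt_trans ze; rewrite /dotp (bigD1 j)//= -expr2 lerDl.
by apply: sumr_ge0 => k _; rewrite -expr2 sqr_ge0.
Qed.

Lemma fourierE phi r : is_test (fun z => Re (phi z)) -> is_test (fun z => Im (phi z)) ->
  Re (fourier phi r) = (2 * pi) ^- n * (cosft (fun z => Re (phi z)) 0 r +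
    cosft (fun z => Im (phi z)) (pi / 2) r) /\
  Im (fourier phi r) = (2 * pi) ^- n * (cosft (fun z => Im (phi z)) 0 r +
    cosft (fun z => Re (phi z)) (- (pi / 2)) r).
Proof.
move=> ta tb; rewrite /fourier ReM ImM /= !mul0r subr0 addr0.
split; congr (_ * _); rewrite /cosft -RintegralD//; try exact: integrable_cos_test;
  apply: eq_Rintegral => z _; rewrite ?ReM ?ImM /= expR0 !mul1r addr0.
  by rewrite cosDpihalf mulNr.
by rewrite cosBpihalf.
Qed.

Lemma dagum_density_fourier : dagum_spectral_density delta lambda
  (fun z : 'rV[R]_n => (dagum_density n delta lambda (enorm z))%:C).
Proof.
split=> [z z0|phi tphi].
  split; first exact: continuous_dagum_density.
  exact: (@continuous_const R _ 0 z).
have [ta tb] := test_function_is_test tphi.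
have [rho rho0 supp] := test_function_support tphi.
have sa z : Re (phi z) != 0 -> rho <= dotp z z.
  by move=> h; apply: supp; apply: contraNneq h => ->.
have sb z : Im (phi z) != 0 -> rho <= dotp z z.
  by move=> h; apply: supp; apply: contraNneq h => ->.
have Pa eta := dagum_pairing hn hdelta hlambda ta rho0 sa eta.
have Pb eta := dagum_pairing hn hdelta hlambda tb rho0 sb eta.
have p0 : (2 * pi) ^+ n != 0 :> R by rewrite expf_neq0// gt_eqF// mulr_gt0// pi_gt0.
have key (f g : 'rV[R]_n -> R) (th : R) : cos th = 0 ->
    (forall eta, m.-integrable setT (EFin \o (fun r => dagum lambda delta (enorm r) * cosft f eta r)) /\
      \int[m]_r (dagum lambda delta (enorm r) * cosft f eta r) = (2 * pi) ^+ n * cos eta *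
      \int[m]_z (dagum_density n delta lambda (enorm z) * f z)) ->
    (forall eta, m.-integrable setT (EFin \o (fun r => dagum lambda delta (enorm r) * cosft g eta r)) /\
      \int[m]_r (dagum lambda delta (enorm r) * cosft g eta r) = (2 * pi) ^+ n * cos eta *
      \int[m]_z (dagum_density n delta lambda (enorm z) * g z)) ->
    \int[m]_r (dagum lambda delta (enorm r) * ((2 * pi) ^- n * (cosft f 0 r + cosft g th r))) =
    \int[m]_z (dagum_density n delta lambda (enorm z) * f z).
  move=> c0 Pf Pg; have [f1 f2] := Pf 0; have [g1 g2] := Pg th.
  transitivity (\int[m]_r ((2 * pi) ^- n * (dagum lambda delta (enorm r) * cosft f 0 r +
      dagum lambda delta (enorm r) * cosft g th r))).
    by apply: eq_Rintegral => r _; ring.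
  rewrite (RintegralZl _ measurableT (integrableD_R measurableT f1 g1)).
  rewrite (RintegralD measurableT f1 g1) f2 g2 c0 cos0 mulr0 mul0r addr0 mulr1.
  by rewrite mulKf.
have cRe (f : 'rV[R]_n -> R[i]) : Re (cintegral m setT f) = \int[m]_r Re (f r) by [].
have cIm (f : 'rV[R]_n -> R[i]) : Im (cintegral m setT f) = \int[m]_r Im (f r) by [].
apply: complex_eqP; rewrite ?cRe ?cIm.
  transitivity (\int[m]_r (dagum lambda delta (enorm r) * ((2 * pi) ^- n *
      (cosft (fun z => Re (phi z)) 0 r + cosft (fun z => Im (phi z)) (pi / 2) r)))).
    by apply: eq_Rintegral => r _; rewrite ReM (fourierE r ta tb).1 /= mul0r subr0.
  rewrite (key _ _ _ (@cos_pihalf R) Pa Pb).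
  by apply: eq_Rintegral => z _; rewrite ReM/= mul0r subr0.
transitivity (\int[m]_r (dagum lambda delta (enorm r) * ((2 * pi) ^- n *
    (cosft (fun z => Im (phi z)) 0 r + cosft (fun z => Re (phi z)) (- (pi / 2)) r)))).
  by apply: eq_Rintegral => r _; rewrite ImM (fourierE r ta tb).2 /= mul0r addr0.
rewrite (key _ _ _ _ Pb Pa); last by rewrite cosN cos_pihalf.
by apply: eq_Rintegral => z _; rewrite ImM/= mul0r addr0.
Qed.

End existence.

(** * Bump functions *)

Section bump.
Context {R : realType}.
Implicit Types (p : {poly R}) (x y : R).

Lemma is_derive_quadratic (f : R -> R) x (C : R) :
  (forall y, `|f y| <= C * (y - x) ^+ 2) -> is_derive x 1 f 0.
Proof.
move=> fC; have fx : f x = 0.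
  by apply/eqP; rewrite -normr_le0 (le_trans (fC x))// subrr expr0n/= mulr0.
have C0 : 0 <= C.
  by have := le_trans (normr_ge0 _) (fC (x + 1)); rewrite addrAC subrr add0r expr1n mulr1.
have H : h^-1 *: ((f \o shift x) (h *: 1) - f x) @[h --> (0 : R)^'] --> (0 : R).
  apply/cvgrPdist_le => e e0; have C1 : 0 < C + 1 by rewrite ltr_wpDl.
  near=> h; rewrite /= fx subr0 sub0r normrN normrZ normfV [h *: 1]mulr1.
  have [->|h0] := eqVneq h 0; first by rewrite normr0 invr0 mul0r ltW.
  rewrite ler_pdivrMl ?normr_gt0// (le_trans (fC _))// addrK -real_normK ?num_real//.
  rewrite expr2 mulrA mulrC; apply: ler_wpM2l => //.
  apply: (@le_trans _ _ ((C + 1) * (e / (C + 1)))); last by rewrite mulrCA mulfV ?mulr1// gt_eqF.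
  apply: ler_pM => //; first by rewrite lerDl.
  by near: h; apply: dnbhs0_le; rewrite divr_gt0.
split; first by apply: (cvgP 0).
exact: cvg_lim H.
Unshelve. all: by end_near. Qed.

(** The family [p * (1 - x ^ 2) ^- m * expR (- (1 - x ^ 2)^-1)] on [-1, 1],
    which is stable under differentiation. *)
Definition bump p (m : nat) x : R := if `|x| < 1 then
  p.[x] * (1 - x ^+ 2) ^- m * expR (- (1 - x ^+ 2)^-1) else 0.

Definition bump_deriv p (m : nat) : {poly R} :=
  p^`() * (1 - 'X ^+ 2) ^+ 2 + (m%:R * 2)%:P * 'X * p * (1 - 'X ^+ 2) - 2%:P * 'X * p.

Lemma bump_out p m x : 1 <= `|x| -> bump p m x = 0.
Proof. by move=> h; rewrite /bump ltNge h. Qed.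

Lemma bumpZ (k : R) p m x : bump (k *: p) m x = k * bump p m x.
Proof. by rewrite /bump; case: ifP => _; rewrite ?mulr0// hornerZ !mulrA. Qed.

Let sqr_lt1 x : `|x| < 1 -> 0 < 1 - x ^+ 2.
Proof.
move=> x1; rewrite subr_gt0 -(real_normK (num_real x)).
by rewrite expr_lt1.
Qed.

(** The exponential beats the poles: flatness at the end points. *)
Lemma bump_flat p m : exists C, forall x y, 1 <= `|x| ->
  `|bump p m y| <= C * (y - x) ^+ 2.
Proof.
pose B := \sum_(i < size p) `|p`_i|; exists (4 * (B * (m.+2)`!%:R)) => x y x1.
have B0 : 0 <= B by apply: sumr_ge0.
have [y1|y1] := ltP `|y| 1; last first.
  by rewrite bump_out// normr0 mulr_ge0 ?sqr_ge0// mulr_ge0// mulr_ge0.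
rewrite /bump y1; have u0 := sqr_lt1 y1; set u := 1 - y ^+ 2 in u0 *.
have pB : `|p.[y]| <= B.
  rewrite horner_coef; apply: (le_trans (ler_norm_sum _ _ _)); apply: ler_sum => i _.
  by rewrite normrM ler_piMr// normrX exprn_ile1// ltW.
have uq : 0 < u^-1 by rewrite invr_gt0.
have f0 : 0 < (m.+2)`!%:R :> R by rewrite ltr0n fact_gt0.
have e1 : u ^- m * expR (- u^-1) <= (m.+2)`!%:R * u ^+ 2.
  have := @expR_ge1Dxn _ u^-1 m.+1 (ltW uq); rewrite expRN.
  move=> h; have {}h : u^-1 ^+ m.+2 / (m.+2)`!%:R <= expR u^-1 by lra.
  rewrite ler_pdivrMr ?expR_gt0//.
  apply: (@le_trans _ _ ((m.+2)`!%:R * u ^+ 2 * (u^-1 ^+ m.+2 / (m.+2)`!%:R))).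
    rewrite -addn2 exprD exprVn (exprVn u 2); move: (u ^- m) => v.
    rewrite (_ : _ * (v * _ / _) = v)//; field.
    by rewrite !gt_eqF// addn2.
  by apply: ler_wpM2l => //; rewrite mulr_ge0// ?sqr_ge0// ltW.
have uy : u <= 2 * `|y - x|.
  have h1 : 1 - `|y| <= `|y - x|.
    by rewrite distrC; apply: le_trans (lerB_dist x y); exact: lerB.
  apply: (@le_trans _ _ (2 * (1 - `|y|))); last by apply: ler_wpM2l.
  rewrite /u -(real_normK (num_real y)); move: `|y| y1 (normr_ge0 y) => a a1 a0; nra.
have u2 : u ^+ 2 <= 4 * (y - x) ^+ 2.
  rewrite -(real_normK (num_real (y - x))) (_ : 4 = 2 ^+ 2) -?exprMn; last by ring.
  by rewrite ler_pXn2r ?nnegrE ?mulr_ge0// ltW.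
rewrite -mulrA normrM; have w0 : 0 <= u ^- m * expR (- u^-1).
  by rewrite mulr_ge0 ?expR_ge0// invr_ge0 exprn_ge0// ltW.
rewrite (ger0_norm w0); apply: (@le_trans _ _ (B * ((m.+2)`!%:R * u ^+ 2))).
  exact: ler_pM.
rewrite (_ : 4 * _ * _ = B * ((m.+2)`!%:R * (4 * (y - x) ^+ 2))); last by ring.
by apply: ler_wpM2l => //; apply: ler_wpM2l => //; exact: ltW.
Qed.

Lemma is_derive_bump p m x : is_derive x 1 (bump p m) (bump (bump_deriv p m) m.+2 x).
Proof.
have [x1|x1] := ltP `|x| 1; last first.
  by have [C hC] := bump_flat p m;
    rewrite bump_out//;
    exact: (@is_derive_quadratic _ x C (fun y => hC x y x1)).
have u0 := sqr_lt1 x1; have un : 1 - x ^+ 2 != 0 by rewrite gt_eqF.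
pose u y := 1 - y ^+ 2 : R; have ux : u x != 0 := un.
have du : is_derive x 1 u (- (2 * x)).
  apply: (is_derive_eq (is_derive1B (is_derive1_cst 1 x) (is_derive1M (is_derive1_id x) (is_derive1_id x)))).
  by ring.
have dq := @is_derive1V R u x _ un du.
have dqm : is_derive x 1 (fun y => (u y)^-1 ^+ m) (m%:R * (2 * x) * (u x)^-1 ^+ m.+1).
  elim: m => [|k IH].
    apply: (is_derive_eq (is_derive1_cst 1 x)); by rewrite !mul0r.
  rewrite (_ : (fun y => (u y)^-1 ^+ k.+1) = (fun y => (u y)^-1 * (u y)^-1 ^+ k)); last first.
    by apply/funext => y; rewrite exprS.
  apply: (is_derive_eq (is_derive1M dq IH)).
  rewrite -[k.+1%:R]natr1 !exprS; move: (u x) ux => w wn; by field.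
have dp : is_derive x 1 (fun y => p.[y]) p^`().[x].
  by split; [exact: derivable_horner|rewrite -derive1E -derivE].
have dE := is_derive1_expR (is_derive1N dq).
have near1 : \forall y \near x, p.[y] * (u y)^-1 ^+ m * expR (- (u y)^-1) = bump p m y.
  have : \forall y \near x, `|y| < 1.
    have h : `|y| @[y --> x] --> `|x| by apply: cvg_norm; exact: cvg_id.
    exact: (cvgr_lt _ h _ x1).
  by apply: filterS => y y1; rewrite /bump y1 exprVn.
apply: (near_eq_is_derive near1).
apply: (is_derive_eq (is_derive1M (is_derive1M dp dqm) dE)).
have -> : bump (bump_deriv p m) m.+2 x = (p^`().[x] * u x ^+ 2 + m%:R * 2 * x * p.[x] * u x -
    2 * x * p.[x]) * ((u x)^-1 ^+ m * (u x)^-1 * (u x)^-1) * expR (- (u x)^-1).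
  rewrite /bump x1 /bump_deriv -exprVn !(hornerD, hornerN, hornerM, hornerC, hornerX, horner_exp).
  rewrite -/(u x) (exprSr _ m.+1) (exprSr _ m).
  by move: (expR _) ((u x)^-1 ^+ m) => e V; ring.
rewrite exprS; move: (u x) ux => w wn; move: (w^-1 ^+ m) (expR _) => V e.
by field.
Qed.

End bump.

Section product_bump.
Context {R : realType}.
Variables (n : nat) (c : 'rV[R]_n) (eps : R).
Hypothesis eps0 : 0 < eps.
Notation mu := (@lebesgue_measure R).
Notation m := (@lebesgue_rV R n).
Notation e_ i := (delta_mx ord0 i).

Let sc (i : 'I_n) (t : R) : R := (t - c ord0 i) / eps.

Definition prodbump (P : 'I_n -> {poly R}) (M : 'I_n -> nat) (z : 'rV[R]_n) : R :=
  \prod_i bump (P i) (M i) (sc i (z ord0 i)).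

Lemma is_derive_sbump p k i (t : R) : is_derive t 1 (fun t => bump p k (sc i t))
  (bump (eps^-1 *: bump_deriv p k) k.+2 (sc i t)).
Proof.
have h1 : is_derive t 1 (sc i) eps^-1.
  apply: (is_derive_eq (is_derive1M (is_derive1B (is_derive1_id t) (is_derive1_cst (c ord0 i) t))
    (is_derive1_cst eps^-1 t))).
  by rewrite subr0 mul1r mulr0 addr0.
apply: (is_derive_eq (is_derive1_comp h1 (is_derive_bump p k (sc i t)))).
by rewrite bumpZ mulrC.
Qed.

Lemma continuous_sbump p k i : continuous (fun t => bump p k (sc i t)).
Proof. exact: is_derive1_continuousT (is_derive_sbump p k i). Qed.

Lemma continuous_prodbump P M : continuous (prodbump P M).
Proof.
apply: continuous_prod => i.
by have := continuous_compR (@continuous_sbump (P i) (M i) i) (@continuous_coord R n i); exact.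
Qed.

Lemma pderiv_prodbump i P M : pderiv i (prodbump P M)
  (prodbump (fun j => if j == i then eps^-1 *: bump_deriv (P i) (M i) else P j)
            (fun j => if j == i then (M i).+2 else M j)).
Proof.
move=> x s.
have ci (u : R) : (u *: e_ i + x) ord0 i = u + x ord0 i by rewrite !mxE !eqxx mulr1.
have cj (u : R) j : j != i -> (u *: e_ i + x) ord0 j = x ord0 j.
  by move=> ji; rewrite !mxE (negPf ji) andbF mulr0 add0r.
pose K := \prod_(j | j != i) bump (P j) (M j) (sc j (x ord0 j)).
have E : (fun u => prodbump P M (u *: e_ i + x)) =
    (fun u => bump (P i) (M i) (sc i (u + x ord0 i)) * K).
  apply/funext => u; rewrite /prodbump (bigD1 i)//= ci; congr (_ * _).
  by apply: eq_bigr => j ji; rewrite cj.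
have h0 : is_derive s 1 (fun u => u + x ord0 i) 1.
  by apply: (is_derive_eq (is_derive1D (is_derive1_id s) (is_derive1_cst (x ord0 i) s))); rewrite addr0.
have h1 := is_derive1_comp h0 (is_derive_sbump (P i) (M i) i (s + x ord0 i)).
rewrite E; apply: (is_derive_eq (is_derive1M h1 (is_derive1_cst K s))).
rewrite mulr0 addr0 mulr1 /prodbump (bigD1 i)//= ci eqxx; congr (_ * _).
by apply: eq_bigr => j ji; rewrite cj// (negPf ji).
Qed.

Lemma smooth_prodbump P M : smooth (prodbump P M).
Proof.
move=> k; elim: k P M => [|k IH] P M /=; split => //; try exact: continuous_prodbump.
move=> i; have [h1 h2] := pderivE (pderiv_prodbump i P M).
by split => //; rewrite h2; exact: IH.
Qed.

Let psi := prodbump (fun=> 1) (fun=> 0%N).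

Lemma prodbump_ge0 z : 0 <= psi z.
Proof.
apply: prodr_ge0 => i _; rewrite /bump; case: ifP => // _.
by rewrite hornerC expr0 invr1 !mul1r expR_ge0.
Qed.

Lemma prodbump_support P M z : prodbump P M z != 0 -> forall i, `|z ord0 i - c ord0 i| < eps.
Proof.
move=> pz i; rewrite ltNge; apply/negP => h; move/eqP: pz; apply.
rewrite /prodbump (bigD1 i)//= bump_out ?mul0r// /sc normrM normfV (gtr0_norm eps0).
by rewrite ler_pdivlMr// mul1r.
Qed.

Lemma compact_box : compact [set z : 'rV[R]_n | forall i, `[c ord0 i - eps, c ord0 i + eps]%classic (z ord0 i)].
Proof.
apply: (@rV_compact R n (fun i => `[c ord0 i - eps, c ord0 i + eps]%classic)) => i.
exact: segment_compact.
Qed.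

Lemma prodbump_box P M z :
  ~ [set z : 'rV[R]_n | forall i, `[c ord0 i - eps, c ord0 i + eps]%classic (z ord0 i)] z ->
  prodbump P M z = 0.
Proof.
move=> nz; apply/eqP; apply: contra_notT nz => /prodbump_support h i /=.
by rewrite in_itv/=; have := h i; rewrite ltr_norml => /andP[h1 h2]; apply/andP; split; lra.
Qed.

Lemma is_test_prodbump : is_test psi.
Proof.
split; first exact: smooth_prodbump.
by eexists; [exact: compact_box|move=> z; exact: prodbump_box].
Qed.

Lemma Rintegral_gt0_itv (f : R -> R) a b : a < b -> mu.-integrable setT (EFin \o f) ->
  (forall x, 0 <= f x) -> (forall x, a < x < b -> 0 < f x) -> 0 < \int[mu]_x f x.
Proof.
move=> ab fi f0 fab; rewrite lt_neqAle Rintegral_ge0 ?andbT//.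
apply/eqP => h.
have : (\int[mu]_x `|(EFin \o f) x| = 0)%E.
  under eq_integral do rewrite /= ger0_norm//.
  by rewrite -EFin_Rintegral// -h.
move/(@ae_eq_integral_abs _ _ _ mu setT measurableT _ (measurable_int _ fi)).
case=> N [mN N0 sub].
have : mu `]a, b[ = 0.
  apply/eqP; rewrite -measure_le0 -N0 le_measure ?inE//.
  move=> x; rewrite /= in_itv/= => xab; apply: sub => /= /(_ I) [h0].
  by have := fab x xab; rewrite h0 ltxx.
rewrite lebesgue_measure_itv/= lte_fin ab => /eqP.
by rewrite -EFinB eqe subr_eq0 gt_eqF.
Qed.

Let sbump0 i t : 0 <= bump 1 0 (sc i t) <= 1.
Proof.
rewrite /bump; case: ifP => [h|_]; last by rewrite lexx ler01.
rewrite hornerC expr0 invr1 !mul1r expR_ge0/= -[leRHS]expR0 ler_expR oppr_le0 invr_ge0.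
by rewrite subr_ge0 -(real_normK (num_real _)) exprn_ile1// ltW.
Qed.

Lemma integrable_sbump i : mu.-integrable setT (EFin \o (fun t => bump 1 0 (sc i t))).
Proof.
apply: (@integrable_le _ _ _ mu _ (fun t => expR 1 * expR (- (eps^-1 * `|t - c ord0 i|)))) => //.
- by apply: continuous_measurable_setT; exact: continuous_sbump.
- move=> t _; have /andP[b0 b1] := sbump0 i t; rewrite ger0_norm//.
  have [t1|t1] := ltP `|sc i t| 1; last by rewrite bump_out// mulr_ge0 ?expR_ge0.
  rewrite (le_trans b1)// -expRD -[leLHS]expR0 ler_expR subr_ge0.
  by rewrite mulrC -[X in _ * X](gtr0_norm (_ : 0 < eps^-1)) ?invr_gt0// -normrM ltW.
- by apply: integrableZl_R => //; apply: integrable_expRN_norm; rewrite invr_gt0.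
Qed.

Lemma Rintegral_prodbump_gt0 : 0 < \int[m]_z psi z.
Proof.
have [_ ->] := integrable_rV_prod integrable_sbump.
apply: prodr_gt0 => i _; apply: (@Rintegral_gt0_itv _ (c ord0 i - eps) (c ord0 i + eps)).
- by rewrite ltrBlDr -addrA ltrDl addr_gt0.
- exact: integrable_sbump.
- by move=> t; have /andP[] := sbump0 i t.
- move=> t /andP[t1 t2]; rewrite /bump ifT.
    by rewrite hornerC expr0 invr1 !mul1r expR_gt0.
  rewrite /sc normrM normfV (gtr0_norm eps0) ltr_pdivrMr// mul1r ltr_norml.
  by apply/andP; split; lra.
Qed.

End product_bump.

(** * Uniqueness of the density *)

Section uniqueness.
Context {R : realType}.
Variable n : nat.
Notation m := (@lebesgue_rV R n).
Implicit Types (F G : 'rV[R]_n -> R) (z : 'rV[R]_n).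

(** A continuous function times a test function is continuous across the
    origin, whatever its value there. *)
Lemma continuous_mul_test F a (S : set 'rV[R]_n) : (forall z, z != 0 -> {for z, continuous F}) ->
  continuous a -> compact S -> S `<=` [set z | z != 0] -> (forall z, ~ S z -> a z = 0) ->
  continuous (fun z => F z * a z).
Proof.
move=> cF ca cS S0 aS z; have [->|z0] := eqVneq z 0; last exact: (cvgM (cF z z0) (ca z)).
have oS : open (~` S).
  by apply: closed_openC; apply: compact_closed => //; exact: norm_hausdorff.
have n0 : nbhs (0 : 'rV[R]_n) (~` S).
  by apply: open_nbhs_nbhs; split => // /S0/=; rewrite eqxx.
have E : \forall w \near (0 : 'rV[R]_n), 0 = F w * a w.
  by apply: filterS n0 => w /aS ->; rewrite mulr0.
have a0 : a 0 = 0 by apply: aS => /S0/=; rewrite eqxx.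
rewrite /continuous_at a0 mulr0; have FF : Filter (nbhs (0 : 'rV[R]_n)) by exact: nbhs_filter.
exact: (cvg_trans (near_eq_cvg E) (cvg_cst 0)).
Qed.

Lemma density_le F G :
  (forall z, z != 0 -> {for z, continuous F}) -> (forall z, z != 0 -> {for z, continuous G}) ->
  (forall a : 'rV[R]_n -> R, is_test a -> (exists2 S : set 'rV[R]_n, compact S /\ S `<=` [set z | z != 0] &
      forall z, ~ S z -> a z = 0) -> \int[m]_z (F z * a z) = \int[m]_z (G z * a z)) ->
  forall z, z != 0 -> F z <= G z.
Proof.
move=> cF cG FG c c0; rewrite leNgt; apply/negP => GF.
pose k := (F c - G c) / 2; have k0 : 0 < k by rewrite divr_gt0// subr_gt0.
have FF : Filter (nbhs c) by exact: nbhs_filter.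
have near1 : \forall w \near c, k < F w - G w.
  have h : {for c, continuous (fun w => F w - G w)} by exact: (cvgB (cF c c0) (cG c c0)).
  have hk : k < F c - G c by rewrite /k gtr_pMr ?subr_gt0// invf_lt1// ltr1n.
  exact: (cvgr_gt _ h _ hk).
have near2 : \forall w \near c, w != 0.
  have : open [set w : 'rV[R]_n | w != 0].
    have -> : [set w : 'rV[R]_n | w != 0] = ~` [set 0] by apply/seteqP; split => w /= /eqP.
    apply: closed_openC; apply: compact_closed; last exact: compact_set1.
    exact: norm_hausdorff.
  by move=> o; exact: open_nbhs_nbhs.
have near12 : nbhs c [set w : 'rV[R]_n | k < F w - G w /\ w != 0].
  exact: (filterI near1 near2).
have /nbhs_ballP[e /= e0 he] := near12.
pose eps := e / 2; have eps0 : 0 < eps by rewrite divr_gt0.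
pose psi := prodbump c eps (fun=> 1) (fun=> 0%N).
pose S := [set z : 'rV[R]_n | forall i, `[c ord0 i - eps, c ord0 i + eps]%classic (z ord0 i)].
have cS : compact S by exact: compact_box.
have SB z : S z -> k < F z - G z /\ z != 0.
  move=> Sz; apply: he; split => // i j; rewrite ord1 -ball_normE /ball_/=.
  have := Sz j; rewrite /= in_itv/= => /andP[h1 h2].
  have ee : eps < e by rewrite /eps gtr_pMr// invf_lt1// ltr1n.
  by rewrite ltr_norml; apply/andP; split; lra.
have S0 : S `<=` [set z | z != 0] by move=> z /SB[].
have tpsi : is_test psi by exact: is_test_prodbump.
have psi0 z : ~ S z -> psi z = 0 by exact: prodbump_box.
have cpsi := is_test_continuous tpsi.
have int (H : 'rV[R]_n -> R) : (forall z, z != 0 -> {for z, continuous H}) ->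
    m.-integrable setT (EFin \o (fun z => H z * psi z)).
  move=> cH; have cHp := continuous_mul_test cH cpsi cS S0 psi0.
  have HS z : ~ S z -> H z * psi z = 0 by move=> /psi0 ->; rewrite mulr0.
  have [C _ hC] := compact_support_le cHp cS HS.
  exact: integrable_le_invsqr (continuous_measurable_rV cHp) hC.
have := FG psi tpsi (ex_intro2 _ _ S (conj cS S0) psi0).
have ip := integrable_test tpsi.
have : k * \int[m]_z psi z <= \int[m]_z (F z * psi z) - \int[m]_z (G z * psi z).
  rewrite -(RintegralB measurableT (int _ cF) (int _ cG)) -(RintegralZl _ measurableT ip).
  apply: le_Rintegral => //.
  - exact: integrableZl_R.
  - exact: (integrableB_R measurableT (int _ cF) (int _ cG)).
  - move=> z _; rewrite -mulrBl; have [Sz|/psi0 ->] := pselect (S z); last by rewrite !mulr0.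
    by apply: ler_wpM2r; [exact: prodbump_ge0|have [/ltW] := SB z Sz].
move=> + e1; rewrite e1 subrr leNgt => /negP; apply.
by rewrite mulr_gt0//; exact: Rintegral_prodbump_gt0.
Qed.


Lemma smooth_cst (k : R) : smooth ((fun=> k) : 'rV[R]_n -> R).
Proof.
move=> j; elim: j k => [|j IH] k /=; split => //; try exact: continuous_const.
move=> i; split; first by move=> x; exact: derivable_cst.
rewrite (_ : 'D_(delta_mx ord0 i) _ = ((fun=> 0) : 'rV[R]_n -> R)); first exact: IH.
by apply/funext => x; exact: derive_cst.
Qed.

Lemma fourier_density_unique g (F G : 'rV[R]_n -> R[i]) :
  fourier_density g F -> fourier_density g G -> forall z, z != 0 -> F z = G z.
Proof.
move=> [cF hF] [cG hG] z z0.
have pair a : is_test a -> (exists2 S : set 'rV[R]_n, compact S /\ S `<=` [set z | z != 0] &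
      forall z, ~ S z -> a z = 0) ->
    \int[m]_z (Re (F z) * a z) = \int[m]_z (Re (G z) * a z) /\
    \int[m]_z (Im (F z) * a z) = \int[m]_z (Im (G z) * a z).
  move=> [sa _] [S hS aS].
  have tphi : test_function [set z | z != 0] (fun z => (a z)%:C).
    split => //; first exact: smooth_cst.
    by exists S => // x /aS ->.
  have e := etrans (esym (hF _ tphi)) (hG _ tphi).
  have cRe (H : 'rV[R]_n -> R[i]) : \int[m]_z (Re (H z) * a z) =
      Re (cintegral m setT (fun z => H z * (a z)%:C)).
    by apply: eq_Rintegral => x _; rewrite ReM /= mulr0 subr0.
  have cIm (H : 'rV[R]_n -> R[i]) : \int[m]_z (Im (H z) * a z) =
      Im (cintegral m setT (fun z => H z * (a z)%:C)).
    by apply: eq_Rintegral => x _; rewrite ImM /= mulr0 add0r.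
  by rewrite !cRe !cIm e.
have cRe (H : 'rV[R]_n -> R[i]) : (forall z, z != 0 ->
    {for z, continuous (fun z => Re (H z))} /\ {for z, continuous (fun z => Im (H z))}) ->
    forall z, z != 0 -> {for z, continuous (fun z => Re (H z))}.
  by move=> h w /h[].
have cIm (H : 'rV[R]_n -> R[i]) : (forall z, z != 0 ->
    {for z, continuous (fun z => Re (H z))} /\ {for z, continuous (fun z => Im (H z))}) ->
    forall z, z != 0 -> {for z, continuous (fun z => Im (H z))}.
  by move=> h w /h[].
apply: complex_eqP; apply/eqP; rewrite eq_le; apply/andP; split.
- apply: (density_le (cRe F cF) (cRe G cG) _ z0) => a ta sa; exact: (pair a ta sa).1.
- apply: (density_le (cRe G cG) (cRe F cF) _ z0) => a ta sa; exact: esym (pair a ta sa).1.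
- apply: (density_le (cIm F cF) (cIm G cG) _ z0) => a ta sa; exact: (pair a ta sa).2.
- apply: (density_le (cIm G cG) (cIm F cF) _ z0) => a ta sa; exact: esym (pair a ta sa).2.
Qed.

End uniqueness.
Theorem theorem3p2 (R : realType) (d : nat) (delta lambda : R)
    (hd : (1 < d)%N) (hdelta : 0 < delta < 2) (hlambda : 0 < lambda)
    (hdl : 0 < delta * lambda <= 2) :
  (exists F : 'rV[R]_d -> R[i], dagum_spectral_density delta lambda F) /\
  (forall F : 'rV[R]_d -> R[i], dagum_spectral_density delta lambda F ->
   forall z : 'rV[R]_d, z != 0 ->
     cintegrable lebesgue_measure `]0, +oo[
       (dagum_integrand d delta lambda (enorm z)) /\
     F z =
       (- (enorm z `^ (1 - d%:R / 2)
           / (2 `^ (d%:R / 2 - 1) * pi `^ (d%:R / 2 + 1)))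
        * complex.Im (cintegral lebesgue_measure `]0, +oo[
                (dagum_integrand d delta lambda (enorm z))))%:C).
Proof.
have F0 := dagum_density_fourier hd hdelta hlambda.
split=> [|F hF z z0]; first by eexists; exact: F0.
have e0 : 0 < enorm z by rewrite sqrtr_gt0 dotp_gt0.
split; first exact: cintegrable_dagum_integrand.
by rewrite (fourier_density_unique hF F0 z0) dagum_densityE.
Qed.
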